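(* Let $0<L<\infty$, $\mathsf a>0$, $\Omega=(-L,L)$, $\Omega_1=(-L-1,L+1)$, and let $\bar f\in L^2(\Omega_1)$. For $\lambda\in H^1_0(\Omega)$ (extended by zero outside $\Omega$) define $$\tilde S[\lambda]=\inf_{f\in L^2(\Omega_1)}\int_{\Omega_1}\Big(-\lambda' f+\tfrac{f^2}{2}(\lambda_{x-1}-\lambda_{x+1})+\tfrac{\mathsf a}{2}(f-\bar f)^2\Big)\,dx .$$ Then the following hold. (1) $\tilde S$ is given by the formula $$\tilde S[\lambda]=\begin{cases} S_L[\lambda] & \text{if for a.e. } x\in\Omega_1:\ \Delta_\lambda(x)\ge 0,\ \text{and } \lambda'(x)+\mathsf a\bar f(x)=0 \text{ whenever } \Delta_\lambda(x)=0,\\ -\infty & \text{otherwise,}\end{cases}$$ and $\tilde S$ maps $H^1_0(\Omega)$ into $[-\infty,\tfrac12\mathsf a\|\bar f\|^2_{L^2(\Omega_1)}]$. (2) $\tilde S$ is concave and upper semicontinuous on $H^1_0(\Omega)$. (3) The interior (in $H^1_0(\Omega)$) of the domain $\operatorname{dom}(\tilde S)=\{\lambda\in H^1_0(\Omega):\tilde S[\lambda]>-\infty\}$ is the set $$\operatorname{int}\operatorname{dom}\tilde S=\{\lambda\in H^1_0(\Omega):\ \Delta_\lambda=\mathsf a+\lambda_{x-1}-\lambda_{x+1}>0\ \text{on } \Omega_1\}.$$ (4) $-\tilde S$ is coercive, and $\tilde S$ achieves a maximum. (5) If some maximizer $\lambda$ of $\tilde S$ lies in $\operatorname{int}\operatorname{dom}\tilde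 S$, then the function defined on $\Omega_1$ by $$\hat f(x)=\frac{\mathsf a\bar f(x)+\lambda'(x)}{\mathsf a+\lambda(x-1)-\lambda(x+1)}$$ is absolutely continuous inside $\Omega$ and is a strong solution there of $$f'(x)+\tfrac12\big(f(x+1)^2-f(x-1)^2\big)=0 .$$
   Context: All functions are real-valued. For a function $g$, $g_{x+h}$ denotes $g(x+h)$. Functions $\lambda\in H^1_0(\Omega)$ are regarded as equal to zero outside $\Omega=(-L,L)$ (so $\lambda$ is continuous on $\mathbb R$ and $\lambda'$ vanishes outside $\Omega$), and $H^1_0(\Omega)$ carries the norm $\|\lambda\|_{H^1_0(\Omega)}=\|\lambda'\|_{L^2(\Omega)}$. Write $\Delta_\lambda(x)=\mathsf a+\lambda(x-1)-\lambda(x+1)$. The functional $S_L$ is $$S_L[\lambda]=\int_{\Omega_1}\Big(-\lambda'\hat f+\tfrac{\hat f^2}{2}(\lambda_{x-1}-\lambda_{x+1})+\tfrac{\mathsf a}{2}(\hat f-\bar f)^2\Big)\,dx\in[-\infty,\infty),$$ where $\hat f(x)=\dfrac{\mathsf a\bar f(x)+\lambda'(x)}{\Delta_\lambda(x)}$ if $\Delta_\lambda(x)\ne0$, and $\hat f(x)=0$ if $\Delta_\lambda(x)=0$ and $\mathsf a\bar f(x)+\lambda'(x)=0$. Coercivity of $-\tilde S$ means $\tilde S[\lambda]\to-\infty$ as $\|\lambda\|_{H^1_0(\Omega)}\to\infty$. As usual for $L^2$ functions, absolute continuity of $\hat f$ is understood up to modification on a null set; a strong solution on $\Omega$ means that $\hat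 f$ is absolutely continuous on $\Omega$ with $\hat f'\in L^1(\Omega)$ and the equation holds for a.e. $x\in\Omega$ (note $x\pm1\in\Omega_1$ for $x\in\Omega$). *)

(* Defs.v *)
From HB Require Import structures.
From mathcomp Require Import all_boot all_order all_algebra.
From mathcomp Require Import all_classical all_reals all_analysis.

Set Implicit Arguments.
Unset Strict Implicit.
Unset Printing Implicit Defensive.

Import Order.TTheory GRing.Theory Num.Theory.
Import numFieldNormedType.Exports.

Local Open Scope classical_set_scope.
Local Open Scope ring_scope.

Section FunctionSpaces.
Context {R : realType}.
Implicit Types (D : set R) (f g u v : R -> R).

Local Notation mu := (@lebesgue_measure R).

Definition L2 D : set (R -> R) := [set f | f \_ D \in Lfun mu 2%:E].

Definition L2norm D f : \bar R := 'N[mu]_2%:E [EFin \o (f \_ D)].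

Definition Cc1 D : set (R -> R) :=
  [set phi : R -> R | [/\ forall x, derivable phi x 1, continuous (derive1 phi) &
    exists2 K, compact K & K `<=` D /\ forall x, ~ K x -> phi x = 0]].

Definition weak_derivative D u g : Prop :=
  forall phi, Cc1 D phi ->
    (\int[mu]_(x in D) (u x * derive1 phi x)%:E =
     - \int[mu]_(x in D) (g x * phi x)%:E)%E.

(* The L2 weak derivative of u on D, unique up to a null set and extended by
   zero outside D; it is 0 if u has no such derivative. *)
Definition wderiv D u : R -> R :=
  xget (cst 0) [set g | [/\ L2 D g, weak_derivative D u g &
                            forall x, ~ D x -> g x = 0]].

Definition H1 D : set (R -> R) :=
  [set u | L2 D u /\ exists2 g, L2 D g & weak_derivative D u g].

Definition H1norm D u : \bar R := (L2norm D u + L2norm D (wderiv D u))%E.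

(* H^1_0(D) is the closure of C^1_c(D) in H^1(D) (as in Brezis's textbook;
   C^oo_c(D) has the same closure).  Each class is represented by its
   continuous representative on the whole line, equal to 0 outside D, so that
   equality of functions is equality in H^1_0(D). *)
Definition H10 D : set (R -> R) :=
  [set u | [/\ H1 D u,
    forall eps : R, 0 < eps ->
      exists2 phi, Cc1 D phi & (H1norm D (u \- phi)%R < eps%:E)%E,
    continuous u & forall x, ~ D x -> u x = 0]].

Definition H10norm D u : \bar R := L2norm D (wderiv D u).

Definition H10_ball D u (eps : R) : set (R -> R) :=
  [set v | H10 D v /\ (H10norm D (v \- u)%R < eps%:E)%E].

Definition H10_interior D (A : set (R -> R)) : set (R -> R) :=
  [set u | H10 D u /\ exists2 eps : R, 0 < eps & H10_ball D u eps `<=` A].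

Definition H10_concave D (F : (R -> R) -> \bar R) : Prop :=
  forall u v (t : R), H10 D u -> H10 D v -> 0 <= t <= 1 ->
    (t%:E * F u + (1 - t)%:E * F v
       <= F (fun x => t * u x + (1 - t) * v x)%R)%E.

Definition H10_upper_semicontinuous D (F : (R -> R) -> \bar R) : Prop :=
  forall u (c : R), H10 D u -> (F u < c%:E)%E ->
    exists2 eps : R, 0 < eps & forall v, H10_ball D u eps v -> (F v < c%:E)%E.

Definition H10_coercive D (F : (R -> R) -> \bar R) : Prop :=
  forall M : R, exists r : R, forall u, H10 D u ->
    (r%:E < H10norm D u)%E -> (M%:E < F u)%E.

Definition H10_maximizer D (F : (R -> R) -> \bar R) u : Prop :=
  H10 D u /\ forall v, H10 D v -> (F v <= F u)%E.

Definition absolutely_continuous D f : Prop :=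
  forall eps : R, 0 < eps -> exists2 delta : R, 0 < delta &
    forall n (a b : 'I_n -> R),
      (forall i, a i <= b i /\ `[a i, b i] `<=` D) ->
      trivIset setT (fun i => `]a i, b i[%classic) ->
      \sum_(i < n) (b i - a i) < delta ->
      \sum_(i < n) `|f (b i) - f (a i)| < eps.

End FunctionSpaces.

Section Functional.
Context {R : realType}.
Variables (L a : R) (fbar : R -> R).
Implicit Types (f lambda : R -> R).

Local Notation mu := (@lebesgue_measure R).

Definition Omega : set R := `]- L, L[%classic.

Definition Omega1 : set R := `](- L - 1), (L + 1)[%classic.

Definition Delta lambda (x : R) : R := a + lambda (x - 1) - lambda (x + 1).

Definition integrand lambda f (x : R) : R :=
  - wderiv Omega lambda x * f x
  + f x ^+ 2 / 2 * (lambda (x - 1) - lambda (x + 1))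
  + a / 2 * (f x - fbar x) ^+ 2.

Definition Stilde lambda : \bar R :=
  ereal_inf [set (\int[mu]_(x in Omega1) (integrand lambda f x)%:E)%E
            | f in L2 Omega1].

(* Since y / 0 = 0, this is 0 where Delta vanishes. *)
Definition fhat lambda (x : R) : R :=
  (a * fbar x + wderiv Omega lambda x) / Delta lambda x.

(* The integral of the positive part minus that of the negative part, which
   may be -oo. *)
Definition SL lambda : \bar R :=
  (\int[mu]_(x in Omega1) (integrand lambda (fhat lambda) x)%:E)%E.

Definition admissible lambda : Prop :=
  {ae mu, forall x, Omega1 x -> 0 <= Delta lambda x /\
    (Delta lambda x = 0 -> wderiv Omega lambda x + a * fbar x = 0)}.

Definition domS : set (R -> R) :=
  [set lambda | H10 Omega lambda /\ (-oo < Stilde lambda)%E].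

(* g is the absolutely continuous modification of f on a null set, and h is
   its a.e. derivative. *)
Definition strong_solution f : Prop :=
  exists g h : R -> R,
    [/\ {ae mu, forall x, Omega1 x -> g x = f x},
        absolutely_continuous Omega g,
        mu.-integrable Omega (EFin \o h),
        {ae mu, forall x, Omega x -> is_derive x 1 g (h x)} &
        {ae mu, forall x, Omega x ->
          h x + 2^-1 * (g (x + 1) ^+ 2 - g (x - 1) ^+ 2) = 0}].

End Functional.

(* Main.v *)
(* For fixed lambda the integrand is, at each x, the quadratic
   Delta/2 f^2 - P f + a/2 fbar^2 in f, where P = lambda' + a fbar.  Its minimum
   is attained at f = P/Delta = fhat, and truncating fhat gives competitors in
   L^2; this is the formula for Stilde.  As an infimum of functionals that are
   affine and continuous in lambda, Stilde is concave and upper semicontinuous.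
   H^1_0 controls the sup norm because lambda(x) is the integral of lambda' over
   ]-oo, x]; hence Delta >= delta > 0 survives small perturbations, while if
   Delta(x) <= 0 then the multiple (1 + s) lambda makes Delta(x) negative.  The
   competitor f = P / (a + 2 sup |lambda|) shows that Stilde decreases at least
   linearly in the norm.  The superlevel sets are closed, convex and bounded, so
   near-minimal norm elements of them converge, to a maximizer.  At an interior
   maximizer the first variation vanishes:
     int fhat phi' = 1/2 int fhat^2 (phi(x - 1) - phi(x + 1)),
   and translating the right-hand side exhibits a weak derivative of fhat in
   L^1, so fhat is a constant plus an indefinite integral (du Bois-Reymond). *)

Require Import Defs.
From HB Require Import structures.
From mathcomp Require Import all_boot all_order all_algebra.
From mathcomp Require Import all_classical all_reals all_analysis.
From mathcomp Require Import measurable_realfun ring lra.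

Import Order.TTheory GRing.Theory Num.Theory.
Import numFieldNormedType.Exports.

Local Open Scope classical_set_scope.
Local Open Scope ring_scope.

Set Implicit Arguments.
Unset Strict Implicit.

(** * Square-integrable functions *)

(* Lebesgue measure lives on [measurableTypeR R], whose display differs from the
   one inferred for [R]; domains are typed accordingly. *)
Section SquareIntegrable.
Context {R : realType}.
Notation mu := (@lebesgue_measure R).
Notation intb D f := (mu.-integrable D (EFin \o f)).
Implicit Types (D E : set (measurableTypeR R)) (f g h : measurableTypeR R -> R).

(** [Stilde] may be [-oo], and [wderiv] is a chosen representative, known only up to a null set.
    Estimates are therefore made on the real functional [J u f] at a fixed competitor [f], almost
    everywhere in [x], and the infimum is taken last. In particular the infimum is never
    differentiated: at an interior maximizer [u], completing the square bounds [J (u + t v) f] from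
    below, uniformly in [f], by [J u fhat + t l - C t^2], where [l] is the expected first variation.
    Maximality leaves [t l <= C t^2] for small [t] of both signs, so [l = 0].

    The positive lower bound on Delta used there comes from compactness of [[-L-1, L+1]]: at its
    endpoints both shifted points lie outside Omega, so Delta equals [a].

    Conversely, finiteness of [Stilde] is exploited along lines [t k] of competitors: a real
    quadratic polynomial in [t] that is bounded below has a nonnegative leading coefficient, and no
    linear term if that coefficient is zero. *)

Lemma ae_imply (P Q : measurableTypeR R -> Prop) : (forall x, P x -> Q x) ->
  {ae mu, forall x, P x} -> {ae mu, forall x, Q x}.
Proof. by move=> PQ; apply: filterS. Qed.

Lemma ae_and (P Q : measurableTypeR R -> Prop) : {ae mu, forall x, P x} -> {ae mu, forall x, Q x} ->
  {ae mu, forall x, P x /\ Q x}.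
Proof. by move=> p q; exact: (@filterI _ _ (ae_filter_ringOfSetsType mu) P Q p q). Qed.

Lemma intb_eq D f g : {in D, f =1 g} -> measurable D ->
  intb D f -> intb D g.
Proof. by move=> fg mD; apply: eq_integrable => // x xD /=; rewrite fg. Qed.

Lemma intbD D f g : measurable D -> intb D f -> intb D g ->
  intb D (fun x => f x + g x).
Proof. by move=> mD f1 g1; exact: (integrableD mD f1 g1). Qed.

Lemma intbZ D k f : measurable D -> intb D f -> intb D (fun x => k * f x).
Proof. by move=> mD f1; exact: (integrableZl mD k f1). Qed.

Lemma intbN D f : measurable D -> intb D f -> intb D (fun x => - f x).
Proof. by move=> mD f1; exact: (integrableN f1). Qed.

Lemma intbB D f g : measurable D -> intb D f -> intb D g ->
  intb D (fun x => f x - g x).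
Proof. by move=> mD f1 g1; apply: intbD => //; exact: intbN. Qed.

Lemma intb_meas D f : intb D f -> measurable_fun D f.
Proof. by move=> /measurable_int /measurable_EFinP. Qed.

Lemma intb_le D f g : measurable D -> measurable_fun D f ->
  (forall x, D x -> `|f x| <= g x) -> intb D g -> intb D f.
Proof.
move=> mD mf fg; apply: le_integrable => //; first exact/measurable_EFinP.
by move=> x Dx /=; rewrite lee_fin (le_trans (fg x Dx))// ler_norm.
Qed.

Lemma intbS D E f : measurable D -> measurable E -> E `<=` D ->
  intb D f -> intb E f.
Proof. by move=> mD mE ED; exact: integrableS. Qed.

Lemma intb_cst D k : measurable D -> (mu D < +oo)%E -> intb D (fun=> k).
Proof.
move=> mD fD; apply: measurable_bounded_integrable => //.
by exists `|k|; split => [|M kM x _]; [exact: num_real|exact: ltW].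
Qed.

Lemma intb_bndM D f g c : measurable D -> measurable_fun D f ->
  (forall x, D x -> `|f x| <= c) -> intb D g -> intb D (fun x => f x * g x).
Proof.
move=> mD mf fc ig.
apply: (@intb_le _ _ (fun x => c * `|g x|)) => //.
- by apply: measurable_funM => //; exact: intb_meas.
- by move=> x Dx; rewrite normrM ler_wpM2r// fc.
- by apply: intbZ => //; exact: integrable_norm.
Qed.

Lemma EFin_Rint {D f} : measurable D -> intb D f ->
  (\int[mu]_(x in D) (f x)%:E)%E = (\int[mu]_(x in D) f x)%:E.
Proof. by move=> mD fi; rewrite fineK//; exact: integrable_fin_num. Qed.

Lemma Rint_ae D f g : measurable D -> measurable_fun D f ->
  measurable_fun D g -> {ae mu, forall x, D x -> f x = g x} ->
  \int[mu]_(x in D) f x = \int[mu]_(x in D) g x.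
Proof.
move=> mD mf mg fg; congr fine; apply: ae_eq_integral => //.
- exact/measurable_EFinP.
- exact/measurable_EFinP.
- by apply: filterS fg => x + Dx => ->.
Qed.

Lemma intb_ae D f g : measurable D -> measurable_fun D g ->
  {ae mu, forall x, D x -> f x = g x} -> intb D f -> intb D g.
Proof.
move=> mD mg fg fi; move/integrableP: (fi) => [mf bf].
apply/integrableP; split; first exact/measurable_EFinP.
suff -> : (\int[mu]_(x in D) `|(EFin \o g) x| =
    \int[mu]_(x in D) `|(EFin \o f) x|)%E by [].
apply: ae_eq_integral => //.
- by apply: measurableT_comp => //; exact/measurable_EFinP.
- exact: measurableT_comp.
- by apply: filterS fg => x + Dx /= => ->.
Qed.

Lemma le_Rint_ae D f g : measurable D -> intb D f -> intb D g ->
  {ae mu, forall x, D x -> f x <= g x} ->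
  \int[mu]_(x in D) f x <= \int[mu]_(x in D) g x.
Proof.
move=> mD fi gi fg.
have mf := intb_meas fi. have mg := intb_meas gi.
have mm : measurable_fun D (fun x => Num.max (f x) (g x)).
  exact: measurable_maxr.
have fgm : {ae mu, forall x, D x -> g x = Num.max (f x) (g x)}.
  by apply: filterS fg => x fg Dx; rewrite max_r// fg.
rewrite (Rint_ae mD mg mm fgm); apply: le_Rintegral => //.
- exact: intb_ae fgm gi.
- by move=> x Dx; rewrite le_max lexx.
Qed.

Lemma Rint_eq0_ae D f : measurable D -> intb D f -> (forall x, D x -> 0 <= f x) ->
  \int[mu]_(x in D) f x = 0 -> {ae mu, forall x, D x -> f x = 0}.
Proof.
move=> mD fi f0 If.
have mf : measurable_fun D (EFin \o f) by exact: measurable_int fi.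
have /ae_eq_integral_abs : (\int[mu]_(x in D) `|(EFin \o f) x| = 0)%E.
  rewrite (eq_integral (EFin \o f)); last first.
    by move=> x /set_mem Dx; rewrite /= ger0_norm// f0.
  by rewrite (EFin_Rint mD fi) If.
by move=> /(_ mD mf); apply: filterS => x + Dx => /(_ Dx) [].
Qed.

Lemma L2P {D f} : measurable D -> L2 D f <->
  (measurable_fun D f /\ intb D (fun x => f x ^+ 2)).
Proof.
move=> mD.
have patch2 : (fun x => (f \_ D) x ^+ 2) = (fun x => f x ^+ 2) \_ D.
  by apply/funext => x; rewrite !patchE; case: ifP => //; rewrite expr0n.
split.
  move=> fL; split.
    apply/(measurable_restrictT _ mD).
    by move: fL; rewrite /L2/= inE => /andP[]; rewrite inE.
  move/Lfun2_integrable_sqr : fL; rewrite patch2 => fL.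
  by apply/integrable_mkcond => //; rewrite restrict_EFin.
move=> [mf fi]; rewrite /L2/= inE; apply/andP; split; rewrite inE /=.
  by apply/(measurable_restrictT _ mD).
rewrite /finite_norm unlock; apply: poweR_lty.
under eq_integral => x _ do rewrite /= powR_mulrn// real_normK ?num_real//.
move/integrable_mkcond : fi => /(_ mD); rewrite restrict_EFin -patch2.
by move=> /integrable_lty; apply.
Qed.

(** The squared norm as a real number, so that polynomial identities and linear arithmetic apply
    without roots or extended reals. *)
Definition sqn D f : R := \int[mu]_(x in D) (f x ^+ 2).

Lemma sqn_ge0 D f : 0 <= sqn D f.
Proof. by apply: Rintegral_ge0 => x _; rewrite sqr_ge0. Qed.

Lemma L2normE {D f} : measurable D -> L2 D f ->
  L2norm D f = (Num.sqrt (sqn D f))%:E.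
Proof.
move=> mD /(L2P mD)[mf fi].
rewrite /L2norm unlock /sqn -powR12_sqrt; last exact: sqn_ge0.
rewrite -poweR_EFin -(EFin_Rint mD fi) [in RHS]integral_mkcond; congr poweR.
apply: eq_integral => x _; rewrite /= powR_mulrn// real_normK ?num_real// !patchE.
by case: ifP => //; rewrite expr0n.
Qed.

Lemma L2norm_lt D f (e : R) : measurable D -> L2 D f -> 0 < e ->
  (L2norm D f < e%:E)%E = (sqn D f < e ^+ 2).
Proof.
move=> mD fL e0; rewrite (L2normE mD fL) lte_fin.
by rewrite -{1}(gtr0_norm e0) -sqrtr_sqr ltr_sqrt// exprn_gt0.
Qed.

Lemma L2_meas D f : measurable D -> L2 D f -> measurable_fun D f.
Proof. by move=> mD /(L2P mD)[]. Qed.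

Lemma L2_sqr D f : measurable D -> L2 D f -> intb D (fun x => f x ^+ 2).
Proof. by move=> mD /(L2P mD)[]. Qed.

Lemma L2M D f g : measurable D -> L2 D f -> L2 D g ->
  intb D (fun x => f x * g x).
Proof.
move=> mD /(L2P mD)[mf fi] /(L2P mD)[mg gi].
apply: (@intb_le _ _ (fun x => f x ^+ 2 + g x ^+ 2)) => //.
- exact: measurable_funM.
- move=> x _; rewrite normrM -(real_normK (num_real (f x))).
  rewrite -(real_normK (num_real (g x))).
  by have := sqr_ge0 (`|f x| - `|g x|); have := sqr_ge0 `|f x|;
    have := sqr_ge0 `|g x|; rewrite sqrrB; lra.
- exact: intbD.
Qed.

Lemma L2Z D k f : measurable D -> L2 D f -> L2 D (fun x => k * f x).
Proof.
move=> mD /(L2P mD)[mf fi]; apply/L2P => //; split.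
  by apply: measurable_funM.
have -> : (fun x => (k * f x) ^+ 2) = (fun x => k ^+ 2 * f x ^+ 2).
  by apply/funext => x; rewrite exprMn.
exact: intbZ.
Qed.

Lemma L2D D f g : measurable D -> L2 D f -> L2 D g -> L2 D (fun x => f x + g x).
Proof.
move=> mD fL gL; apply/L2P => //; split.
  by apply: measurable_funD; exact: L2_meas.
have -> : (fun x => (f x + g x) ^+ 2) =
    (fun x => f x ^+ 2 + (2 * (f x * g x) + g x ^+ 2)).
  by apply/funext => x; ring.
apply: intbD => //; first exact: L2_sqr.
by apply: intbD => //; [apply: intbZ => //; exact: L2M|exact: L2_sqr].
Qed.

Lemma L2N D f : measurable D -> L2 D f -> L2 D (fun x => - f x).
Proof.
move=> mD fL; have := @L2Z _ (-1) _ mD fL.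
by congr (L2 D _); apply/funext => x; rewrite mulN1r.
Qed.

Lemma L2B D f g : measurable D -> L2 D f -> L2 D g -> L2 D (fun x => f x - g x).
Proof. by move=> mD fL gL; apply: L2D => //; exact: L2N. Qed.

Lemma L2_bndM D f g c : measurable D -> measurable_fun D f ->
  (forall x, D x -> `|f x| <= c) -> L2 D g -> L2 D (fun x => f x * g x).
Proof.
move=> mD mf fc /(L2P mD)[mg gi]; apply/(L2P mD); split.
  exact: measurable_funM.
have -> : (fun x => (f x * g x) ^+ 2) = (fun x => f x ^+ 2 * g x ^+ 2).
  by apply/funext => x; rewrite exprMn.
apply: (@intb_bndM _ _ _ (c ^+ 2)) => //.
  exact: measurable_funX.
move=> x Dx; rewrite normrX; have := fc _ Dx => fxc.
by rewrite lerXn2r// nnegrE// (le_trans _ fxc).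
Qed.

Lemma L2_ae D f g : measurable D -> measurable_fun D g ->
  {ae mu, forall x, D x -> f x = g x} -> L2 D f -> L2 D g.
Proof.
move=> mD mg fg /(L2P mD)[mf fi]; apply/(L2P mD); split => //.
apply: intb_ae fi => //; first exact: measurable_funX.
by apply: filterS fg => x + Dx => ->.
Qed.

Lemma L2S D E f : measurable D -> measurable E -> E `<=` D -> L2 D f -> L2 E f.
Proof.
move=> mD mE ED /(L2P mD)[mf fi]; apply/(L2P mE); split.
  exact: measurable_funS mf.
exact: intbS fi.
Qed.

Lemma L2_bounded D f c : measurable D -> (mu D < +oo)%E -> measurable_fun D f ->
  (forall x, D x -> `|f x| <= c) -> L2 D f.
Proof.
move=> mD fD mf fc; apply/(L2P mD); split => //.
apply: (@intb_le _ _ (fun=> c ^+ 2)) => //.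
- exact: measurable_funX.
- move=> x Dx; rewrite normrX; have := fc _ Dx => fxc.
  by rewrite lerXn2r// nnegrE// (le_trans _ fxc).
- exact: intb_cst.
Qed.

Lemma L2_int D f : measurable D -> (mu D < +oo)%E -> L2 D f -> intb D f.
Proof.
move=> mD fD fL.
have c1 : L2 D (fun=> 1).
  by apply: (@L2_bounded _ _ 1) => // x _; rewrite normr1.
apply: intb_eq (L2M mD c1 fL) => // x _ /=; exact: mul1r.
Qed.

Lemma sqn_ae D f g : measurable D -> measurable_fun D f -> measurable_fun D g ->
  {ae mu, forall x, D x -> f x = g x} -> sqn D f = sqn D g.
Proof.
move=> mD mf mg fg; apply: Rint_ae => //; try exact: measurable_funX.
by apply: filterS fg => x + Dx => ->.
Qed.

Lemma sqnZ D k f : measurable D -> L2 D f -> sqn D (fun x => k * f x) = k ^+ 2 * sqn D f.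
Proof.
move=> mD fL; rewrite /sqn -RintegralZl//; last exact: L2_sqr.
by apply: eq_Rintegral => x _; rewrite exprMn.
Qed.

Lemma sqn_lin D f g k : measurable D -> L2 D f -> L2 D g ->
  sqn D (fun x => f x + k * g x) =
  sqn D f + 2 * k * (\int[mu]_(x in D) (f x * g x)) + k ^+ 2 * sqn D g.
Proof.
move=> mD fL gL; rewrite /sqn.
have fg := L2M mD fL gL; have f2 := L2_sqr mD fL; have g2 := L2_sqr mD gL.
rewrite -RintegralZl// -RintegralZl// -!RintegralD//.
- by apply: eq_Rintegral => x _; ring.
- by apply: intbD => //; exact: intbZ.
- exact: intbZ.
- exact: intbZ.
Qed.

Lemma sqnD_le D f g : measurable D -> L2 D f -> L2 D g ->
  sqn D (fun x => f x + g x) <= 2 * sqn D f + 2 * sqn D g.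
Proof.
move=> mD fL gL; rewrite /sqn -!RintegralZl//; try exact: L2_sqr.
rewrite -RintegralD//; try (by apply: intbZ => //; exact: L2_sqr).
apply: le_Rintegral => //.
- by apply: L2_sqr => //; exact: L2D.
- by apply: intbD => //; apply: intbZ => //; exact: L2_sqr.
- by move=> x _; have := sqr_ge0 (f x - g x); rewrite sqrrB sqrrD; lra.
Qed.

Lemma sqnN D f : sqn D (fun x => - f x) = sqn D f.
Proof. by apply: eq_Rintegral => x _; rewrite sqrrN. Qed.

Lemma sqnB_sym D f g : sqn D (fun x => f x - g x) = sqn D (fun x => g x - f x).
Proof. by apply: eq_Rintegral => x _; rewrite -opprB sqrrN. Qed.

Lemma sqnB_le D f g : measurable D -> L2 D f -> L2 D g ->
  sqn D (fun x => f x - g x) <= 2 * sqn D f + 2 * sqn D g.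
Proof.
move=> mD fL gL; rewrite -(sqnN _ g); apply: sqnD_le => //; exact: L2N.
Qed.

(** The polynomial [k |-> sqn (f + k g)] is nonnegative; evaluate it at its minimizer
    [- I / sqn g]. *)
Lemma cauchy_schwarz D f g : measurable D -> L2 D f -> L2 D g ->
  (\int[mu]_(x in D) (f x * g x)) ^+ 2 <= sqn D f * sqn D g.
Proof.
move=> mD fL gL; set I := \int[mu]_(x in D) _.
have H k : 0 <= sqn D f + 2 * k * I + k ^+ 2 * sqn D g.
  by rewrite -sqn_lin//; exact: sqn_ge0.
have [g0|gn0] := eqVneq (sqn D g) 0.
  have [->|I0] := eqVneq I 0; first by rewrite expr0n/= g0 mulr0.
  (* With [sqn g = 0] the polynomial is affine in [k]; this [k] gives it the value [-1]. *)
  have := H (- (1 + sqn D f) / (2 * I)); rewrite g0 mulr0 addr0.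
  have -> : 2 * (- (1 + sqn D f) / (2 * I)) * I = - (1 + sqn D f) by field.
  lra.
have gp : 0 < sqn D g by rewrite lt_def gn0 sqn_ge0.
have := H (- I / sqn D g).
have -> : sqn D f + 2 * (- I / sqn D g) * I + (- I / sqn D g) ^+ 2 * sqn D g =
  sqn D f - I ^+ 2 / sqn D g by field.
by rewrite subr_ge0 ler_pdivrMr.
Qed.

End SquareIntegrable.

(** * Completeness of L^2 *)

Section Completeness.
Context {R : realType}.
Notation mu := (@lebesgue_measure R).
Implicit Types (D E : set (measurableTypeR R)) (f : measurableTypeR R -> R)
  (g : nat -> measurableTypeR R -> R).

Lemma cvg_partial_sums (u : nat -> R) :
  (\sum_(k <oo) (`|u k.+1 - u k|)%:E < +oo)%E -> cvgn u.
Proof.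
move=> S_fin.
have Sge0 : (0 <= \sum_(k <oo) (`|u k.+1 - u k|)%:E)%E.
  by apply: nneseries_ge0 => n _ _; rewrite lee_fin.
have Sf : (\sum_(k <oo) (`|u k.+1 - u k|)%:E)%E \is a fin_num.
  by rewrite ge0_fin_numE.
have -> : u = (fun n => u 0%N + series (telescope u) n).
  by apply/funext => n; rewrite -eq_sum_telescope.
apply: is_cvgD; first exact: is_cvg_cst.
apply: normed_cvg.
apply: nondecreasing_is_cvgn.
  by apply/nondecreasing_seqP => n; rewrite /= !seriesEord/= big_ord_recr/= lerDl.
exists (fine (\sum_(k <oo) (`|u k.+1 - u k|)%:E)%E) => _ [n _ <-].
rewrite -lee_fin fineK// /series/= -sumEFin.
by apply: nneseries_lim_ge => i _ _; rewrite lee_fin.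
Qed.

Lemma limn_einf_le (u : nat -> \bar R) (c : \bar R) (N : nat) :
  (forall n, (N <= n)%N -> (u n <= c)%E) -> (limn_einf u <= c)%E.
Proof.
move=> uc; rewrite limn_einf_lim; apply: lime_le; first exact: is_cvg_einfs.
exists N => // n /= Nn; apply: (le_trans _ (uc n Nn)).
by apply: ereal_inf_lbound; exists n => /=.
Qed.

(** Young's inequality [|f| <= (2^k / 2) f^2 + 2^-k / 2], integrated. The bound has the geometric
    form that makes the increments of a rapid subsequence summable. *)
Lemma norm1_le_sqn D f (k : nat) : measurable D -> (mu D < +oo)%E -> L2 D f ->
  sqn D f <= (2^-1) ^+ k * (2^-1) ^+ k ->
  \int[mu]_(x in D) `|f x| <= (1 + fine (mu D)) / 2 ^+ k.+1.
Proof.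
move=> mD fD fL sf.
have f2 := L2_sqr mD fL.
have k2 : 0 < (2 : R) ^+ k by rewrite exprn_gt0.
apply: (@le_trans _ _ (\int[mu]_(x in D) (2 ^+ k / 2 * f x ^+ 2 + (2 ^+ k)^-1 / 2))).
  apply: le_Rintegral => //.
  - by apply: integrable_norm; exact: L2_int.
  - by apply: intbD => //; [exact: intbZ|exact: intb_cst].
  - move=> x _.
    have := sqr_ge0 (2 ^+ k * `|f x| - 1); rewrite -(real_normK (num_real (f x))).
    move=> H; rewrite -subr_ge0.
    have -> : 2 ^+ k / 2 * `|f x| ^+ 2 + (2 ^+ k)^-1 / 2 - `|f x| =
      (2 ^+ k * `|f x| - 1) ^+ 2 / (2 * 2 ^+ k) by field; rewrite gt_eqF.
    by rewrite divr_ge0// mulr_ge0// ltW.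
rewrite RintegralD//; [|exact: intbZ|exact: intb_cst].
rewrite RintegralZl// Rintegral_cst//.
have : 2 ^+ k / 2 * sqn D f <= 2 ^+ k / 2 * ((2^-1) ^+ k * (2^-1) ^+ k).
  by rewrite ler_wpM2l// divr_ge0// ltW.
rewrite -/(sqn D f) => H; apply: (le_trans (lerD H (lexx _))).
rewrite exprVn exprS le_eqVlt; apply/orP; left; apply/eqP; field.
by rewrite gt_eqF.
Qed.

(* Riesz-Fischer: the rapid subsequence [g (n k)] converges a.e., and Fatou's
   lemma identifies its limit as the limit in L^2. *)
Lemma L2_complete D g : measurable D -> (mu D < +oo)%E ->
  (forall n, L2 D (g n)) ->
  (forall e : R, 0 < e -> exists N, forall m n, (N <= m)%N -> (N <= n)%N ->
     sqn D (fun x => g m x - g n x) <= e) ->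
  exists2 f, L2 D f & forall e : R, 0 < e -> exists N, forall n, (N <= n)%N ->
     sqn D (fun x => g n x - f x) <= e.
Proof.
move=> mD fD gL gC.
have mg n : measurable_fun D (g n) by exact: L2_meas.
have /choice[N HN] k : exists N, forall m n, (N <= m)%N -> (N <= n)%N ->
     sqn D (fun x => g m x - g n x) <= (2^-1) ^+ k * (2^-1) ^+ k.
  by apply: gC; rewrite mulr_gt0// exprn_gt0.
(* The cumulative sum puts both [n_ k] and [n_ k.+1] beyond [N k]; the added [k] makes the indices
   tend to infinity. *)
pose n_ k := (\sum_(j < k.+1) N j + k)%N.
have Nn k : (N k <= n_ k)%N by rewrite /n_ big_ord_recr/= addnAC leq_addl.
have NnS k : (N k <= n_ k.+1)%N.
  by rewrite (leq_trans (Nn k))// /n_ [in leqRHS]big_ord_recr/= leq_add// leq_addr.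
have kn k : (k <= n_ k)%N by rewrite /n_ leq_addl.
pose h k := g (n_ k).
have hLk k : L2 D (h k) by exact: gL.
have mh k : measurable_fun D (h k) by exact: mg.
pose S x := (\sum_(k <oo) (`|h k.+1 x - h k x|)%:E)%E.
have mS0 k : measurable_fun D (fun x => (`|h k.+1 x - h k x|)%:E).
  apply/measurable_EFinP; apply: measurableT_comp => //.
  exact: measurable_funB.
have mS : measurable_fun D S by apply: ge0_emeasurable_sum.
have iS : mu.-integrable D S.
  apply/integrableP; split => //.
  rewrite (eq_integral S); last first.
    by move=> x _; rewrite gee0_abs// nneseries_ge0.
  rewrite integral_nneseries//.
  have e0 : 0 <= 1 + fine (mu D) by rewrite addr_ge0// fine_ge0.
  have := @epsilon_trick _ (fun=> 0%E) (1 + fine (mu D)) xpredT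
    (fun=> lexx _) e0.
  rewrite [X in (_ <= X + _)%E]eseries0// add0e => /le_lt_trans/(_ (ltry _)).
  apply: le_lt_trans.
  rewrite [leRHS](_ : _ = \sum_(k <oo) ((1 + fine (mu D)) / 2 ^+ k.+1)%:E)%E; last first.
    by apply: eq_eseriesr => k _; rewrite add0e natrX.
  apply: lee_nneseries => [k _ _|k _]; first exact: integral_ge0.
  have hL : L2 D (fun x => h k.+1 x - h k x) by apply: L2B => //; exact: gL.
  have hI : mu.-integrable D (EFin \o (fun x => `|h k.+1 x - h k x|)).
    by apply: integrable_norm; exact: L2_int.
  rewrite (EFin_Rint mD hI) lee_fin.
  by apply: norm1_le_sqn => //; exact: HN.
pose A := D `&` [set x | (S x < +oo)%E].
have mA : measurable A by apply: measurable_lte.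
have Ah x : A x -> cvgn (h ^~ x).
  by move=> [Dx Sx]; exact: cvg_partial_sums.
pose f x := if x \in A then limn (h ^~ x) else 0.
have hf x : A x -> h ^~ x @ \oo --> f x.
  by move=> Ax; rewrite /f mem_set//; exact: Ah.
have mf : measurable_fun D f.
  apply: (@measurable_fun_cvg _ _ _ _ (fun k => h k \_ A)).
    move=> k; apply/measurable_restrict => //.
    by apply: measurable_funS (mh k) => // x [].
  move=> x Dx; have [Ax|nAx] := pselect (A x).
    have -> : (fun k => (h k \_ A) x) = h ^~ x.
      by apply/funext => k; rewrite patchE mem_set.
    exact: hf.
  have -> : (fun k => (h k \_ A) x) = (fun=> 0).
    by apply/funext => k; rewrite patchE memNset.
  by rewrite /f memNset//; exact: cvg_cst.
have aeA : {ae mu, forall x, D x -> A x}.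
  apply: filterS (integrable_ae mD iS) => x + Dx => /(_ Dx).
  by move=> /fin_numPlt/andP[_ ?]; split.
have key (e : R) : 0 < e -> exists N, forall n, (N <= n)%N ->
    (\int[mu]_(x in D) ((g n x - f x) ^+ 2)%:E <= e%:E)%E.
  move=> e0; have [M HM] := gC e e0; exists M => n Mn.
  pose F k x := ((g n x - h k x) ^+ 2)%:E.
  have mF k : measurable_fun D (F k).
    by apply/measurable_EFinP; apply: measurable_funX; exact: measurable_funB.
  have F0 k x : D x -> (0 <= F k x)%E by rewrite lee_fin sqr_ge0.
  have := fatou mu mD mF F0.
  have -> : (\int[mu]_(x in D) limn_einf (F ^~ x) =
             \int[mu]_(x in D) ((g n x - f x) ^+ 2)%:E)%E.
    apply: ae_eq_integral => //.
    - apply: measurableT_comp => //.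
      by apply: measurable_fun_limn_esup => // k; exact: measurableT_comp (mF k).
    - by apply/measurable_EFinP; apply: measurable_funX; exact: measurable_funB.
    - apply: filterS aeA => x + Dx => /(_ Dx) Ax.
      have Fx : F ^~ x @ \oo --> ((g n x - f x) ^+ 2)%:E.
        apply: cvg_EFin; first by near=> k.
        have hx : (fun k => g n x - h k x) @ \oo --> g n x - f x.
          by apply: cvgB; [exact: cvg_cst|exact: hf].
        by rewrite expr2; exact: (cvgM hx hx).
      by have [-> _] := cvg_limn_einf_sup Fx.
  move=> /le_trans; apply; apply: (@limn_einf_le _ _ M) => k Mk.
  rewrite EFin_Rint//; last by apply: L2_sqr => //; exact: L2B.
  by rewrite lee_fin; apply: HM => //; exact: leq_trans (kn k).
have fL : L2 D f.
  have [M HM] := key 1 ltr01.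
  have : L2 D (fun x => g M x - f x).
    apply/(L2P mD); split; first exact: measurable_funB.
    apply/integrableP; split.
      by apply/measurable_EFinP; apply: measurable_funX; exact: measurable_funB.
    apply: le_lt_trans (ltry 1); apply: le_trans (HM M (leqnn M)).
    rewrite le_eqVlt; apply/orP; left; apply/eqP; apply: eq_integral => x _ /=.
    by rewrite ger0_norm// sqr_ge0.
  move=> /(L2B mD (gL M)); congr (L2 D _).
  by apply/funext => x; rewrite subKr.
exists f => // e e0; have [M HM] := key e e0; exists M => n /HM.
by rewrite EFin_Rint//; apply: L2_sqr => //; exact: L2B.
Unshelve. all: by end_near. Qed.

End Completeness.

(** * Test functions *)

Section TestFunctions.
Context {R : realType}.
Notation mu := (@lebesgue_measure R).
Implicit Types (f phi : R -> R) (c d x e : R).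

(** The error of the difference quotient is at most [C |h|]. This handles the square of a positive
    part at its kink without separating one-sided limits. *)
Lemma is_derive_quadratic f x (l C : R) :
  (forall h, `|f (x + h) - f x - l * h| <= C * h ^+ 2) -> is_derive x 1 f l.
Proof.
move=> fC.
have C0 : 0 <= C by have := fC 1; rewrite expr1n !mulr1; exact: le_trans (normr_ge0 _).
have q : (fun h : R => h^-1 *: (f (h *: (1:R) + x) - f x)) @ 0^' --> l.
  apply/cvgrPdist_le => e e0; near=> h.
  have h0 : h != 0 by near: h; exact: nbhs_dnbhs_neq.
  have he : `|h| <= e / (C + 1).
    near: h; apply: dnbhs0_le; apply: divr_gt0 => //; exact: ltr_wpDl.
  have -> : h *: (1 : R) = h by rewrite /GRing.scale/= mulr1.
  rewrite distrC [h + x]addrC [X in `|X|]addrC.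
  have -> : - l + h^-1 *: (f (x + h) - f x) = h^-1 * (f (x + h) - f x - l * h).
    by rewrite /GRing.scale/=; field.
  rewrite normrM normfV ler_pdivrMl ?normr_gt0//.
  apply: (le_trans (fC h)); rewrite -(real_normK (num_real h)) expr2 mulrCA.
  rewrite ler_wpM2l//; apply: (@le_trans _ _ ((C + 1) * `|h|)).
    by rewrite ler_wpM2r// lerDl.
  by rewrite mulrC -ler_pdivlMr// ltr_wpDl.
apply: DeriveDef; first by apply/cvg_ex; exists l.
by apply/cvg_lim => //; exact: Rhausdorff.
Unshelve. all: by end_near. Qed.

Lemma is_derive_maxsq (t : R) :
  is_derive t 1 (fun t : R => Num.max 0 t ^+ 2) (2 * Num.max 0 t).
Proof.
apply: (@is_derive_quadratic _ _ _ 1) => h; rewrite mul1r.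
rewrite ler_norml.
by case: (leP 0 (t + h)) => th; case: (leP 0 t) => t0; apply/andP; split; nra.
Qed.

Lemma continuous_max0 : continuous (fun t : R => Num.max 0 t).
Proof.
have -> : (fun t : R => Num.max 0 t) = (fun t => (t + `|t|) / 2).
  apply/funext => t; case: (leP 0 t) => t0.
    by rewrite ger0_norm//; field.
  by rewrite ltr0_norm// subrr mul0r.
move=> t; apply: cvgM; last exact: cvg_cst.
by apply: cvgD; [exact: cvg_id|apply: cvg_norm; exact: cvg_id].
Qed.

(** Squaring the positive part makes the function continuously differentiable across [c] and [d]. *)
Definition bump c d x : R := Num.max 0 ((x - c) * (d - x)) ^+ 2.

Lemma bump_ge0 c d x : 0 <= bump c d x. Proof. exact: sqr_ge0. Qed.

Lemma bump_gt0 c d x : c < x < d -> 0 < bump c d x.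
Proof.
move=> /andP[cx xd]; rewrite exprn_gt0// lt_max; apply/orP; right.
by rewrite mulr_gt0// subr_gt0.
Qed.

Lemma bump_eq0 c d x : c <= d -> ~~ (c < x < d) -> bump c d x = 0.
Proof.
move=> cd; rewrite negb_and -!leNgt => H.
have le0 : (x - c) * (d - x) <= 0 by case/orP: H => ?; nra.
by rewrite /bump max_l// expr0n.
Qed.

(** A test function with values in [[0, 1]] that tends pointwise to the indicator of []c, d[] as [e]
    decreases to 0. *)
Definition cutoff e c d x : R := bump c d x / (bump c d x + e).

Definition dcutoff e c d x : R :=
  e * (2 * Num.max 0 ((x - c) * (d - x)) * ((d - x) - (x - c)))
  / (bump c d x + e) ^+ 2.

Lemma is_derive_bump c d x : is_derive x 1 (bump c d)
  (2 * Num.max 0 ((x - c) * (d - x)) * ((d - x) - (x - c))).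
Proof.
have H : is_derive x 1 (fun y : R => (y - c) * (d - y)) ((d - x) - (x - c)).
  apply: (@is_derive_quadratic _ _ _ 1) => h.
  have -> : (x + h - c) * (d - (x + h)) - (x - c) * (d - x) -
    (d - x - (x - c)) * h = - h ^+ 2 by ring.
  by rewrite normrN mul1r ger0_norm// sqr_ge0.
exact: (is_derive1_comp (is_derive_maxsq _) H).
Qed.

Lemma is_derive_cutoff e c d x : 0 < e ->
  is_derive x 1 (cutoff e c d) (dcutoff e c d x).
Proof.
move=> e0.
have be : bump c d x + e != 0 by rewrite gt_eqF// ltr_wpDl// bump_ge0.
have H := is_derive_bump c d x.
have H2 : is_derive x 1 (fun y => bump c d y + e)
    (2 * Num.max 0 ((x - c) * (d - x)) * ((d - x) - (x - c))).
  have := is_deriveD H (is_derive_cst e x 1); rewrite addr0.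
  by apply.
have H3 := @is_deriveV _ (fun y => bump c d y + e) x _ _ be H2.
have := is_deriveM H H3.
move=> /is_derive_eq; apply; rewrite /dcutoff /GRing.scale/=; field.
exact: be.
Qed.

Lemma continuous_bump c d : continuous (bump c d).
Proof.
move=> x; apply: differentiable_continuous; apply/derivable1_diffP.
by have [] := is_derive_bump c d x.
Qed.

Lemma Cc1_cutoff e c d (D : set R) : 0 < e -> c <= d -> `[c, d] `<=` D ->
  Cc1 D (cutoff e c d).
Proof.
move=> e0 cd cdD; have dE : derive1 (cutoff e c d) = dcutoff e c d.
  apply/funext => x; rewrite derive1E; have H := is_derive_cutoff c d x e0.
  exact: derive_val.
split.
- by move=> x; have [] := is_derive_cutoff c d x e0.
- rewrite dE => x; rewrite /dcutoff.
  have be y : bump c d y + e != 0 by rewrite gt_eqF// ltr_wpDl// bump_ge0.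
  have Hs : (fun y => bump c d y + e) y @[y --> x] --> bump c d x + e.
    by apply: cvgD; [exact: continuous_bump|exact: cvg_cst].
  apply: cvgM; last first.
    by apply: cvgV; [rewrite expf_neq0|exact: (cvgM Hs Hs)].
  apply: cvgM; first exact: cvg_cst.
  have Hc : (fun y : R => y - c) y @[y --> x] --> x - c.
    by apply: cvgB; [exact: cvg_id|exact: cvg_cst].
  have Hd : (fun y : R => d - y) y @[y --> x] --> d - x.
    by apply: cvgB; [exact: cvg_cst|exact: cvg_id].
  apply: cvgM; last exact: cvgB.
  apply: cvgM; first exact: cvg_cst.
  have Hp : (fun y : R => (y - c) * (d - y)) y @[y --> x] --> (x - c) * (d - x).
    exact: cvgM.
  exact: (@cvg_comp _ _ _ (fun y : R => (y - c) * (d - y))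
    (fun t => Num.max 0 t) _ _ _ Hp (@continuous_max0 _)).
- exists `[c, d]%classic; first exact: segment_compact.
  split => // x nx; rewrite /cutoff bump_eq0 ?mul0r//.
  apply/negP => /andP[cx xd]; apply: nx; rewrite /= in_itv/=.
  by rewrite !ltW.
Qed.

Lemma cutoff01 e c d x : 0 < e -> 0 <= cutoff e c d x <= 1.
Proof.
move=> e0; have b0 := bump_ge0 c d x.
have be : 0 < bump c d x + e by rewrite ltr_wpDl.
by rewrite /cutoff divr_ge0 ?(ltW be)//= ler_pdivrMr// mul1r lerDl ltW.
Qed.

Lemma cvg_cutoff c d x : c <= d ->
  cutoff (n.+1%:R^-1) c d x @[n --> \oo] --> (\1_(`]c, d[%classic) x : R).
Proof.
move=> cd; rewrite indicE mem_setE; have [cxd|ncxd] := boolP (x \in `]c, d[).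
  have b0 : 0 < bump c d x by apply: bump_gt0; rewrite in_itv/= in cxd.
  have -> : (true%:R : R) = bump c d x / (bump c d x + 0).
    by rewrite addr0 divff// gt_eqF.
  apply: cvgM; first exact: cvg_cst.
  apply: cvgV; first by rewrite addr0 gt_eqF.
  by apply: cvgD; [exact: cvg_cst|exact: cvg_harmonic].
have -> : (fun n : nat => cutoff (n.+1%:R^-1) c d x) = (fun=> 0).
  apply/funext => n; rewrite /cutoff bump_eq0 ?mul0r//.
exact: cvg_cst.
Qed.

(** The extreme points of the compact support are moved halfway towards [a] and [b], which leaves a
    nondegenerate segment even if the support is one point. The complement of the segment is open,
    so [phi] vanishes near each of its points and the derivative vanishes there too. *)
Lemma Cc1_itv (a b : R) phi : a < b -> Cc1 `]a, b[%classic phi ->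
  exists c d, [/\ a < c, c < d, d < b &
    forall x, ~ (c <= x <= d) -> phi x = 0 /\ derive1 phi x = 0].
Proof.
move=> ab [dphi cphi [K cK [Kab K0]]].
have [c [d [ac cd db Kcd]]] : exists c d, [/\ a < c, c < d, d < b &
    forall x, K x -> c <= x <= d].
  have [K_0|/set0P K_n0] := eqVneq K set0.
    exists ((a + a + b) / 3), ((a + b + b) / 3).
    split; [lra|lra|lra|]; by rewrite K_0.
  have cid : {within K, continuous (@id R)} by apply: continuous_subspaceT => x.
  have [c /set_mem cinK cmin] := compact_EVT_min K_n0 cK cid.
  have [d /set_mem dinK dmax] := compact_EVT_max K_n0 cK cid.
  have := Kab _ cinK; have := Kab _ dinK; rewrite /= !in_itv/=.
  move=> /andP[ad db] /andP[ac cb].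
  have cled : c <= d by apply: cmin; exact/mem_set.
  exists ((a + c) / 2), ((d + b) / 2); split; [lra|lra|lra|].
  move=> x Kx; have := cmin x (mem_set Kx); have := dmax x (mem_set Kx); lra.
exists c, d; split => // x ncxd.
have phi0 y : ~ (c <= y <= d) -> phi y = 0.
  by move=> ncyd; apply: K0 => /Kcd.
split; first exact: phi0.
rewrite derive1E; apply: derive_val.
have H0 := is_derive_cst (0 : R) x 1.
apply: near_eq_is_derive H0.
have : (~` `[c, d]%classic) x by rewrite /= in_itv/=.
have op : open (~` `[c, d]%classic : set R).
  by apply: closed_openC; exact: itv_closed.
rewrite openE in op => /op; apply: filterS => y /= nycd.
by rewrite phi0//; move: nycd; rewrite in_itv.
Qed.

End TestFunctions.

(** * The fundamental lemma and indefinite integrals *)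

Section DuBoisReymond.
Context {R : realType}.
Notation mu := (@lebesgue_measure R).
Notation RM := (measurableTypeR R).
Notation intb D f := (mu.-integrable D (EFin \o f)).
Implicit Types (f g h phi : RM -> R) (a b c d x y : R) (D : set RM).

Lemma measurable_cts D f : continuous (f : R -> R) -> measurable_fun D f.
Proof. by move=> cf; exact: (measurable_funTS (continuous_measurable_fun cf)). Qed.

Lemma Rint_supp D f : (forall x, ~ D x -> f x = 0) ->
  \int[mu]_(x in D) f x = \int[mu]_x f x.
Proof.
move=> f0; rewrite Rintegral_mkcond; apply: eq_Rintegral => x _.
by rewrite patchE; case: ifPn => // /negP xD; rewrite f0// => Dx; apply: xD; exact/mem_set.
Qed.

Lemma intb_supp D f : measurable D -> (forall x, ~ D x -> f x = 0) ->
  intb D f -> intb setT f.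
Proof.
move=> mD f0 /integrable_mkcond-/(_ mD); congr (mu.-integrable _ _).
apply/funext => x; rewrite patchE; case: ifPn => // /negP xD /=.
by rewrite f0// => Dx; apply: xD; exact/mem_set.
Qed.

Lemma cts_supp_bounded f c d : c < d -> continuous (f : R -> R) ->
  (forall x, ~ (c <= x <= d) -> f x = 0) -> exists M, forall x, `|f x| <= M.
Proof.
move=> cd cf f0.
have ncf : {within `[c, d], continuous (fun x => `|f x|)}.
  apply: continuous_subspaceT => x; apply: cvg_norm; exact: cf.
have [m mcd fm] := EVT_max (ltW cd) ncf.
exists `|f m| => x; have [xcd|xcd] := pselect (c <= x <= d).
  by apply: fm; rewrite in_itv.
by rewrite f0// normr0.
Qed.

Lemma cts_supp_intb f c d : c < d -> continuous (f : R -> R) ->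
  (forall x, ~ (c <= x <= d) -> f x = 0) -> intb setT f.
Proof.
move=> cd cf f0; have fi : intb `[c, d]%classic f.
  apply: continuous_compact_integrable; first exact: segment_compact.
  exact: continuous_subspaceT.
by apply: intb_supp fi => // x /=; rewrite in_itv; exact: f0.
Qed.

Lemma derivable_cts phi : (forall x, derivable (phi : R -> R) x 1) ->
  continuous (phi : R -> R).
Proof.
move=> dphi x; apply: differentiable_continuous; exact/derivable1_diffP.
Qed.

Lemma FTC_C1 phi y M : y < M -> (forall x, derivable (phi : R -> R) x 1) ->
  continuous (derive1 (phi : R -> R)) ->
  \int[mu]_(x in `[y, M]%classic) derive1 (phi : R -> R) x = phi M - phi y.
Proof.
move=> yM dphi cphi; have cp := derivable_cts dphi.
have wcphi : {within `[y, M], continuous (derive1 (phi : R -> R))}.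
  exact: continuous_subspaceT.
have dLR : derivable_oo_LRcontinuous (phi : R -> R) y M.
  split; [by move=> x _; exact: dphi|exact: (cvg_at_right_filter (cp y))|].
  exact: (cvg_at_left_filter (cp M)).
by rewrite /Rintegral (continuous_FTC2 yM wcphi dLR (fun x _ => erefl)).
Qed.

Lemma itv_oo_cc_Rint f c d : intb `[c, d]%classic f ->
  \int[mu]_(x in `]c, d[%classic) f x = \int[mu]_(x in `[c, d]%classic) f x.
Proof.
move=> fi.
rewrite Rintegral_itv_bndo_bndc; last first.
  by apply: intbS fi => //; apply: subset_itv_oo_cc.
rewrite Rintegral_itv_obnd_cbnd//.
by apply: intbS fi => //; apply: subset_itv_oc_cc.
Qed.

(** Dominated convergence along the cutoffs of []c, d[], with dominating function [|g|]. *)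
Lemma cutoff_limit a b g c d : intb `]a, b[%classic g ->
  (forall phi, Cc1 `]a, b[%classic phi ->
    \int[mu]_(x in `]a, b[%classic) (g x * phi x) = 0) ->
  a < c -> c <= d -> d < b -> \int[mu]_(x in `]c, d[%classic) g x = 0.
Proof.
move=> gi H ac cd db.
pose D : set RM := `]a, b[%classic.
rewrite -/D in gi H.
have mD : measurable (D : set RM) by exact: measurable_itv.
have mg := intb_meas gi.
have cdD : `[c, d] `<=` (D : set R).
  move=> x /=; rewrite /D /= !in_itv/= => /andP[cx xd].
  by rewrite (lt_le_trans ac cx) (le_lt_trans xd db).
pose th n : RM -> R := cutoff (n.+1%:R^-1) c d.
have Cth n : Cc1 D (th n) by apply: Cc1_cutoff => //; rewrite invr_gt0.
have mth n : measurable_fun D (th n).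
  have [dth _ _] := Cth n; exact: (measurable_cts (derivable_cts dth)).
have b01 n x : `|th n x| <= 1.
  have n0 : (0 : R) < n.+1%:R^-1 by rewrite invr_gt0.
  by have /andP[t0 t1] := cutoff01 c d x n0; rewrite ger0_norm.
have := @dominated_convergence _ _ _ mu D mD
  (fun n x => (g x * th n x)%:E) (fun x => (g x * \1_(`]c, d[%classic) x)%:E)
  (fun x => (`|g x|)%:E).
case.
- by move=> n; apply/measurable_EFinP; exact: measurable_funM.
- by apply/measurable_EFinP; apply: measurable_funM.
- apply: nearW => x Dx; apply: cvg_EFin; first by near=> n.
  by apply: cvgM; [exact: cvg_cst|exact: cvg_cutoff].
- by apply: integrable_norm.
- apply: nearW => x n Dx; rewrite lee_fin normrM -[leRHS]mulr1.
  by rewrite ler_wpM2l.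
move=> i1 _ lim.
have E n : (\int[mu]_(x in D) (g x * th n x)%:E = 0)%E.
  have gti : intb D (fun x => g x * th n x).
    apply: (@intb_eq _ _ (fun x => th n x * g x)) => // [x _|].
      by rewrite mulrC.
    exact: (@intb_bndM _ _ _ _ 1).
  by rewrite (EFin_Rint mD gti) H.
have lim0 : (\int[mu]_(x in D) (g x * th n x)%:E)%E @[n --> \oo] --> (0 : \bar R)%E.
  by under eq_fun do rewrite E; exact: cvg_cst.
have E0 : (\int[mu]_(x in D) (g x * \1_(`]c, d[%classic) x)%:E = 0)%E.
  exact: (cvg_unique (@ereal_hausdorff R) lim lim0).
have cdD' : `]c, d[ `<=` (D : set R).
  by apply: subset_trans cdD; exact: subset_itv_oo_cc.
have DI : D `&` `]c, d[%classic = `]c, d[%classic by apply/setIidr.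
rewrite -[X in \int[mu]_(x in X) _]DI Rintegral_mkcondr /Rintegral.
rewrite [X in fine X](_ : _ = 0%E)// -E0; apply: eq_integral => x _.
by rewrite patchE indicE; case: (x \in `]c, d[%classic); rewrite ?mulr1 ?mulr0.
Unshelve. all: by end_near. Qed.

(** The integrals of [g] over segments inside []a, b[] vanish, so the indefinite integral from a
    point [c < x] is constant near [x]; by Lebesgue differentiation its derivative is [g x] for
    almost every [x]. *)
Lemma fundamental_lemma a b g : intb `]a, b[%classic g ->
  (forall phi, Cc1 `]a, b[%classic phi ->
    \int[mu]_(x in `]a, b[%classic) (g x * phi x) = 0) ->
  {ae mu, forall x, `]a, b[%classic x -> g x = 0}.
Proof.
move=> gi H.
have mD : measurable (`]a, b[%classic : set RM) by exact: measurable_itv.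
pose G := g \_ `]a, b[%classic.
have Gi : locally_integrable setT G by exact: integrable_locally.
have GiT : intb setT G.
  by move/integrable_mkcond : gi => /(_ mD); rewrite restrict_EFin.
have := lebesgue_differentiation Gi.
apply: filterS; first exact: (ae_filter_ringOfSetsType mu).
move=> x Gx; rewrite /= in_itv/= => /andP[ax xb].
pose c := (a + x) / 2; pose u := (x + b) / 2.
have ac : a < c by rewrite /c; lra.
have cx : c < x by rewrite /c; lra.
have xu : x < u by rewrite /u; lra.
have ub : u < b by rewrite /u; lra.
have GiS D : measurable D -> intb D G by move=> m; apply: intbS GiT.
have Gi' : mu.-integrable [set` Interval (BLeft c) (BRight u)] (EFin \o G).
  exact: GiS.
have [dF F'] := @FTC1_lebesgue_pt R G (BLeft c) x u xu Gi' cx Gx.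
have <- : G x = g x by rewrite /G patchE mem_set//= in_itv/= ax xb.
rewrite -F' derive1E; apply: derive_val.
have H0 := is_derive_cst (0 : R) x 1; apply: near_eq_is_derive H0.
near=> y.
have cy : c <= y by apply/ltW; near: y; exact: lt_nbhsr.
have yb : y < b by near: y; exact: lt_nbhsl.
rewrite /cst -itv_oo_cc_Rint; last exact: GiS.
rewrite -(cutoff_limit gi H ac cy yb); apply: eq_Rintegral => z.
rewrite inE/= in_itv/= => /andP[cz zy]; rewrite /G patchE mem_set//= in_itv/=.
by rewrite (lt_trans ac cz) (lt_trans zy yb).
Unshelve. all: by end_near. Qed.

(** * Indefinite integrals from [-oo] *)

Definition primitive h x : R := \int[mu]_(t in `]-oo, x]%classic) h t.

Lemma primitiveB h x y : intb setT h -> x <= y ->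
  primitive h y - primitive h x = \int[mu]_(t in `]x, y]%classic) h t.
Proof.
by move=> hi xy; apply: Rintegral_itvB => //; apply: intbS hi.
Qed.

(** Absolute continuity of the integral of [|h|], applied to the union of the disjoint intervals,
    whose measure is the sum of their lengths. *)
Lemma primitive_ac h (e : R) : intb setT h -> 0 < e ->
  exists2 delta : R, 0 < delta & forall n (a b : 'I_n -> R),
    (forall i, a i <= b i) ->
    trivIset setT (fun i => `]a i, b i[%classic) ->
    \sum_(i < n) (b i - a i) < delta ->
    \sum_(i < n) `|primitive h (b i) - primitive h (a i)| < e.
Proof.
move=> hi e0.
have [delta [d0 Hd]] := integral_normr_continuous hi e0.
exists delta => // n a b ab tab sab.
have hT D : measurable D -> intb D h by move=> mD; apply: intbS hi.
have hN D : measurable D -> intb D (fun x => `|h x|).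
  by move=> mD; apply: integrable_norm; exact: hT.
pose F i : set RM := `]a i, b i[%classic.
have mF i : measurable (F i) by exact: measurable_itv.
pose A : set RM := \big[setU/set0]_(i < n) F i.
have mA : measurable A by apply: bigsetU_measurable.
have tF : trivIset [set` index_enum 'I_n] F.
  by apply: sub_trivIset tab.
have muF i : mu (F i) = (b i - a i)%:E.
  rewrite /F lebesgue_measure_itv/= lte_fin.
  have := ab i; rewrite le_eqVlt => /predU1P[->|->]; last by rewrite EFinB.
  by rewrite ltxx subrr.
have muA : (mu A < delta%:E)%E.
  rewrite (measure_semi_additive_ord mu mF tab mA).
  rewrite (eq_bigr (fun i => (b i - a i)%:E) (fun i _ => muF i)).
  by rewrite sumEFin lte_fin.
apply: le_lt_trans (Hd A mA muA).
rewrite -lee_fin -sumEFin -EFin_Rint//; last exact: hN.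
rewrite (@ge0_integral_bigsetU _ _ _ mu _ F _ (index_enum 'I_n))//=; last 2 first.
- by rewrite index_enum_uniq.
- by apply/measurable_EFinP; apply: intb_meas; exact: hN.
apply: lee_sum => i _.
rewrite primitiveB//.
rewrite EFin_Rint ?lee_fin//; last exact: hN.
rewrite itv_oo_cc_Rint; last exact: hN.
rewrite -Rintegral_itv_obnd_cbnd; last exact: hN.
by apply: le_normr_Rintegral => //; exact: hT.
Qed.

Lemma primitive_continuous h : intb setT h -> continuous (primitive h : R -> R).
Proof.
move=> hi x; apply/cvgrPdist_lt => e e0.
have [delta d0 H] := primitive_ac hi e0.
near=> y.
have H1 u v : u <= v -> v - u < delta -> `|primitive h v - primitive h u| < e.
  move=> uv vu; have := H 1%N (fun=> u) (fun=> v); rewrite !big_ord1; apply => //.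
  by move=> i j _ _ _; rewrite !ord1.
have yd : `|x - y| < delta by near: y; exact: cvgr_dist_lt.
move: yd; case: (leP x y) => xy yd.
  by rewrite distrC; apply: H1 => //; rewrite (le_lt_trans _ yd)// distrC ler_norm.
by apply: H1; [exact: ltW|rewrite (le_lt_trans _ yd)// ler_norm].
Unshelve. all: by end_near. Qed.

Lemma primitive_bounded h x : intb setT h ->
  `|primitive h x| <= \int[mu]_t `|h t|.
Proof.
move=> hi; have hx : intb `]-oo, x]%classic h by apply: intbS hi.
apply: (le_trans (le_normr_Rintegral _ hx)) => //.
rewrite -lee_fin -!EFin_Rint//; try exact: integrable_norm.
apply: ge0_subset_integral => //.
by apply: measurable_int; apply: integrable_norm hi.
Qed.

Lemma primitive_derive h : intb setT h ->
  {ae mu, forall x, is_derive (x : R) 1 (primitive h : R -> R) (h x)}.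
Proof.
move=> hi.
have hl : locally_integrable setT h.
  have := @integrable_locally _ h setT measurableT hi; congr (locally_integrable _ _).
  by apply/funext => x; rewrite patchE in_setT.
have hy y : intb `]-oo, y]%classic h by apply: intbS hi.
have := FTC1Ny hy hl.
apply: filterS; first exact: (ae_filter_ringOfSetsType mu).
move=> x /= [dP P']; apply: DeriveDef; first exact: dP.
by rewrite -derive1E; exact: P'.
Qed.

End DuBoisReymond.

(** * Weak derivatives in L^1 *)

Section WeakAntiderivative.
Context {R : realType}.
Notation mu := (@lebesgue_measure R).
Notation RM := (measurableTypeR R).
Notation intb D f := (mu.-integrable D (EFin \o f)).
Implicit Types (f g h phi : RM -> R) (a b c d x y : R) (D : set RM).

(** This is the inner integral that appears when the order of integration is exchanged in
    [primitive_by_parts]; the ray is cut at a point [M] beyond the support. *)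
Lemma ray_FTC_C1 phi c d y : c < d -> (forall x, derivable (phi : R -> R) x 1) ->
  continuous (derive1 (phi : R -> R)) ->
  (forall x, ~ (c <= x <= d) -> phi x = 0 /\ derive1 (phi : R -> R) x = 0) ->
  \int[mu]_(x in `[y, +oo[%classic) derive1 (phi : R -> R) x = - phi y.
Proof.
move=> cd dphi cphi phi0.
pose M := Num.max y d + 1.
have yd : y <= Num.max y d by rewrite le_max lexx.
have dy : d <= Num.max y d by rewrite le_max lexx orbT.
have yM : y < M by rewrite /M; lra.
have dM : d < M by rewrite /M; lra.
rewrite (_ : \int[mu]_(x in `[y, +oo[%classic) derive1 (phi : R -> R) x =
  \int[mu]_(x in `[y, M]%classic) derive1 (phi : R -> R) x).
  rewrite FTC_C1// (_ : phi M = 0) ?sub0r//.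
  by apply: (phi0 M _).1 => /andP[_]; rewrite leNgt dM.
rewrite [LHS]Rintegral_mkcond [RHS]Rintegral_mkcond; apply: eq_Rintegral => x _.
rewrite !patchE !mem_setE !in_itv/= andbT; case: (leP y x) => //= yx.
case: (leP x M) => //= Mx.
by apply: (phi0 x _).2 => /andP[_]; rewrite leNgt (lt_trans dM).
Qed.

Lemma indic_triangle x y : \1_[set z : RM * RM | z.2 <= z.1] (x, y) = (y <= x)%R%:R :> R.
Proof.
rewrite indicE; case: (boolP (y <= x)) => yx; first by rewrite mem_set.
by rewrite memNset//; exact/negP.
Qed.

(** The integrand is dominated by [|f x| |h y|], whose iterated integral is the product of two
    finite integrals. *)
Lemma integrable_triangle f h : intb setT f -> intb setT h ->
  (mu \x mu)%E.-integrable setT (fun z : RM * RM =>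
    (f z.1 * (h z.2 * \1_[set z : RM * RM | z.2 <= z.1] z))%:E).
Proof.
move=> fi hi.
have mf : measurable_fun setT f := intb_meas fi.
have mh : measurable_fun setT h := intb_meas hi.
have mT : measurable [set z : RM * RM | z.2 <= z.1].
  rewrite (_ : [set z | _] =
      setT `&` (fun z : RM * RM => (z.2 : R) <= z.1) @^-1` [set true]).
    exact: (@measurable_fun_ler _ (RM * RM)%type R setT snd fst
      measurable_snd measurable_fst measurableT [set true] I).
  by rewrite setTI; apply/seteqP; split => z /=.
have mk : measurable_fun setT (fun z : RM * RM =>
    (f z.1 * (h z.2 * \1_[set z : RM * RM | z.2 <= z.1] z))%:E).
  apply/measurable_EFinP; apply: measurable_funM.
    exact: (measurableT_comp mf measurable_fst).
  apply: measurable_funM; first exact: (measurableT_comp mh measurable_snd).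
  exact: measurable_indic.
apply/(integrable12ltyP _ _ mk).
have hN := integrable_norm hi; have fN := integrable_norm fi.
pose C := \int[mu]_y `|h y|.
apply: (@le_lt_trans _ _ (\int[mu]_x (`|f x| * C)%:E)%E); last first.
  have : intb setT (fun x => C * `|f x|) by apply: intbZ.
  move=> /(integrable_lty measurableT); apply: le_lt_trans.
  by rewrite le_eqVlt; apply/orP; left; apply/eqP; apply: eq_integral => x _ /=; rewrite mulrC.
apply: ge0_le_integral => //.
- by move=> x _; exact: integral_ge0.
- have := @measurable_fun_fubini_tonelli_F _ _ _ _ _ mu
    (fun z : RM * RM => `|(f z.1 * (h z.2 * \1_[set z : RM * RM | z.2 <= z.1] z))%:E|%E).
  by apply; [exact: measurableT_comp|].
- by apply/measurable_EFinP; apply: measurable_funM => //; exact: measurableT_comp.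
move=> x _.
have -> : (`|f x| * C)%:E = (\int[mu]_y (`|f x| * `|h y|)%:E)%E.
  by rewrite (EFin_Rint measurableT (intbZ _ measurableT hN)) RintegralZl.
apply: ge0_le_integral => //=.
- apply/measurable_EFinP; apply: measurableT_comp => //.
  apply: measurable_funM => //; apply: measurable_funM => //.
  apply: (eq_measurable_fun (\1_(`]-oo, x]%classic : set RM) : RM -> R)).
    by move=> y _; rewrite indic_triangle indicE mem_setE in_itv.
  by apply: measurable_indic; exact: measurable_itv.
- by apply/measurable_EFinP; apply: measurable_funM => //; exact: measurableT_comp.
- move=> y _; rewrite lee_fin !normrM ler_wpM2l// ler_piMr//.
  by rewrite ger0_norm// indicE; case: (_ \in _).
Qed.

(* Fubini on the half plane [y <= x]. *)
Lemma primitive_by_parts phi h c d : c < d -> intb setT h ->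
  (forall x, derivable (phi : R -> R) x 1) -> continuous (derive1 (phi : R -> R)) ->
  (forall x, ~ (c <= x <= d) -> phi x = 0 /\ derive1 (phi : R -> R) x = 0) ->
  \int[mu]_x (primitive h x * derive1 (phi : R -> R) x) =
  - \int[mu]_x (h x * phi x).
Proof.
move=> cd hi dphi cphi phi0.
have cp := derivable_cts dphi.
pose f : RM -> R := derive1 (phi : R -> R).
have fi : intb setT f by apply: (cts_supp_intb cd cphi) => x /phi0[].
have [M phiM] : exists M, forall x, `|phi x| <= M.
  by apply: (cts_supp_bounded cd cp) => x /phi0[].
have hphi : intb setT (fun x => h x * phi x).
  apply: (@intb_eq _ _ (fun x => phi x * h x)) => // [x _|]; first by rewrite mulrC.
  by apply: (@intb_bndM _ _ _ _ M) => //; exact: measurable_cts.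
have Hf : intb setT (fun x => primitive h x * f x).
  apply: (@intb_bndM _ _ _ _ (\int[mu]_t `|h t|)) => //.
    by apply: measurable_cts; exact: primitive_continuous.
  by move=> x _; exact: primitive_bounded.
have := Fubini (integrable_triangle fi hi).
have -> : (\int[mu]_x \int[mu]_y (f (x, y).1 * (h (x, y).2 *
    \1_[set z : RM * RM | (z.2 <= z.1)%R] (x, y)))%:E =
    \int[mu]_x (primitive h x * f x)%:E)%E.
  apply: eq_integral => x _ /=.
  have hx : intb `]-oo, x]%classic h by apply: intbS hi.
  rewrite /primitive mulrC -RintegralZl// -(EFin_Rint _ (intbZ _ _ hx))//.
  rewrite [RHS]integral_mkcond; apply: eq_integral => y _.
  rewrite indic_triangle patchE mem_setE in_itv/=.
  by case: (y <= x); rewrite ?mulr1 ?mulr0 ?mulr0.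
have -> : (\int[mu]_y \int[mu]_x (f (x, y).1 * (h (x, y).2 *
    \1_[set z : RM * RM | (z.2 <= z.1)%R] (x, y)))%:E =
    \int[mu]_y (- (h y * phi y))%:E)%E.
  apply: eq_integral => y _ /=.
  have fy : intb `[y, +oo[%classic f by apply: intbS fi.
  rewrite -mulrN -(ray_FTC_C1 y cd dphi cphi phi0) -RintegralZl//.
  rewrite -(EFin_Rint _ (intbZ _ _ fy))//.
  rewrite [RHS]integral_mkcond; apply: eq_integral => x _.
  rewrite indic_triangle patchE mem_setE in_itv/= andbT.
  by case: (y <= x); rewrite ?mulr1 ?mulr0 ?mulr0// mulrC.
rewrite (EFin_Rint _ Hf)// (EFin_Rint _ (intbN _ hphi))// => -[->].
by rewrite -mulN1r -RintegralZl//; apply: eq_Rintegral => x _; rewrite mulN1r.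
Qed.

(** If every test function had integral 0, the fundamental lemma applied to the constant 1 would
    give [1 = 0] almost everywhere on an interval of positive measure. *)
Lemma exists_unit_test a b : a < b ->
  exists2 psi : RM -> R, Cc1 `]a, b[%classic psi & \int[mu]_x psi x != 0.
Proof.
move=> ab; apply: contrapT => H.
have mD : measurable (`]a, b[%classic : set RM) by exact: measurable_itv.
have fD : (mu `]a, b[%classic < +oo)%E.
  by rewrite lebesgue_measure_itv/=; case: ifP => _; rewrite ?ltry.
have one : {ae mu, forall x, `]a, b[%classic x -> (1 : R) = 0}.
  apply: (@fundamental_lemma _ a b (fun=> 1)); first exact: intb_cst.
  move=> phi phiC; apply: contrapT => nphi; apply: H; exists phi => //.
  apply/eqP => E; apply: nphi; rewrite -E -[RHS](@Rint_supp _ `]a, b[%classic).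
    by apply: eq_Rintegral => x _; rewrite mul1r.
  by move=> x nx; have [_ _ [K _ [KD ->//]]] := phiC; move=> /KD.
have : (mu `]a, b[%classic = 0)%E.
  have [N [mN N0 HN]] := one.
  apply/eqP; rewrite eq_le measure_ge0 andbT -N0; apply: le_measure; rewrite ?inE//.
  by move=> x Dx; apply: HN => /= /(_ Dx)/eqP; rewrite oner_eq0.
rewrite lebesgue_measure_itv/= lte_fin ab => -[] /eqP.
by rewrite subr_eq0 gt_eqF.
Qed.

(** The zero mean is what makes the primitive vanish to the right of [d], so that it is again
    compactly supported. *)
Lemma Cc1_primitive a b c d psi : a < c -> c < d -> d < b ->
  continuous (psi : R -> R) -> (forall x, ~ (c <= x <= d) -> psi x = 0) ->
  \int[mu]_x psi x = 0 ->
  Cc1 `]a, b[%classic (primitive psi) /\ derive1 (primitive psi : R -> R) = psi.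
Proof.
move=> ac cd db cpsi psi0 Ipsi.
have pi := cts_supp_intb cd cpsi psi0.
have D x : derivable (primitive psi : R -> R) x 1 /\ derive1 (primitive psi : R -> R) x = psi x.
  have x1 : x < x + 1 by rewrite ltrDl.
  have pix : intb [set` Interval -oo%O (BRight (x + 1))] psi by apply: intbS pi.
  by apply: (@continuous_FTC1 _ psi -oo%O x (x + 1) x1 pix); [rewrite ltNyr|exact: cpsi].
have dE : derive1 (primitive psi : R -> R) = psi by apply/funext => x; have [] := D x.
split=> //; split.
- by move=> x; have [] := D x.
- by rewrite dE.
- exists `[c, d]%classic; first exact: segment_compact.
  split.
    move=> x /=; rewrite !in_itv/= => /andP[cx xd].
    by rewrite (lt_le_trans ac cx) (le_lt_trans xd db).
  move=> x /=; rewrite in_itv/= => /negP; rewrite negb_and -!ltNge => /orP[xc|dx].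
    rewrite /primitive (_ : \int[mu]_(t in _) _ = \int[mu]_(t in `]-oo, x]%classic) 0).
      by rewrite Rintegral_cst ?mul0r.
    apply: eq_Rintegral => t; rewrite inE/= in_itv/= => tx; apply: psi0.
    by move=> /andP[ct _]; have := le_lt_trans (le_trans ct tx) xc; rewrite ltxx.
  rewrite /primitive -Ipsi; apply: Rint_supp => t /=.
  rewrite in_itv/= => /negP; rewrite -ltNge => xt; apply: psi0 => /andP[_ td].
  by have := lt_le_trans (lt_trans dx xt) td; rewrite ltxx.
Qed.

Lemma RintM_supp D phi : (forall x, ~ D x -> phi x = 0) ->
  forall F, \int[mu]_(x in D) (F x * phi x) = \int[mu]_x (F x * phi x).
Proof. by move=> p0 F; apply: Rint_supp => x /p0 ->; rewrite mulr0. Qed.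

(** For a test function [phi], the combination [chi = phi - (I / m0) psi] has mean zero, hence is
    the derivative of a test function. The hypothesis on that test function says that [F - k]
    integrates to 0 against [phi], where [k] is the mean of [F] weighted by [psi]. *)
Lemma weakly_constant a b F : a < b -> intb `]a, b[%classic F ->
  (forall phi, Cc1 `]a, b[%classic phi ->
    \int[mu]_(x in `]a, b[%classic) (F x * derive1 (phi : R -> R) x) = 0) ->
  exists k, {ae mu, forall x, `]a, b[%classic x -> F x = k}.
Proof.
move=> ab Fi H.
have mD : measurable (`]a, b[%classic : set RM) by exact: measurable_itv.
have [psi psiC psin0] := exists_unit_test ab.
have [c0 [d0 [ac0 cd0 db0 psi0]]] := Cc1_itv ab psiC.
have [dpsi _ _] := psiC; have cpsi := derivable_cts dpsi.
have psii : intb setT psi by apply: (cts_supp_intb cd0 cpsi) => x /psi0[].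
have bM phi : Cc1 `]a, b[%classic phi -> intb `]a, b[%classic (fun x => F x * phi x).
  move=> phiC; have [c [d [ac cd db phi0]]] := Cc1_itv ab phiC.
  have [dphi _ _] := phiC; have cphi := derivable_cts dphi.
  have [M HM] : exists M, forall x, `|phi x| <= M.
    by apply: (cts_supp_bounded cd cphi) => x /phi0[].
  apply: (@intb_eq _ _ (fun x => phi x * F x)) => // [x _|]; first by rewrite mulrC.
  by apply: (@intb_bndM _ _ _ _ M) => //; exact: measurable_cts.
set m0 := \int[mu]_x psi x in psin0.
pose k := \int[mu]_(x in `]a, b[%classic) (F x * psi x) / m0.
exists k.
have fD : (mu `]a, b[%classic < +oo)%E.
  by rewrite lebesgue_measure_itv/=; case: ifP => _; rewrite ?ltry.
suff : {ae mu, forall x, `]a, b[%classic x -> F x - k = 0}.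
  by apply: ae_imply => x + Dx => /(_ Dx)/eqP; rewrite subr_eq0 => /eqP.
apply: fundamental_lemma; first by apply: intbB => //; exact: intb_cst.
move=> phi phiC; have [c [d [ac cd db phi0]]] := Cc1_itv ab phiC.
have [dphi _ _] := phiC; have cphi := derivable_cts dphi.
have phii : intb setT phi by apply: (cts_supp_intb cd cphi) => x /phi0[].
pose I := \int[mu]_x phi x.
pose chi : RM -> R := fun x => phi x + (- (I / m0)) * psi x.
have cchi : continuous (chi : R -> R).
  move=> x; apply: cvgD; first exact: cphi.
  by apply: cvgM; [exact: cvg_cst|exact: cpsi].
have chi0 x : ~ (Num.min c c0 <= x <= Num.max d d0) -> chi x = 0.
  move=> /negP; rewrite negb_and -!ltNge lt_min gt_max => xx.
  rewrite /chi; have [-> _] : phi x = 0 /\ derive1 (phi : R -> R) x = 0.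
    by apply: phi0 => /andP[u v]; case/orP: xx => /andP[]; lra.
  have [-> _] : psi x = 0 /\ derive1 (psi : R -> R) x = 0.
    by apply: psi0 => /andP[u v]; case/orP: xx => /andP[]; lra.
  by rewrite mulr0 addr0.
have Ichi : \int[mu]_x chi x = 0.
  rewrite RintegralD//; last exact: intbZ.
  by rewrite RintegralZl// -/I -/m0 mulNr divfK// subrr.
have [] := @Cc1_primitive a b (Num.min c c0) (Num.max d d0) chi _ _ _ cchi chi0 Ichi.
- by rewrite lt_min ac.
- by rewrite gt_min lt_max cd.
- by rewrite gt_max db.
move=> PC dP; have := H _ PC; rewrite dP => E.
have -> : \int[mu]_(x in `]a, b[%classic) ((F x - k) * phi x) =
  \int[mu]_(x in `]a, b[%classic) (F x * phi x) - k * \int[mu]_(x in `]a, b[%classic) phi x.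
  rewrite -RintegralZl//; last by apply: intbS phii.
  rewrite -RintegralB//; [|exact: bM|by apply: intbZ => //; apply: intbS phii].
  by apply: eq_Rintegral => x _; rewrite mulrBl.
have phiD x : ~ `]a, b[%classic x -> phi x = 0.
  by move=> nx; have [_ _ [K _ [KD ->//]]] := phiC; move=> /KD.
rewrite (Rint_supp phiD) -/I.
move: E; rewrite (_ : (fun x => F x * chi x) =
   (fun x => F x * phi x + (- (I / m0)) * (F x * psi x))); last first.
  by apply/funext => x; rewrite /chi; ring.
rewrite RintegralD//; [|exact: bM|by apply: intbZ => //; exact: bM].
rewrite RintegralZl//; last exact: bM.
by rewrite /k => <-; ring.
Qed.

(** By [primitive_by_parts], [primitive h] has the same weak derivative as [f], so their difference
    is weakly constant. *)
Lemma weak_derivative_primitive a b f h : a < b -> intb `]a, b[%classic f ->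
  intb setT h ->
  (forall phi, Cc1 `]a, b[%classic phi ->
    \int[mu]_(x in `]a, b[%classic) (f x * derive1 (phi : R -> R) x) =
    - \int[mu]_(x in `]a, b[%classic) (h x * phi x)) ->
  exists k, {ae mu, forall x, `]a, b[%classic x -> f x = k + primitive h x}.
Proof.
move=> ab fi hi H.
have mD : measurable (`]a, b[%classic : set RM) by exact: measurable_itv.
have fD : (mu `]a, b[%classic < +oo)%E.
  by rewrite lebesgue_measure_itv/=; case: ifP => _; rewrite ?ltry.
have mH : measurable_fun `]a, b[%classic (primitive h).
  by apply: measurable_cts; exact: primitive_continuous.
have Hi : intb `]a, b[%classic (primitive h).
  apply: (@intb_le _ _ _ (fun=> \int[mu]_t `|h t|)) => //; last exact: intb_cst.
  by move=> x _; exact: primitive_bounded.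
have [k Hk] : exists k, {ae mu, forall x, `]a, b[%classic x -> f x - primitive h x = k}.
  apply: weakly_constant => //; first exact: intbB.
  move=> phi phiC; have [c [d [ac cd db phi0]]] := Cc1_itv ab phiC.
  have [dphi cdphi _] := phiC; have cphi := derivable_cts dphi.
  have [M HM] : exists M, forall x, `|derive1 (phi : R -> R) x| <= M.
    by apply: (cts_supp_bounded cd cdphi) => x /phi0[].
  have mdp D : measurable_fun D (derive1 (phi : R -> R) : RM -> R).
    exact: measurable_cts.
  have bM g : intb `]a, b[%classic g ->
      intb `]a, b[%classic (fun x => g x * derive1 (phi : R -> R) x).
    move=> gi; apply: (@intb_eq _ _ (fun x => derive1 (phi : R -> R) x * g x)) => //.
      by move=> x _; rewrite mulrC.
    by apply: (@intb_bndM _ _ _ _ M).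
  have phiD x : ~ `]a, b[%classic x -> phi x = 0 /\ derive1 (phi : R -> R) x = 0.
    move=> nx; apply: phi0 => /andP[cx xd]; apply: nx; rewrite /= in_itv/=.
    by rewrite (lt_le_trans ac cx) (le_lt_trans xd db).
  rewrite (_ : (fun x => (f x - primitive h x) * derive1 (phi : R -> R) x) =
   (fun x => f x * derive1 (phi : R -> R) x - primitive h x * derive1 (phi : R -> R) x)).
    rewrite RintegralB ?H//; [|exact: bM|exact: bM].
    rewrite (@RintM_supp _ phi); last by move=> x /phiD[].
    rewrite (@RintM_supp _ (derive1 (phi : R -> R))); last by move=> x /phiD[].
    by rewrite (primitive_by_parts cd hi dphi cdphi phi0) opprK addNr.
  by apply/funext => x; rewrite mulrBl.
exists k; apply: ae_imply Hk => x + Dx => /(_ Dx) <-; ring.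
Qed.

End WeakAntiderivative.

(** * The space H^1_0 *)

Section Sobolev.
Context {R : realType} (L : R) (L_gt0 : 0 < L).
Notation mu := (@lebesgue_measure R).
Notation RM := (measurableTypeR R).
Notation intb D f := (mu.-integrable D (EFin \o f)).
Notation Om := (Omega L : set RM).
Notation wd := (wderiv (Omega L)).
Implicit Types (f g h p phi psi u v : RM -> R) (x y e s t : R).

Lemma measurable_Omega : measurable Om.
Proof. exact: measurable_itv. Qed.
Local Notation mOm := measurable_Omega.

Lemma mu_Omega : mu Om = (2 * L)%:E.
Proof.
rewrite /Omega lebesgue_measure_itv/= lte_fin ifT; last by have := L_gt0; lra.
by rewrite -EFinB; congr EFin; ring.
Qed.

Lemma fin_Omega : (mu Om < +oo)%E.
Proof. by rewrite mu_Omega ltry. Qed.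
Local Notation fOm := fin_Omega.

(** A neighbourhood contains a ball of positive measure, which no null set contains. Through this,
    almost-everywhere information on continuous functions becomes pointwise. *)
Lemma ae_nbhs (A P : RM -> Prop) (x : R) : nbhs x (A : set R) ->
  {ae mu, forall y, P y} -> exists2 y, A y & P y.
Proof.
move=> /nbhs_ballP[e /= e0 eA] [N [mN N0 HN]]; apply: contrapT => H.
have bN : ball x e `<=` N.
  by move=> y xy; apply: HN => /= Py; apply: H; exists y => //; exact: eA.
have : (mu (ball x e) <= 0)%E.
  rewrite -N0; apply: le_measure; rewrite ?inE//; exact: measurable_ball.
have -> := lebesgue_measure_ball x (ltW e0).
by rewrite lee_fin leNgt pmulrn_lgt0// e0.
Qed.

Lemma ae_cts_eq0 f x : continuous (f : R -> R) -> Om x ->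
  {ae mu, forall y, Om y -> f y = 0} -> f x = 0.
Proof.
move=> cf Ox H; apply/eqP/negPn/negP => fx.
have [y [Oy fy0]] : exists2 y, (Om y /\ f y != 0) & (Om y -> f y = 0).
  apply: ae_nbhs H; apply: filterI.
    exact: (near_in_itvoo Ox).
  exact: (cvgr_neq0 (f x) (cf x) fx).
by move=> /(_ Oy) E; rewrite E eqxx in fy0.
Qed.

Lemma Cc1_out phi : Cc1 Om phi -> forall x, ~ Om x ->
  phi x = 0 /\ derive1 (phi : R -> R) x = 0.
Proof.
move=> phiC x nx; have LL : - L < L by have := L_gt0; lra.
have [c [d [ac cd db phi0]]] := Cc1_itv LL phiC.
apply: phi0 => /andP[cx xd]; apply: nx; rewrite /Omega /= in_itv/=.
by rewrite (lt_le_trans ac cx) (le_lt_trans xd db).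
Qed.

Lemma Cc1_support phi : Cc1 Om phi -> exists c d, [/\ c < d,
  forall x, derivable (phi : R -> R) x 1, continuous (derive1 (phi : R -> R)) &
  forall x, ~ (c <= x <= d) -> phi x = 0 /\ derive1 (phi : R -> R) x = 0].
Proof.
move=> phiC; have LL : - L < L by have := L_gt0; lra.
have [c [d [ac cd db phi0]]] := Cc1_itv LL phiC; have [dp cp _] := phiC.
by exists c, d; split; [exact: cd|exact: dp|exact: cp|exact: phi0].
Qed.

Lemma Cc1_L2 phi : Cc1 Om phi ->
  L2 Om phi /\ L2 Om (derive1 (phi : R -> R)).
Proof.
move=> phiC; have [c [d [cd dphi cdphi phi0]]] := Cc1_support phiC.
have cphi := derivable_cts dphi.
have [M HM] : exists M, forall x, `|phi x| <= M.
  by apply: (cts_supp_bounded cd cphi) => x /phi0[].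
have [M' HM'] : exists M, forall x, `|derive1 (phi : R -> R) x| <= M.
  by apply: (cts_supp_bounded cd cdphi) => x /phi0[].
split.
  apply: (@L2_bounded _ _ _ M) => //; [exact: mOm|exact: fOm|exact: measurable_cts].
apply: (@L2_bounded _ _ _ M') => //; [exact: mOm|exact: fOm|exact: measurable_cts].
Qed.

(** Products of [L2] functions are integrable, so the extended integrals of the definition are
    real. *)
Lemma weak_derivP u g : L2 Om u -> L2 Om g ->
  weak_derivative Om u g <-> (forall phi, Cc1 Om phi ->
    \int[mu]_(x in Om) (u x * derive1 (phi : R -> R) x) =
    - \int[mu]_(x in Om) (g x * phi x)).
Proof.
move=> uL gL; split => H phi phiC; have [pL dpL] := Cc1_L2 phiC.
- have := H phi phiC.
  rewrite (EFin_Rint mOm (L2M mOm uL dpL)) (EFin_Rint mOm (L2M mOm gL pL)).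
  by rewrite -EFinN => -[].
- rewrite (EFin_Rint mOm (L2M mOm uL dpL)) (EFin_Rint mOm (L2M mOm gL pL)).
  by rewrite -EFinN H.
Qed.

Lemma weak_deriv_unique u g1 g2 : L2 Om g1 -> L2 Om g2 ->
  weak_derivative Om u g1 -> weak_derivative Om u g2 ->
  {ae mu, forall x, Om x -> g1 x = g2 x}.
Proof.
move=> g1L g2L H1 H2.
suff : {ae mu, forall x, Om x -> g1 x - g2 x = 0}.
  by apply: ae_imply => x + Ox => /(_ Ox)/eqP; rewrite subr_eq0 => /eqP.
apply: fundamental_lemma.
  by apply: L2_int; [exact: mOm|exact: fOm|apply: L2B => //; exact: mOm].
move=> phi phiC; have [pL dpL] := Cc1_L2 phiC.
have := H1 phi phiC; rewrite (H2 phi phiC).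
rewrite (EFin_Rint mOm (L2M mOm g1L pL)) (EFin_Rint mOm (L2M mOm g2L pL)).
rewrite -!EFinN => -[] /oppr_inj E.
rewrite (_ : (fun x => (g1 x - g2 x) * phi x) = (fun x => g1 x * phi x - g2 x * phi x)).
  rewrite RintegralB; [|exact: mOm|exact: L2M mOm g1L pL|exact: L2M mOm g2L pL].
  by rewrite E subrr.
by apply/funext => x; rewrite mulrBl.
Qed.

(** Restricting any [L2] weak derivative to [Omega] gives a witness that vanishes outside, so the
    choice in [wderiv] is not the default value. *)
Lemma wderivP u : H1 Om u ->
  [/\ L2 Om (wd u), weak_derivative Om u (wd u) & forall x, ~ Om x -> wd u x = 0].
Proof.
move=> [uL [g gL gW]]; rewrite /wderiv; set P := (P in xget _ P).
suff : exists g0, P g0 by move=> /(xgetPex (cst 0)).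
exists (g \_ Om); have gE x : Om x -> g x = (g \_ Om) x.
  by move=> Ox; rewrite patchE mem_set.
split.
- apply: (@L2_ae _ _ g) => //; first exact: mOm.
    by apply/(measurable_restrict _ mOm mOm); rewrite setIid; exact: L2_meas mOm gL.
  by apply: aeW => x Ox; exact: gE.
- move=> phi phiC; rewrite (gW phi phiC); congr (- _)%E; apply: eq_integral => x.
  by rewrite inE => Ox; rewrite gE.
- by move=> x nx; rewrite patchE memNset.
Qed.

Lemma wd_ae u g : H1 Om u -> L2 Om g -> weak_derivative Om u g ->
  {ae mu, forall x, Om x -> wd u x = g x}.
Proof.
move=> uH gL gW; have [wL wW _] := wderivP uH.
exact: weak_deriv_unique wW gW.
Qed.

Lemma weak_deriv_lin u v g h s t : L2 Om u -> L2 Om v -> L2 Om g -> L2 Om h ->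
  weak_derivative Om u g -> weak_derivative Om v h ->
  weak_derivative Om (fun x => s * u x + t * v x) (fun x => s * g x + t * h x).
Proof.
move=> uL vL gL hL /(weak_derivP uL gL) ug /(weak_derivP vL hL) vh.
have lin f1 f2 : L2 Om f1 -> L2 Om f2 -> L2 Om (fun x => s * f1 x + t * f2 x).
  by move=> f1L f2L; apply: L2D => //; try exact: mOm; apply: L2Z => //; exact: mOm.
have I f1 f2 f3 : L2 Om f1 -> L2 Om f2 -> L2 Om f3 ->
   \int[mu]_(x in Om) ((s * f1 x + t * f2 x) * f3 x) =
   s * \int[mu]_(x in Om) (f1 x * f3 x) + t * \int[mu]_(x in Om) (f2 x * f3 x).
  move=> f1L f2L f3L; have i1 := L2M mOm f1L f3L; have i2 := L2M mOm f2L f3L.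
  rewrite -RintegralZl//; last exact: mOm.
  rewrite -RintegralZl//; last exact: mOm.
  rewrite -RintegralD; [|exact: mOm|by apply: intbZ => //; exact: mOm..].
  by apply: eq_Rintegral => x _; ring.
apply/weak_derivP => [||phi phiC]; [exact: lin|exact: lin|].
have [pL dpL] := Cc1_L2 phiC.
by rewrite !I// ug// vh//; ring.
Qed.

Lemma H1_lin u v s t : H1 Om u -> H1 Om v -> H1 Om (fun x => s * u x + t * v x).
Proof.
move=> [uL [g gL gW]] [vL [h hL hW]]; split.
  by apply: L2D; [exact: mOm|apply: L2Z => //; exact: mOm..].
exists (fun x => s * g x + t * h x); last exact: weak_deriv_lin.
by apply: L2D; [exact: mOm|apply: L2Z => //; exact: mOm..].
Qed.

(** Each [wd] is chosen separately, so linearity holds only up to a null set. *)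
Lemma wd_lin u v s t : H1 Om u -> H1 Om v ->
  {ae mu, forall x, Om x -> wd (fun x => s * u x + t * v x) x = s * wd u x + t * wd v x}.
Proof.
move=> uH vH; have [uwL uwW _] := wderivP uH; have [vwL vwW _] := wderivP vH.
apply: wd_ae; first exact: H1_lin.
- by apply: L2D; [exact: mOm|apply: L2Z => //; exact: mOm..].
- by case: uH => uL _; case: vH => vL _; exact: weak_deriv_lin.
Qed.

Lemma wd_B u v : H1 Om u -> H1 Om v ->
  {ae mu, forall x, Om x -> wd (u \- v) x = wd u x - wd v x}.
Proof.
move=> uH vH; have := wd_lin 1 (-1) uH vH.
have -> : (fun x => 1 * u x + -1 * v x) = u \- v.
  by apply/funext => x /=; ring.
by apply: ae_imply => x + Ox => /(_ Ox) ->; ring.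
Qed.

Lemma H1_B u v : H1 Om u -> H1 Om v -> H1 Om (u \- v).
Proof.
move=> uH vH; have := H1_lin 1 (-1) uH vH.
by congr (H1 Om _); apply/funext => x /=; ring.
Qed.

Lemma sqn_wdB u v : H1 Om u -> H1 Om v ->
  sqn Om (wd (u \- v)) = sqn Om (fun x => wd u x - wd v x).
Proof.
move=> uH vH; have [uwL _ _] := wderivP uH; have [vwL _ _] := wderivP vH.
have [wL _ _] := wderivP (H1_B uH vH).
apply: sqn_ae; [exact: mOm|exact: L2_meas mOm wL| |exact: wd_B].
by apply: L2_meas; [exact: mOm|apply: L2B => //; exact: mOm].
Qed.

Lemma H10norm_lt u e : H1 Om u -> 0 < e ->
  (H10norm Om u < e%:E)%E = (sqn Om (wd u) < e ^+ 2).
Proof.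
by move=> uH e0; have [wL _ _] := wderivP uH; rewrite /H10norm L2norm_lt//; exact: mOm.
Qed.

Lemma primitive_C1 phi c d x : c < d -> (forall x, derivable (phi : R -> R) x 1) ->
  continuous (derive1 (phi : R -> R)) ->
  (forall x, ~ (c <= x <= d) -> phi x = 0 /\ derive1 (phi : R -> R) x = 0) ->
  primitive (derive1 (phi : R -> R)) x = phi x.
Proof.
move=> cd dphi cphi phi0.
pose m := Num.min x c - 1.
have xm : Num.min x c <= x by rewrite ge_min lexx.
have cm : Num.min x c <= c by rewrite ge_min lexx orbT.
have mx : m < x by rewrite /m; lra.
have mc : m < c by rewrite /m; lra.
rewrite /primitive (_ : \int[mu]_(y in `]-oo, x]%classic) derive1 (phi : R -> R) y =
  \int[mu]_(y in `[m, x]%classic) derive1 (phi : R -> R) y).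
  rewrite FTC_C1// (_ : phi m = 0) ?subr0//.
  by apply: (phi0 m _).1 => /andP[]; rewrite leNgt mc.
rewrite [LHS]Rintegral_mkcond [RHS]Rintegral_mkcond; apply: eq_Rintegral => y _.
rewrite !patchE !mem_setE !in_itv/=; case: (leP y x) => //= yx; last by rewrite andbF.
case: (leP m y) => //= my.
by apply: (phi0 y _).2 => /andP[+ _]; rewrite leNgt (lt_trans my).
Qed.

(** [phi] is the primitive of its classical derivative, so [primitive_by_parts] applies. *)
Lemma Cc1_weak phi : Cc1 Om phi -> weak_derivative Om phi (derive1 (phi : R -> R)).
Proof.
move=> phiC; have [pL dpL] := Cc1_L2 phiC; apply/weak_derivP => // psi psiC.
have [c [d [cd dphi cdphi phi0]]] := Cc1_support phiC.
have [c' [d' [cd' dpsi cdpsi psi0]]] := Cc1_support psiC.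
have phii : intb setT (derive1 (phi : R -> R) : RM -> R).
  by apply: (cts_supp_intb cd cdphi) => x /phi0[].
rewrite (@RintM_supp _ _ psi); last by move=> x /(Cc1_out psiC)[].
rewrite (@RintM_supp _ _ (derive1 (psi : R -> R))); last by move=> x /(Cc1_out psiC)[].
rewrite -(primitive_by_parts cd' phii dpsi cdpsi psi0); apply: eq_Rintegral => x _.
by rewrite (primitive_C1 x cd dphi cdphi phi0).
Qed.

Lemma Cc1_H1 phi : Cc1 Om phi -> H1 Om phi.
Proof.
move=> phiC; have [pL dpL] := Cc1_L2 phiC; split => //.
by exists (derive1 (phi : R -> R)) => //; exact: Cc1_weak.
Qed.

Lemma wd_Cc1 phi : Cc1 Om phi ->
  {ae mu, forall x, Om x -> wd phi x = derive1 (phi : R -> R) x}.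
Proof.
move=> phiC; have [pL dpL] := Cc1_L2 phiC.
apply: wd_ae => //; [exact: Cc1_H1|exact: Cc1_weak].
Qed.

(** The closure condition of [H10], restated with real squared norms and with the classical
    derivative of the test function in place of its [wderiv]. *)
Definition approximable u : Prop := forall e, 0 < e -> exists2 phi, Cc1 Om phi &
  sqn Om (fun x => u x - phi x) < e /\
  sqn Om (fun x => wd u x - derive1 (phi : R -> R) x) < e.

Lemma sqn_wdBC u phi : H1 Om u -> Cc1 Om phi -> sqn Om (wd (u \- phi)) =
  sqn Om (fun x => wd u x - derive1 (phi : R -> R) x).
Proof.
move=> uH phiC; have pH := Cc1_H1 phiC; have [uL _ _] := wderivP uH.
have [pL _ _] := wderivP pH; have [_ dpL] := Cc1_L2 phiC.
rewrite sqn_wdB//; apply: sqn_ae; first exact: mOm.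
- by apply: L2_meas; [exact: mOm|apply: L2B => //; exact: mOm].
- by apply: L2_meas; [exact: mOm|apply: L2B => //; exact: mOm].
- by apply: ae_imply (wd_Cc1 phiC) => x + Ox => ->.
Qed.

Lemma H10P u : H10 Om u <->
  [/\ H1 Om u, approximable u, continuous (u : R -> R) & forall x, ~ Om x -> u x = 0].
Proof.
split=> -[uH uA uc u0]; split => // e e0.
- have se : 0 < Num.sqrt e by rewrite sqrtr_gt0.
  have [phi phiC H] := uA _ se; exists phi => //.
  have pH := Cc1_H1 phiC; have bH := H1_B uH pH; have [wL _ _] := wderivP bH.
  rewrite /H1norm in H.
  have N0 D f : (0 <= L2norm D f)%E by exact: Lnorm_ge0.
  have e2 : e = Num.sqrt e ^+ 2 by rewrite sqr_sqrtr// ltW.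
  split; rewrite e2.
  + rewrite -(L2norm_lt mOm)//; last by case: bH.
    by apply: le_lt_trans H; rewrite leeDl.
  + rewrite -sqn_wdBC// -(L2norm_lt mOm)//.
    by apply: le_lt_trans H; rewrite leeDr.
- have e20 : 0 < e / 2 by rewrite divr_gt0.
  have [|phi phiC [H1' H2']] := uA ((e / 2) ^+ 2); first by rewrite exprn_gt0.
  exists phi => //.
  have pH := Cc1_H1 phiC; have bH := H1_B uH pH; have [wL _ _] := wderivP bH.
  rewrite [e]splitr EFinD; apply: lteD.
  + by rewrite (L2norm_lt mOm)//; case: bH.
  + by rewrite (L2norm_lt mOm)// sqn_wdBC.
Qed.

End Sobolev.

(** * The sup-norm bound and the completeness of H^1_0 *)

Section SobolevComplete.
Context {R : realType} (L : R) (L_gt0 : 0 < L).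
Notation mu := (@lebesgue_measure R).
Notation RM := (measurableTypeR R).
Notation intb D f := (mu.-integrable D (EFin \o f)).
Notation Om := (Omega L : set RM).
Notation wd := (wderiv (Omega L)).
Implicit Types (f g h p phi psi u v : RM -> R) (x y e s t : R).

Let mOm : measurable Om := measurable_Omega L.
Let fOm : (mu Om < +oo)%E := fin_Omega L_gt0.

Lemma L2_supp_intb g : L2 Om g -> (forall x, ~ Om x -> g x = 0) -> intb setT g.
Proof. by move=> gL g0; apply: intb_supp (L2_int mOm fOm gL). Qed.

(** The extra [1] keeps the inequality strict when both weights vanish. *)
Lemma weighted_lt (p q a b d : R) : 0 <= p -> 0 <= q -> 0 < d -> a < d -> b < d ->
  2 * p * a + 2 * q * b < (2 * p + 2 * q + 1) * d.
Proof.
move=> p0 q0 d0 ad bd.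
by have := ler_wpM2l p0 (ltW ad); have := ler_wpM2l q0 (ltW bd); lra.
Qed.

Lemma sqn0 : sqn Om (fun=> 0) = 0.
Proof.
by rewrite /sqn; under eq_Rintegral do rewrite expr0n; rewrite Rintegral_cst// mul0r.
Qed.

Lemma sqn_le_cst f c : measurable_fun Om f -> (forall x, Om x -> f x ^+ 2 <= c) ->
  L2 Om f /\ sqn Om f <= 2 * L * c.
Proof.
move=> mf fc.
(* hidden *)
have fL : L2 Om f.
  apply: (@L2_bounded _ _ _ (Num.max 1 c)) => // x Ox.
  have := fc x Ox; rewrite -(real_normK (num_real (f x))) => H.
  rewrite le_max; case: (leP `|f x| 1) => //= f1.
  by apply: le_trans H; rewrite expr2 ler_peMl// ltW.
split=> //; rewrite /sqn.
apply: (le_trans (@le_Rintegral _ _ _ mu _ _ (fun=> c) mOm _ _ fc)).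
- exact: L2_sqr.
- exact: intb_cst.
- have E : fine (mu Om) = 2 * L by rewrite (mu_Omega L_gt0).
  by rewrite Rintegral_cst// [fine _]E mulrC.
Qed.

(** Cauchy-Schwarz on [Omega] between [g] and the indicator of []-oo, x]], whose squared norm is at
    most the length [2 L]. *)
Lemma primitive_sq_le g x : L2 Om g -> (forall x, ~ Om x -> g x = 0) ->
  primitive g x ^+ 2 <= 2 * L * sqn Om g.
Proof.
move=> gL g0.
pose i : RM -> R := \1_(`]-oo, x]%classic : set RM).
have mi : measurable_fun Om i by apply: measurable_indic; exact: measurable_itv.
have [iL iq] : L2 Om i /\ sqn Om i <= 2 * L * 1.
  apply: sqn_le_cst => // y _; rewrite /i indicE.
  by case: (_ \in _); rewrite ?expr1n ?expr0n.
have -> : primitive g x = \int[mu]_(y in Om) (i y * g y).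
  rewrite /primitive Rintegral_mkcond [RHS]Rintegral_mkcond; apply: eq_Rintegral => y _.
  rewrite !patchE /i indicE; case: (y \in `]-oo, x]%classic) => /=.
    case: ifPn => [_|]; first by rewrite mul1r.
    by move=> /negP yO; rewrite g0// => Oy; apply: yO; exact/mem_set.
  by case: ifP => _ //; rewrite mul0r.
apply: (le_trans (cauchy_schwarz mOm iL gL)).
by rewrite ler_wpM2r ?sqn_ge0// (le_trans iq)// mulr1.
Qed.

Lemma primitive_B g h x : intb setT g -> intb setT h ->
  primitive (fun y => g y - h y) x = primitive g x - primitive h x.
Proof.
by move=> gi hi; rewrite /primitive RintegralB//; [apply: intbS gi|apply: intbS hi].
Qed.

(** Test functions are the primitives of their derivatives. Along test functions that approximate
    [u], these primitives converge uniformly to [primitive (wd u)], and the functions themselves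
    converge to [u] in [L2]. So the two limits agree almost everywhere in [Omega], hence at every
    point of it by continuity; outside [Omega] all the test functions vanish. *)
Lemma H10_primitive u x : H10 Om u -> u x = primitive (wd u) x.
Proof.
move=> /(H10P L_gt0)[uH uA uc u0]; have [pL pW p0] := wderivP uH.
have pi := L2_supp_intb pL p0.
have uL : L2 Om u by case: uH.
have mP : measurable_fun Om (primitive (wd u)).
  by apply: measurable_cts; exact: primitive_continuous.
have key phi e : Cc1 Om phi -> sqn Om (fun x => wd u x - derive1 (phi : R -> R) x) < e ->
    forall y, (primitive (wd u) y - phi y) ^+ 2 <= 2 * L * e.
  move=> phiC He y; have [_ dpL] := Cc1_L2 L_gt0 phiC.
  have dp0 z : ~ Om z -> derive1 (phi : R -> R) z = 0.
    by move=> /(Cc1_out L_gt0 phiC)[].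
  have [c [d [cd dphi cdphi phi0]]] := Cc1_support L_gt0 phiC.
  rewrite -{1}(primitive_C1 y cd dphi cdphi phi0) -primitive_B//; last first.
    exact: L2_supp_intb.
  apply: le_trans (primitive_sq_le _ _ _) _.
  - by apply: L2B.
  - by move=> z nz; rewrite p0// dp0// subr0.
  - by apply: ler_wpM2l; [have := L_gt0; lra|exact: ltW].
have eps0 (z c : R) : 0 <= z -> (forall e, 0 < e -> z <= c * e) -> z = 0.
  move=> z0 H; apply/eqP; rewrite eq_le z0 andbT; apply/ler_addgt0Pl => e e0.
  rewrite addr0; have [c0|c0] := leP c 0.
    by apply: le_trans (H 1 ltr01) _; rewrite mulr1 (le_trans c0)// ltW.
  by apply: le_trans (H (e / c) (divr_gt0 e0 c0)) _; rewrite mulrC divfK// gt_eqF.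
have [Ox|nOx] := pselect (Om x); last first.
  apply/eqP; rewrite u0// eq_sym -sqrf_eq0; apply/eqP.
  apply: (eps0 _ (2 * L)); first exact: sqr_ge0.
  move=> e e0; have [phi phiC [_ He]] := uA e e0.
  have := key phi e phiC He x; have [-> _] := Cc1_out L_gt0 phiC nOx.
  by rewrite subr0.
apply/eqP; rewrite -subr_eq0; apply/eqP.
apply: (@ae_cts_eq0 R L (fun x => u x - primitive (wd u) x)) => //.
  by move=> y; apply: cvgB; [exact: uc|exact: primitive_continuous].
have PL : L2 Om (primitive (wd u)).
  apply: (@L2_bounded _ _ _ (\int[mu]_t `|wd u t|)) => // y _.
  exact: primitive_bounded.
have bL : L2 Om (fun y => u y - primitive (wd u) y) by exact: L2B.
have S0 : sqn Om (fun y => u y - primitive (wd u) y) = 0.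
  (* From [(x - y)^2 <= 2 x^2 + 2 y^2]: the first term is below [2 e], and the second integrates the
     uniform bound [2 L e] over a length [2 L]. *)
  apply: (eps0 _ (2 + 2 * (2 * L * (2 * L)))); first exact: sqn_ge0.
  move=> e e0; have [phi phiC [H1e H2e]] := uA e e0.
  have [phL _] := Cc1_L2 L_gt0 phiC.
  have upL : L2 Om (fun y => u y - phi y) by exact: L2B.
  have pPL : L2 Om (fun y => primitive (wd u) y - phi y) by exact: L2B.
  have [_ S2] := sqn_le_cst (L2_meas mOm pPL) (fun y _ => key phi e phiC H2e y).
  have := sqnB_le mOm upL pPL.
  rewrite (_ : (fun y => u y - phi y - _) = (fun y => u y - primitive (wd u) y)); last first.
    by apply/funext => y; ring.
  by move=> /le_trans; apply; move: S2 H1e; lra.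
have := Rint_eq0_ae mOm (L2_sqr mOm bL) (fun y _ => sqr_ge0 _) S0.
by apply: ae_imply => y + Oy => /(_ Oy)/eqP; rewrite sqrf_eq0 => /eqP.
Qed.

Lemma H10_H1 u : H10 Om u -> H1 Om u. Proof. by case. Qed.

Lemma H10_sup u x : H10 Om u -> u x ^+ 2 <= 2 * L * sqn Om (wd u).
Proof.
move=> uH; rewrite (H10_primitive _ uH); have [pL _ p0] := wderivP (H10_H1 uH).
exact: primitive_sq_le.
Qed.

Lemma derive1_lin phi psi s t x : derivable (phi : R -> R) x 1 ->
  derivable (psi : R -> R) x 1 ->
  is_derive x 1 (fun x => s * phi x + t * psi x : R)
    (s * derive1 (phi : R -> R) x + t * derive1 (psi : R -> R) x).
Proof.
move=> dp dq.
have Hp : is_derive x 1 (phi : R -> R) (derive1 (phi : R -> R) x).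
  by apply: DeriveDef; [exact: dp|rewrite derive1E].
have Hq : is_derive x 1 (psi : R -> R) (derive1 (psi : R -> R) x).
  by apply: DeriveDef; [exact: dq|rewrite derive1E].
exact: (is_deriveD (is_deriveZ s Hp) (is_deriveZ t Hq)).
Qed.

Lemma Cc1_lin phi psi s t : Cc1 Om phi -> Cc1 Om psi ->
  Cc1 Om (fun x => s * phi x + t * psi x) /\
  derive1 (fun x => s * phi x + t * psi x : R) =
    (fun x => s * derive1 (phi : R -> R) x + t * derive1 (psi : R -> R) x).
Proof.
move=> [dp cp [K cK [KD K0]]] [dq cq [K' cK' [KD' K0']]].
have dE : derive1 (fun x => s * phi x + t * psi x : R) =
    (fun x => s * derive1 (phi : R -> R) x + t * derive1 (psi : R -> R) x).
  apply/funext => x; rewrite derive1E.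
  have H := derive1_lin s t (dp x) (dq x); exact: derive_val.
refine (conj _ dE); split.
- by move=> x; have [] := derive1_lin s t (dp x) (dq x).
- rewrite dE => x; apply: cvgD; (apply: cvgM; first exact: cvg_cst).
    exact: cp.
  exact: cq.
- exists (K `|` K'); first exact: compactU.
  split; first by move=> x [/KD|/KD'].
  by move=> x /not_orP[/K0 -> /K0' ->]; rewrite !mulr0 addr0.
Qed.

Lemma H10_lin u v s t : H10 Om u -> H10 Om v -> H10 Om (fun x => s * u x + t * v x).
Proof.
move=> /(H10P L_gt0)[uH uA uc u0] /(H10P L_gt0)[vH vA vc v0].
have [upL _ _] := wderivP uH; have [vpL _ _] := wderivP vH.
have lH := H1_lin L_gt0 s t uH vH; have [wL _ _] := wderivP lH.
have uL : L2 Om u by case: uH.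
have vL : L2 Om v by case: vH.
have lin f1 f2 : L2 Om f1 -> L2 Om f2 -> sqn Om (fun x => s * f1 x + t * f2 x) <=
    2 * s ^+ 2 * sqn Om f1 + 2 * t ^+ 2 * sqn Om f2.
  move=> f1L f2L; have := sqnD_le mOm (L2Z s mOm f1L) (L2Z t mOm f2L).
  by rewrite !sqnZ// !mulrA.
apply/(H10P L_gt0); split; first exact: lH.
- move=> e e0; pose c := 2 * s ^+ 2 + 2 * t ^+ 2 + 1.
  have s2 := sqr_ge0 s; have t2 := sqr_ge0 t.
  have c0 : 0 < c by rewrite /c; lra.
  pose d := e / c; have ec : 0 < d by exact: divr_gt0.
  have [phi phiC [A1 A2]] := uA _ ec; have [psi psiC [B1 B2]] := vA _ ec.
  have [phL dphL] := Cc1_L2 L_gt0 phiC; have [psL dpsL] := Cc1_L2 L_gt0 psiC.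
  have [lC lE] := Cc1_lin s t phiC psiC; have [_ dlL] := Cc1_L2 L_gt0 lC.
  exists (fun x => s * phi x + t * psi x); first exact: lC.
  have cc : e = c * d by rewrite mulrC divfK// gt_eqF.
  have bnd a b : a < d -> b < d -> 2 * s ^+ 2 * a + 2 * t ^+ 2 * b < e.
    by move=> ha hb; rewrite [ltRHS]cc; exact: weighted_lt.
  split.
  + rewrite (_ : (fun x => _ - _) = (fun x => s * (u x - phi x) + t * (v x - psi x))).
      apply: le_lt_trans (lin _ _ _ _) _; [exact: L2B|exact: L2B|exact: bnd].
    by apply/funext => x; ring.
  + have -> : sqn Om (fun x => wd (fun x => s * u x + t * v x) x -
        derive1 (fun x => s * phi x + t * psi x : R) x) =
      sqn Om (fun x => s * (wd u x - derive1 (phi : R -> R) x) +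
                       t * (wd v x - derive1 (psi : R -> R) x)).
      apply: sqn_ae => //.
      * by apply: L2_meas => //; apply: L2B.
      * by apply: L2_meas => //; apply: L2D => //; apply: L2Z => //; apply: L2B.
      * apply: ae_imply (wd_lin L_gt0 s t uH vH) => x + Ox => ->//.
        by rewrite lE; ring.
    by apply: le_lt_trans (lin _ _ _ _) _; [exact: L2B|exact: L2B|exact: bnd].
- by move=> x; apply: cvgD; (apply: cvgM; first exact: cvg_cst); [exact: uc|exact: vc].
- by move=> x nx; rewrite u0// v0// !mulr0 addr0.
Qed.

Lemma H10_B u v : H10 Om u -> H10 Om v -> H10 Om (u \- v).
Proof.
move=> uH vH; have := H10_lin 1 (-1) uH vH.
by congr (H10 Om _); apply/funext => x /=; ring.
Qed.

Lemma Cc1_H10 phi : Cc1 Om phi -> H10 Om phi.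
Proof.
move=> phiC; have pH := Cc1_H1 L_gt0 phiC; have [pL dpL] := Cc1_L2 L_gt0 phiC.
have [wL _ _] := wderivP pH.
apply/(H10P L_gt0); split; first exact: pH.
- move=> e e0; exists phi; [exact: phiC|split].
    rewrite (_ : (fun x => _ - _) = (fun x => 0)).
      by rewrite sqn0.
    by apply/funext => x; rewrite subrr.
  rewrite (_ : sqn _ _ = sqn Om (fun=> 0)).
    by rewrite sqn0.
  apply: sqn_ae => //; first by apply: L2_meas => //; exact: L2B.
  by apply: ae_imply (wd_Cc1 L_gt0 phiC) => x + Ox => ->//; rewrite subrr.
- by have [dp _ _] := phiC; exact: derivable_cts dp.
- by move=> x /(Cc1_out L_gt0 phiC)[].
Qed.

Lemma H10_0 : H10 Om (fun=> 0).
Proof.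
have [psi psiC _] : exists2 psi : RM -> R, Cc1 `]-L, L[%classic psi & \int[mu]_x psi x != 0.
  by apply: exists_unit_test; have := L_gt0; lra.
have := H10_lin 0 0 (Cc1_H10 psiC) (Cc1_H10 psiC).
by congr (H10 Om _); apply/funext => x; ring.
Qed.

(** The limit is defined as the primitive of the [L2] limit [g] of the derivatives, hence is
    continuous. Since each [u_ n] is the primitive of its derivative, convergence is uniform, which
    gives the value 0 outside [Omega]; integration by parts makes [g] the weak derivative. Test
    functions close to a late [u_ N] are close to the limit. *)
Lemma H10_complete (u_ : nat -> RM -> R) : (forall n, H10 Om (u_ n)) ->
  (forall e : R, 0 < e -> exists N, forall m n, (N <= m)%N -> (N <= n)%N ->
     sqn Om (fun x => wd (u_ m) x - wd (u_ n) x) <= e) ->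
  exists2 u, H10 Om u & forall e : R, 0 < e -> exists N, forall n, (N <= n)%N ->
     sqn Om (fun x => wd (u_ n) x - wd u x) <= e.
Proof.
move=> uH uC; have pP n := wderivP (H10_H1 (uH n)).
have pL n : L2 Om (wd (u_ n)) by have [] := pP n.
have p0 n x : ~ Om x -> wd (u_ n) x = 0 by have [_ _] := pP n; apply.
have [g0 g0L g0C] := @L2_complete R Om (fun n => wd (u_ n)) mOm fOm pL uC.
pose g : RM -> R := g0 \_ Om.
have gE x : Om x -> g0 x = g x by move=> Ox; rewrite /g patchE mem_set.
have mg : measurable_fun Om g.
  by apply/(measurable_restrict _ mOm mOm); rewrite setIid; exact: L2_meas mOm g0L.
have gL : L2 Om g by apply: L2_ae g0L => //; apply: aeW => x; exact: gE.
have gz x : ~ Om x -> g x = 0 by move=> nx; rewrite /g patchE memNset.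
have gi := L2_supp_intb gL gz.
have gC (e : R) : 0 < e -> exists N, forall n, (N <= n)%N ->
    sqn Om (fun x => wd (u_ n) x - g x) <= e.
  move=> e0; have [N HN] := g0C e e0; exists N => n /HN.
  by congr (_ <= _); apply: eq_Rintegral => x /set_mem Ox; rewrite gE.
pose u := primitive g.
have uc : continuous (u : R -> R) by exact: primitive_continuous.
have udist n x : (u_ n x - u x) ^+ 2 <= 2 * L * sqn Om (fun x => wd (u_ n) x - g x).
  rewrite (H10_primitive _ (uH n)) /u -primitive_B;
    [|exact: (L2_supp_intb (pL n) (p0 n))|exact: gi].
  apply: primitive_sq_le; first exact: L2B.
  by move=> y ny; rewrite gz// p0// subr0.
have u0 x : ~ Om x -> u x = 0.
  move=> nx; apply/eqP; rewrite -sqrf_eq0 eq_le sqr_ge0 andbT.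
  apply/ler_addgt0Pl => e e0; rewrite addr0.
  have L2p : 0 < 2 * L by have := L_gt0; lra.
  have [N HN] := gC (e / (2 * L)) (divr_gt0 e0 L2p).
  have un0 : u_ N x = 0 by have [_ _ _] := uH N; apply.
  have := udist N x; rewrite un0 sub0r sqrrN => /le_trans; apply.
  by rewrite mulrC -ler_pdivlMr// HN.
have mu_ : measurable_fun Om u by exact: measurable_cts.
have uL : L2 Om u.
  apply: (@L2_bounded _ _ _ (\int[mu]_t `|g t|)) => // y _; exact: primitive_bounded.
have uW : weak_derivative Om u g.
  apply/weak_derivP => // phi phiC; have [c [d [cd dphi cdphi phi0]]] := Cc1_support L_gt0 phiC.
  rewrite (@RintM_supp _ _ phi); last by move=> x /(Cc1_out L_gt0 phiC)[].
  rewrite (@RintM_supp _ _ (derive1 (phi : R -> R))); last by move=> x /(Cc1_out L_gt0 phiC)[].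
  exact: (primitive_by_parts cd).
have uH1 : H1 Om u by split; [exact: uL|exists g; [exact: gL|exact: uW]].
have wE := wd_ae L_gt0 uH1 gL uW; have [wL _ _] := wderivP uH1.
have wC n : sqn Om (fun x => wd (u_ n) x - wd u x) = sqn Om (fun x => wd (u_ n) x - g x).
  apply: sqn_ae => //; try (by apply: L2_meas => //; exact: L2B).
  by apply: ae_imply wE => x + Ox => ->.
exists u; last first.
  by move=> e e0; have [N HN] := gC e e0; exists N => n /HN; rewrite wC.
apply/(H10P L_gt0); split; [exact: uH1|move=> e e0|exact: uc|exact: u0].
(* Small enough for both estimates below: [2 d + 2 (2 L)^2 d] for the functions and [4 d] for the
   derivatives. *)
pose d := e / (8 * (1 + 2 * L * (2 * L))).
have LL : 0 < 2 * L * (2 * L) by have := L_gt0; nra.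
have d0 : 0 < d by apply: divr_gt0 => //; lra.
have de : e = 8 * (1 + 2 * L * (2 * L)) * d.
  by rewrite /d mulrC divfK// gt_eqF//; lra.
have [N HN] := gC d d0; have uN := HN N (leqnn N).
have /(H10P L_gt0)[uNH uNA _ _] := uH N; have [phi phiC [A1 A2]] := uNA d d0.
have [phL dpL] := Cc1_L2 L_gt0 phiC; have uNL : L2 Om (u_ N) by case: uNH.
exists phi; [exact: phiC|split].
- have bL : L2 Om (fun x => u_ N x - u x) by exact: L2B.
  have bL' : L2 Om (fun x => u_ N x - phi x) by exact: L2B.
  have udist' x : Om x -> (u_ N x - u x) ^+ 2 <= 2 * L * d.
    move=> _; apply: le_trans (udist N x) _; rewrite ler_wpM2l//.
    by have := L_gt0; lra.
  have [_ S1] := sqn_le_cst (L2_meas mOm bL) udist'.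
  have := sqnB_le mOm bL' bL.
  rewrite (_ : (fun x => u_ N x - phi x - _) = (fun y => u y - phi y)); last first.
    by apply/funext => y; ring.
  move=> /le_lt_trans; apply; rewrite de.
  by have := mulr_gt0 LL d0; move: S1 A1; lra.
- have bL : L2 Om (fun x => wd (u_ N) x - wd u x) by exact: L2B.
  have bL' : L2 Om (fun x => wd (u_ N) x - derive1 (phi : R -> R) x) by exact: L2B.
  have := sqnB_le mOm bL' bL.
  rewrite (_ : (fun x => wd (u_ N) x - _ - _) =
      (fun y => wd u y - derive1 (phi : R -> R) y)); last first.
    by apply/funext => y; ring.
  move=> /le_lt_trans; apply; rewrite de wC.
  by have := mulr_gt0 LL d0; move: uN A2; lra.
Qed.

End SobolevComplete.

(** * The functional *)

Section IntegralLemmas.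
Context {R : realType}.
Notation mu := (@lebesgue_measure R).
Notation RM := (measurableTypeR R).
Notation intb D f := (mu.-integrable D (EFin \o f)).
Implicit Types (f g h b : RM -> R) (D : set RM).

(* The integral of the negative part of [b - g] may be infinite. *)
Lemma integral_sub_nonneg D b g : measurable D -> intb D b ->
  (forall x, D x -> 0 <= b x) -> measurable_fun D g -> (forall x, D x -> 0 <= g x) ->
  (\int[mu]_(x in D) (b x - g x)%:E =
   (\int[mu]_(x in D) b x)%R%:E - \int[mu]_(x in D) (g x)%:E)%E.
Proof.
move=> mD bi b0 mg g0; have mb := intb_meas bi.
pose fp : RM -> R := fun x => Num.max (b x - g x) 0.
pose fn : RM -> R := fun x => Num.max (- (b x - g x)) 0.
have mfp : measurable_fun D fp by apply: measurable_maxr => //; exact: measurable_funB.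
have mfn : measurable_fun D fn.
  by apply: measurable_maxr => //; apply: measurableT_comp => //; exact: measurable_funB.
have fp0 x : 0 <= fp x by rewrite le_max lexx orbT.
have fn0 x : 0 <= fn x by rewrite le_max lexx orbT.
have fpi : intb D fp.
  apply: (@intb_le _ _ _ b) => // x Dx; rewrite ger0_norm// ge_max b0// andbT.
  by rewrite gerBl g0.
have E1 : (\int[mu]_(x in D) (b x - g x)%:E =
   (\int[mu]_(x in D) fp x)%R%:E - \int[mu]_(x in D) (fn x)%:E)%E.
  rewrite integralE -(EFin_Rint mD fpi); congr (_ - _)%E; apply: eq_integral => x _.
    by rewrite funeposE /fp EFin_max.
  by rewrite funenegE /fn EFin_max EFinN.
(* The identity [fn + b = g + fp] involves only nonnegative functions, so it integrates even when
   [fn] and [g] have infinite integrals. *)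
have E2 : (\int[mu]_(x in D) (fn x)%:E + (\int[mu]_(x in D) b x)%R%:E =
   (\int[mu]_(x in D) (g x)%:E) + (\int[mu]_(x in D) fp x)%R%:E)%E.
  rewrite -(EFin_Rint mD fpi) -(EFin_Rint mD bi) -!ge0_integralD//=;
    try (by move=> x Dx; rewrite lee_fin ?b0 ?g0 ?fp0 ?fn0);
    try (by apply/measurable_EFinP).
  apply: eq_integral => x _; rewrite -!EFinD; congr EFin; rewrite /fn /fp.
  by case: (leP (- (b x - g x)) 0) => ?; case: (leP (b x - g x) 0) => ?; lra.
rewrite E1; move: E2.
have := integral_ge0 mu (f := fun x => (fn x)%:E) (D := D) (fun x _ => fn0 x).
have := @integral_ge0 _ _ _ mu D (fun x => (g x)%:E) g0.
case: (\int[mu]_(x in D) (fn x)%:E)%E => [u| |]//;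
  case: (\int[mu]_(x in D) (g x)%:E)%E => [v| |]// _ _.
by rewrite -!EFinD => -[H]; congr EFin; lra.
Qed.

(* [x^-1] is the pointwise limit of [x / (x ^ 2 + 1 / n)], also at [x = 0]. *)
Lemma measurable_invr : measurable_fun setT (fun x : R => x^-1).
Proof.
apply: (@measurable_fun_cvg _ R R setT (fun (n : nat) (x : R) => x / (x ^+ 2 + n.+1%:R^-1))).
  move=> n; apply: continuous_measurable_fun => x.
  apply: cvgM; first exact: cvg_id.
  apply: cvgV; first by rewrite gt_eqF// ltr_wpDl ?sqr_ge0// invr_gt0.
  apply: cvgD; last exact: cvg_cst.
  have Hs : (fun y : R => y * y) y @[y --> x] --> x * x by apply: cvgM; exact: cvg_id.
  exact: Hs.
move=> x _; have [->|x0] := eqVneq x 0.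
  rewrite invr0 (_ : (fun n : nat => _) = (fun=> 0 : R)); first exact: cvg_cst.
  by apply/funext => n; rewrite mul0r.
have -> : x^-1 = x / (x ^+ 2 + 0) by rewrite addr0; field.
apply: cvgM; first exact: cvg_cst.
apply: cvgV; first by rewrite addr0 sqrf_eq0.
by apply: cvgD; [exact: cvg_cst|exact: cvg_harmonic].
Qed.

(** Extracts pointwise information from lines of competitors, on which the functional is such a
    polynomial. *)
Lemma quadratic_bounded_below (al be ga m : R) :
  (forall t, m <= al * t ^+ 2 - be * t + ga) -> 0 <= al /\ (al = 0 -> be = 0).
Proof.
move=> H; have H0 := H 0.
have E : al = 0 -> be = 0.
  move=> a0; apply/eqP/negPn/negP => b0.
  (* Here the affine function takes the value [m - 1]. *)
  have := H ((ga - m + 1) / be); rewrite a0 mul0r add0r mulrC divfK//; lra.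
split=> //; rewrite leNgt; apply/negP => al0.
have [b0|b0] := eqVneq be 0.
  have := H (1 + (ga - m) / (- al)); rewrite b0.
  have gm : 0 <= ga - m by move: H0; rewrite expr0n/=; lra.
  have t0 : 0 <= (ga - m) / (- al) by rewrite divr_ge0// oppr_ge0 ltW.
  have -> : al * (1 + (ga - m) / - al) ^+ 2 - 0 * (1 + (ga - m) / - al) + ga =
    al * (1 + (ga - m) / - al) + (al * (1 + (ga - m) / - al)) * ((ga - m) / - al) + ga by ring.
  have -> : al * (1 + (ga - m) / - al) = al - (ga - m) by field; rewrite lt_eqF.
  have : (al - (ga - m)) * ((ga - m) / - al) <= 0 by rewrite mulr_le0_ge0//; lra.
  lra.
(* Large enough for [al T^2 < m - ga]; adding the inequalities at [T] and [-T] cancels the linear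
   term. *)
pose T := (`|be| + 1 + `|ga - m|) / (- al) + 1.
have T1 : 1 <= T by rewrite /T lerDr divr_ge0 ?oppr_ge0 ?ltW// !addr_ge0.
have := H T; have := H (- T).
have e1 : al * T <= - (`|be| + 1 + `|ga - m|).
  rewrite /T mulrDr mulr1.
  have -> : al * ((`|be| + 1 + `|ga - m|) / - al) = - (`|be| + 1 + `|ga - m|).
    by field; rewrite lt_eqF.
  lra.
clearbody T.
have g1 : ga - m <= `|ga - m| by exact: ler_norm.
have g2 : 0 <= `|ga - m| by exact: normr_ge0.
have b1 : 0 <= `|be| by exact: normr_ge0.
have : al * T ^+ 2 <= - (`|be| + 1 + `|ga - m|).
  rewrite expr2 mulrA; apply: (le_trans _ e1).
  have n0 : al * T <= 0 by apply: (le_trans e1); rewrite oppr_le0 !addr_ge0.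
  have T0 : 0 <= T - 1 by lra.
  by have := mulr_le0_ge0 n0 T0; lra.
rewrite sqrrN; lra.
Qed.

End IntegralLemmas.

(** * The pointwise quadratic problem and the formula for [Stilde] *)

Section Functional.
Context {R : realType} (L a : R) (fbar : R -> R).
Context (L_gt0 : 0 < L) (a_gt0 : 0 < a).
Notation mu := (@lebesgue_measure R).
Notation RM := (measurableTypeR R).
Notation intb D f := (mu.-integrable D (EFin \o f)).
Notation Om := (Omega L : set RM).
Notation Om1 := (Omega1 L : set RM).
Notation wd := (wderiv (Omega L)).
Notation S := (Stilde L a fbar).
Notation J u f := (\int[mu]_(x in Om1) integrand L a fbar u f x).
Context (fbar_L2 : L2 Om1 fbar).
Implicit Types (f g h u v : RM -> R) (x y e s t : R).

Let mOm : measurable Om := measurable_Omega L.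
Let fOm : (mu Om < +oo)%E := fin_Omega L_gt0.

Lemma measurable_Omega1 : measurable Om1. Proof. exact: measurable_itv. Qed.
Let mO1 : measurable Om1 := measurable_Omega1.

Lemma fin_Omega1 : (mu Om1 < +oo)%E.
Proof. by rewrite /Omega1 lebesgue_measure_itv/=; case: ifP => _; rewrite ?ltry. Qed.
Let fO1 : (mu Om1 < +oo)%E := fin_Omega1.

Lemma sub_Omega : Om `<=` Om1.
Proof. by move=> x; rewrite /Omega /Omega1 /= !in_itv/= => /andP[? ?]; apply/andP; split; lra. Qed.

Lemma Omega_shift x : Om x -> Om1 (x - 1) /\ Om1 (x + 1).
Proof. by rewrite /Omega /Omega1 /= !in_itv/= => /andP[? ?]; split; apply/andP; split; lra. Qed.

Lemma L2_Omega1 g : L2 Om g -> (forall x, ~ Om x -> g x = 0) -> L2 Om1 g.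
Proof.
move=> gL g0; rewrite /L2/= (_ : g \_ Om1 = g \_ Om)//.
apply/funext => x; rewrite !patchE; case: ifPn => [xO1|].
  case: ifPn => // /negP xO; rewrite g0// => Ox; apply: xO; exact/mem_set.
by move=> /negP xO1; rewrite memNset// => /sub_Omega O1x; apply: xO1; exact/mem_set.
Qed.

Lemma sqn_Omega1 g : (forall x, ~ Om x -> g x = 0) -> sqn Om1 g = sqn Om g.
Proof.
move=> g0; rewrite /sqn (@Rint_supp _ Om) => [|x nx]; last by rewrite g0// expr0n.
by apply: Rint_supp => x nx; rewrite g0 ?expr0n// => /sub_Omega.
Qed.

Lemma wd_L2 u : H10 Om u -> L2 Om (wd u).
Proof. by move=> /H10_H1/wderivP[]. Qed.

Lemma wd_out u x : H10 Om u -> ~ Om x -> wd u x = 0.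
Proof. by move=> /H10_H1/wderivP[_ _]; apply. Qed.

Lemma wd_L21 u : H10 Om u -> L2 Om1 (wd u).
Proof. by move=> uH; apply: L2_Omega1; [exact: wd_L2|move=> x; exact: wd_out]. Qed.

Lemma wd_ae1 (f g : RM -> R) : (forall x, ~ Om x -> f x = g x) ->
  {ae mu, forall x, Om x -> f x = g x} -> {ae mu, forall x, Om1 x -> f x = g x}.
Proof.
move=> fg; apply: ae_imply => x H _; have [/H//|nx] := pselect (Om x); exact: fg.
Qed.

Lemma H10_cts u : H10 Om u -> continuous (u : R -> R). Proof. by case. Qed.

Lemma Delta_cts u : H10 Om u -> continuous (Delta a u : R -> R).
Proof.
move=> uH x; have uc := H10_cts uH.
have sh c : (fun y : R => u (y + c)) y @[y --> x] --> u (x + c).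
  apply: (@cvg_comp _ _ _ (fun y : R => y + c) (u : R -> R) _ (nbhs (x + c))); last exact: uc.
  by apply: cvgD; [exact: cvg_id|exact: cvg_cst].
apply: cvgB; last exact: sh.
by apply: cvgD; [exact: cvg_cst|exact: sh].
Qed.

Definition sup_bound u : R := Num.sqrt (2 * L * sqn Om (wd u)).

Lemma H10_sup_bound u x : H10 Om u -> `|u x| <= sup_bound u.
Proof.
move=> uH; rewrite -sqrtr_sqr ler_sqrt ?H10_sup//.
by rewrite !mulr_ge0 ?sqn_ge0// ltW.
Qed.

Lemma Delta_bound u x : H10 Om u -> `|Delta a u x| <= a + 2 * sup_bound u.
Proof.
move=> uH; have := H10_sup_bound (x - 1) uH; have := H10_sup_bound (x + 1) uH.
rewrite /Delta !ler_norml => /andP[? ?] /andP[? ?]; apply/andP; split; have := a_gt0; lra.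
Qed.

Lemma Delta_meas u : H10 Om u -> measurable_fun Om1 (Delta a u).
Proof. by move=> uH; apply: measurable_cts; exact: Delta_cts. Qed.

Definition source u x : R := wd u x + a * fbar x.

Lemma source_L2 u : H10 Om u -> L2 Om1 (source u).
Proof. by move=> uH; apply: L2D => //; [exact: wd_L21|exact: L2Z]. Qed.

Lemma integrandE u f x : integrand L a fbar u f x =
  Delta a u x / 2 * f x ^+ 2 - source u x * f x + a / 2 * fbar x ^+ 2.
Proof. by rewrite /integrand /Delta /source; field. Qed.

Lemma Delta_sqr_int u f : H10 Om u -> L2 Om1 f ->
  intb Om1 (fun x => Delta a u x / 2 * f x ^+ 2).
Proof.
move=> uH fL; apply: (@intb_bndM _ _ _ _ ((a + 2 * sup_bound u) / 2)) => //.
- by apply: measurable_funM => //; exact: Delta_meas.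
- by move=> x _; rewrite normrM (ger0_norm (_ : 0 <= 2^-1))// ler_wpM2r// Delta_bound.
- exact: L2_sqr.
Qed.

Lemma integrand_int u f : H10 Om u -> L2 Om1 f -> intb Om1 (integrand L a fbar u f).
Proof.
move=> uH fL.
apply: (@intb_eq _ _ (fun x => Delta a u x / 2 * f x ^+ 2 - source u x * f x +
   a / 2 * fbar x ^+ 2)) => // [x _|]; first by rewrite integrandE.
apply: intbD => //; last by apply: intbZ => //; exact: L2_sqr.
by apply: intbB => //; [exact: Delta_sqr_int|apply: L2M => //; exact: source_L2].
Qed.

(** Serves three choices: [t = 0] for the upper bound, all [t] for the necessity of admissibility,
    and one well-chosen [t] for coercivity. *)
Lemma J_scale u k t : H10 Om u -> L2 Om1 k -> J u (fun x => t * k x) =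
  (\int[mu]_(x in Om1) (Delta a u x / 2 * k x ^+ 2)) * t ^+ 2 -
  (\int[mu]_(x in Om1) (source u x * k x)) * t + a / 2 * sqn Om1 fbar.
Proof.
move=> uH kL; have i1 := Delta_sqr_int uH kL.
have i2 := L2M mO1 (source_L2 uH) kL; have i3 := L2_sqr mO1 fbar_L2.
rewrite mulrC [X in _ - X + _]mulrC /sqn -!RintegralZl// -RintegralB//; try exact: intbZ.
rewrite -RintegralD//; [|by apply: intbB => //; exact: intbZ|exact: intbZ].
by apply: eq_Rintegral => x _; rewrite integrandE; ring.
Qed.

Lemma Stilde_le u f : H10 Om u -> L2 Om1 f -> (S u <= (J u f)%:E)%E.
Proof.
move=> uH fL; rewrite -(EFin_Rint mO1 (integrand_int uH fL)).
by apply: ereal_inf_lbound; exists f.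
Qed.

Lemma Stilde_ge u (c : \bar R) : H10 Om u ->
  (forall f, L2 Om1 f -> (c <= (J u f)%:E)%E) -> (c <= S u)%E.
Proof.
move=> uH H; apply: le_ereal_inf_tmp => _ [f fL <-].
by rewrite (EFin_Rint mO1 (integrand_int uH fL)) H.
Qed.

Lemma Stilde_lt u (c : \bar R) : H10 Om u -> (S u < c)%E ->
  exists2 f, L2 Om1 f & ((J u f)%:E < c)%E.
Proof.
move=> uH Sc; apply: contrapT => H; move: Sc; rewrite ltNge => /negP; apply.
apply: Stilde_ge => // f fL; rewrite leNgt; apply/negP => Jc.
by apply: H; exists f.
Qed.

Lemma L2_0 : L2 Om1 (fun=> 0).
Proof. by apply: (@L2_bounded _ _ _ 0) => // x _; rewrite normr0. Qed.

Lemma Stilde_upper u : H10 Om u -> (S u <= (a / 2 * sqn Om1 fbar)%:E)%E.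
Proof.
move=> uH; have := Stilde_le uH L2_0.
have <- : (fun x : RM => 0 * 0) = (fun=> 0 : R) by apply/funext => x; rewrite mul0r.
by rewrite (J_scale 0 uH L2_0) expr0n/= !mulr0 subrr add0r.
Qed.

Lemma Stilde_ltNy u : H10 Om u -> (-oo < S u)%E ->
  exists m, forall f, L2 Om1 f -> m <= J u f.
Proof.
move=> uH; have Sle f (fL : L2 Om1 f) := Stilde_le uH fL.
case E : (S u) => [s| |]// _.
  by exists s => f fL; rewrite -lee_fin -E Sle.
by have := Sle _ L2_0; rewrite E leye_eq.
Qed.

(** The functional is bounded below on each line [t k]. With [k] the indicator of [Delta < 0], the
    quadratic coefficient integrates a nonpositive function, so it must vanish and that set is null.
    With [k] equal to [source u] on [Delta = 0] and 0 elsewhere, the quadratic coefficient is 0, so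
    the linear one, the integral of [source u ^ 2] over that set, is 0 too. *)
Lemma Stilde_admissible u : H10 Om u -> (-oo < S u)%E -> admissible L a fbar u.
Proof.
move=> uH /(Stilde_ltNy uH)[m Hm].
have mD := Delta_meas uH; have sL := source_L2 uH; have ms := L2_meas mO1 sL.
pose i (P : RM -> bool) : RM -> R := fun x => (P x)%:R.
have mi P : measurable_fun Om1 P -> measurable_fun Om1 (i P).
  move=> mP; rewrite (_ : i P = (fun x => if P x then 1 else 0)).
    by apply: measurable_fun_if.
  by apply/funext => x; rewrite /i; case: (P x).
have i1 P x : `|i P x| <= 1 by rewrite /i; case: (P x); rewrite ?normr1 ?normr0.
have m1 : measurable_fun Om1 (fun x => Delta a u x < 0) by apply: measurable_fun_ltr.
have m2 : measurable_fun Om1 (fun x => Delta a u x == 0) by apply: measurable_fun_eqr.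
have k1L : L2 Om1 (i (fun x => Delta a u x < 0)).
  by apply: (@L2_bounded _ _ _ 1) => //; exact: mi.
have k2L : L2 Om1 (fun x => i (fun x => Delta a u x == 0) x * source u x).
  by apply: (@L2_bndM _ _ _ _ 1) => //; exact: mi.
have Q k : L2 Om1 k -> 0 <= \int[mu]_(x in Om1) (Delta a u x / 2 * k x ^+ 2) /\
   (\int[mu]_(x in Om1) (Delta a u x / 2 * k x ^+ 2) = 0 ->
    \int[mu]_(x in Om1) (source u x * k x) = 0).
  move=> kL; apply: (@quadratic_bounded_below _ _ _ (a / 2 * sqn Om1 fbar) m) => t.
  by rewrite -J_scale//; apply: Hm; exact: L2Z.
have [] := Q _ k1L; set F1 := (F in \int[mu]_(x in Om1) F x) => F1ge _.
have F1le x : F1 x <= 0.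
  rewrite /F1 /i; case: (ltP (Delta a u x) 0) => D0; rewrite ?expr1n ?expr0n/= ?mulr0//.
  by rewrite mulr1 pmulr_lle0// ltW.
have F1i : intb Om1 F1 by exact: Delta_sqr_int.
have F1z : \int[mu]_(x in Om1) (- F1 x) = 0.
  have E : \int[mu]_(x in Om1) (- F1 x) = - \int[mu]_(x in Om1) F1 x.
    by rewrite -mulN1r -RintegralZl//; apply: eq_Rintegral => x _; rewrite mulN1r.
  apply/eqP; rewrite eq_le; apply/andP; split; first by rewrite E oppr_le0.
  by apply: Rintegral_ge0 => x _; rewrite oppr_ge0.
have F1N x : Om1 x -> 0 <= - F1 x by rewrite oppr_ge0 F1le.
have ae1 := Rint_eq0_ae mO1 (intbN mO1 F1i) F1N F1z.
have [_] := Q _ k2L; set F2 := (F in \int[mu]_(x in Om1) F x = 0 -> _).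
have F2E x : F2 x = 0.
  rewrite /F2 /i; case: (eqVneq (Delta a u x) 0) => [->|_]; first by rewrite !mul0r.
  by rewrite mul0r expr0n mulr0.
have -> : \int[mu]_(x in Om1) F2 x = 0.
  by rewrite (_ : F2 = fun=> 0); [rewrite Rintegral_cst// mul0r|apply/funext].
move=> /(_ erefl) F3z.
have F3i := L2M mO1 sL k2L.
have F3ge x : Om1 x -> 0 <= source u x * (i (fun x => Delta a u x == 0) x * source u x).
  by move=> _; rewrite mulrCA -expr2 mulr_ge0 ?sqr_ge0.
have ae3 := Rint_eq0_ae mO1 F3i F3ge F3z.
apply: ae_imply (ae_and ae1 ae3) => x [H1 H3] Ox; split.
  rewrite leNgt; apply/negP => D0; have := H1 Ox; rewrite /F1 /i D0 expr1n mulr1; lra.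
move=> D0; have := H3 Ox; rewrite /i D0 eqxx mul1r -expr2 => /eqP.
by rewrite sqrf_eq0 => /eqP.
Qed.

(** Where [Delta > 0], the drop from the value of the integrand at [f = 0] to its minimum over [f].
    Where [Delta = 0], division by zero makes it 0, in agreement with [fhat = 0] there. *)
Definition gain u x : R := source u x ^+ 2 / (2 * Delta a u x).

Lemma integrand_fhat u x : integrand L a fbar u (fhat L a fbar u) x =
  a / 2 * fbar x ^+ 2 - gain u x.
Proof.
rewrite integrandE /gain /fhat -/(source u x) [a * fbar x + _]addrC -/(source u x).
have [->|D0] := eqVneq (Delta a u x) 0; first by rewrite !mulr0 invr0; ring.
by field.
Qed.

Lemma gain_meas u : H10 Om u -> measurable_fun Om1 (gain u).
Proof.
move=> uH; apply: measurable_funM.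
  by apply: measurable_funX; apply: L2_meas => //; exact: source_L2.
apply: (measurableT_comp measurable_invr).
by apply: measurable_funM => //; exact: Delta_meas.
Qed.

(** Admissibility makes [gain] nonnegative only almost everywhere; taking its positive part gives a
    function to which [integral_sub_nonneg] applies, even if its integral is infinite. *)
Lemma SL_E u : H10 Om u -> admissible L a fbar u ->
  (SL L a fbar u = (a / 2 * sqn Om1 fbar)%:E -
    \int[mu]_(x in Om1) (Num.max 0 (gain u x))%:E)%E.
Proof.
move=> uH adm; rewrite /SL.
have i3 := intbZ (a / 2) mO1 (L2_sqr mO1 fbar_L2).
have mg := gain_meas uH.
have mg0 : measurable_fun Om1 (fun x => Num.max 0 (gain u x)) by apply: measurable_maxr.
have a2 : 0 <= a / 2 by rewrite divr_ge0// ltW.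
have := @integral_sub_nonneg R Om1 _ _ mO1 i3 _ mg0 _.
rewrite /sqn -RintegralZl//; last exact: L2_sqr.
move=> <-//; last first.
- by move=> x _; rewrite le_max lexx.
- by move=> x _; rewrite mulr_ge0// sqr_ge0.
apply: ae_eq_integral => //.
- apply/measurable_EFinP; apply: (eq_measurable_fun (fun x => a / 2 * fbar x ^+ 2 - gain u x)).
    by move=> x _; rewrite integrand_fhat.
  by apply: measurable_funB => //; exact: intb_meas i3.
- by apply/measurable_EFinP; apply: measurable_funB => //; exact: intb_meas i3.
- apply: ae_imply adm => x H Ox; have [D0 Dz] := H Ox; rewrite integrand_fhat max_r//.
  by rewrite /gain divr_ge0 ?sqr_ge0// mulr_ge0.
Qed.

(** If the gain is not integrable, the left side is [-oo]. Otherwise compare pointwise: complete the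
    square where [Delta > 0]; where [Delta = 0], admissibility cancels the linear term and the
    integrand does not depend on [f]. *)
Lemma SL_le_J u f : H10 Om u -> admissible L a fbar u -> L2 Om1 f ->
  (SL L a fbar u <= (J u f)%:E)%E.
Proof.
move=> uH adm fL; rewrite SL_E//.
have Ji := integrand_int uH fL.
have i3 := intbZ (a / 2) mO1 (L2_sqr mO1 fbar_L2).
have mg0 : measurable_fun Om1 (fun x => Num.max 0 (gain u x)).
  by apply: measurable_maxr => //; exact: gain_meas.
have [gi|ngi] := pselect (intb Om1 (fun x => Num.max 0 (gain u x))).
  rewrite (EFin_Rint mO1 gi) -EFinB lee_fin /sqn -RintegralZl//; last exact: L2_sqr.
  rewrite -RintegralB//; apply: le_Rint_ae => //; first exact: intbB.
  apply: ae_imply adm => x H Ox; have [D0 Dz] := H Ox.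
  have : gain u x <= Num.max 0 (gain u x) by rewrite le_max lexx orbT.
  rewrite integrandE; move: D0; rewrite le_eqVlt => /predU1P[D0|D0].
    rewrite -D0 (_ : source u x = 0); last exact: Dz.
    have : 0 <= Num.max 0 (gain u x) by rewrite le_max lexx.
    lra.
  have : 0 <= Delta a u x / 2 * (f x - source u x / Delta a u x) ^+ 2.
    by rewrite mulr_ge0 ?sqr_ge0// divr_ge0// ltW.
  have -> : Delta a u x / 2 * (f x - source u x / Delta a u x) ^+ 2 =
    Delta a u x / 2 * f x ^+ 2 - source u x * f x + gain u x.
    by rewrite /gain; field; rewrite gt_eqF.
  lra.
suff -> : (\int[mu]_(x in Om1) (Num.max 0 (gain u x))%:E = +oo)%E by rewrite leNye.
apply/eqP; rewrite -leye_eq leNgt; apply/negP => lt; apply: ngi; apply/integrableP.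
split; first exact/measurable_EFinP.
apply: le_lt_trans lt; rewrite le_eqVlt; apply/orP; left; apply/eqP.
apply: eq_integral => x _ /=.
by rewrite ger0_norm// le_max lexx.
Qed.

(* Truncating [fhat] makes it admissible as a competitor; monotone convergence
   removes the truncation. *)
Lemma Stilde_le_SL u : H10 Om u -> admissible L a fbar u ->
  (S u <= SL L a fbar u)%E.
Proof.
move=> uH adm.
case E : (S u) => [s| |]; last by rewrite leNye.
  2: by have := Stilde_le uH L2_0; rewrite E leye_eq.
have mg := gain_meas uH; have mD := Delta_meas uH.
have mg0 : measurable_fun Om1 (fun x => Num.max 0 (gain u x)) by apply: measurable_maxr.
have mf : measurable_fun Om1 (fhat L a fbar u : RM -> R).
  apply: measurable_funM.
    apply: measurable_funD; last by apply: L2_meas => //; exact: wd_L21.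
    by apply: measurable_funM => //; exact: L2_meas.
  exact: (measurableT_comp measurable_invr).
pose tr n : RM -> R := fun x => (`|fhat L a fbar u x| <= n%:R)%R%:R.
have mtr n : measurable_fun Om1 (tr n).
  rewrite (_ : tr n = (fun x => if `|fhat L a fbar u x| <= n%:R then 1 else 0)).
    by apply: measurable_fun_if => //; apply: measurable_fun_ler => //; exact: measurableT_comp.
  by apply/funext => x; rewrite /tr; case: (_ <= _).
pose fn n : RM -> R := fun x => tr n x * fhat L a fbar u x.
have fnL n : L2 Om1 (fn n).
  apply: (@L2_bounded _ _ _ n%:R) => //; first exact: measurable_funM.
  move=> x _; rewrite /fn /tr; case: (leP `|fhat L a fbar u x| n%:R) => H.
    by rewrite mul1r.
  by rewrite mul0r normr0.
have i3 := intbZ (a / 2) mO1 (L2_sqr mO1 fbar_L2).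
pose G n : RM -> R := fun x => Num.max 0 (gain u x) * tr n x.
have mG n : measurable_fun Om1 (G n) by exact: measurable_funM.
have G0 n x : 0 <= G n x.
  by rewrite mulr_ge0 ?le_max ?lexx// /tr; case: (_ <= _).
(* As [tr n] takes only the values 0 and 1, the integrand at [fn n] is [a / 2 fbar^2 - G n] almost
   everywhere. *)
have bound n : (\int[mu]_(x in Om1) (G n x)%:E <= (a / 2 * sqn Om1 fbar - s)%:E)%E.
  have := Stilde_le uH (fnL n); rewrite E lee_fin => sJ.
  have Ji := integrand_int uH (fnL n).
  rewrite (_ : (\int[mu]_(x in Om1) (G n x)%:E =
    \int[mu]_(x in Om1) (a / 2 * fbar x ^+ 2 - integrand L a fbar u (fn n) x)%:E)%E).
    rewrite (EFin_Rint mO1 (intbB mO1 i3 Ji)) lee_fin RintegralB//.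
    by rewrite RintegralZl//; [rewrite -/(sqn _ _); lra|exact: L2_sqr].
  apply: ae_eq_integral => //.
  - by apply/measurable_EFinP.
  - by apply/measurable_EFinP; exact: intb_meas (intbB mO1 i3 Ji).
  - apply: ae_imply adm => x H Ox; have [D0 Dz] := H Ox; congr EFin.
    rewrite /G max_r; last by rewrite /gain divr_ge0 ?sqr_ge0// mulr_ge0.
    have := integrand_fhat u x; rewrite !integrandE /fn /tr.
    case: (_ <= n%:R); rewrite ?mul1r ?mul0r ?mulr1 ?mulr0 ?expr0n/=; lra.
have lim : ((\int[mu]_(x in Om1) (G n x)%:E)%E @[n --> \oo] -->
    (\int[mu]_(x in Om1) (Num.max 0 (gain u x))%:E)%E).
  have := @cvg_monotone_convergence _ _ _ mu Om1 mO1 (fun n x => (G n x)%:E).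
  have -> : (\int[mu]_(x in Om1) limn (fun n => (G n x)%:E) =
    \int[mu]_(x in Om1) (Num.max 0 (gain u x))%:E)%E.
    apply: eq_integral => x _; apply/cvg_lim => //.
    apply: cvg_near_cst.
    have [N] : exists N : nat, `|fhat L a fbar u x| < N%:R.
      by exists (Num.truncn `|fhat L a fbar u x|).+1; exact: truncnS_gt.
    move=> HN; exists N => // n /= Nn; rewrite /G /tr.
    by rewrite (le_trans (ltW HN)) ?ler_nat// mulr1.
  apply.
  - by move=> n; apply/measurable_EFinP.
  - by move=> n x _; rewrite lee_fin.
  - move=> x _ n m nm; rewrite lee_fin /G ler_wpM2l ?le_max ?lexx//.
    rewrite /tr; case: (leP `|fhat L a fbar u x| n%:R) => H //.
    by rewrite (le_trans H) ?ler_nat.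
have : (\int[mu]_(x in Om1) (Num.max 0 (gain u x))%:E <= (a / 2 * sqn Om1 fbar - s)%:E)%E.
  by apply: (cvge_le _ lim); exact: nearW.
rewrite SL_E//.
have : (0 <= \int[mu]_(x in Om1) (Num.max 0 (gain u x))%:E)%E.
  by apply: integral_ge0 => x _; rewrite lee_fin le_max lexx.
case: (\int[mu]_(x in Om1) (Num.max 0 (gain u x))%:E)%E => [v| |]//.
by rewrite !lee_fin; lra.
Qed.

Lemma Stilde_formula u : H10 Om u ->
  S u = (if `[< admissible L a fbar u >] then SL L a fbar u else -oo)%E.
Proof.
move=> uH; case: asboolP => adm.
  apply/eqP; rewrite eq_le Stilde_le_SL//=.
  by apply: Stilde_ge => // f fL; exact: SL_le_J.
apply/eqP; rewrite -leeNy_eq leNgt; apply/negP => H.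
by apply: adm; exact: Stilde_admissible.
Qed.

End Functional.

(** * Concavity, interior of the domain, maximizers *)

Section Arithmetic.
Context {R : realType}.

(** [x], [y] and [z] stand for the squared norms of two near-minimizers and of their midpoint, [dn]
    and [dm] for infima over superlevel sets, and [l] for the limit of these infima; the left side
    comes from the parallelogram identity. *)
Lemma near_minimal_arith (x y z dn dm l i j : R) : x < dn + i -> y < dm + j ->
  j <= i -> dm <= l -> dn <= z -> 2 * x + 2 * y - 4 * z <= 2 * (l - dn) + 4 * i.
Proof. by lra. Qed.

Lemma cauchy_arith (l e d i : R) : 0 < e -> l - e / 8 < d -> i < e / 8 ->
  2 * (l - d) + 4 * i <= e.
Proof. by lra. Qed.

Lemma scale_lt (s z : R) : 0 < s -> 0 <= z -> s ^+ 2 * z < (s * (z + 1)) ^+ 2.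
Proof.
move=> s0 z0; have s2 : 0 < s ^+ 2 by rewrite exprn_gt0.
have z2 : 0 < (z + 1) ^+ 2 - z by nra.
by rewrite exprMn ltr_pM2l// -subr_gt0.
Qed.

Lemma scale_le (l e : R) : 0 <= l -> 2 * l * e ^+ 2 <= (e * (2 * l + 1)) ^+ 2.
Proof.
move=> l0; rewrite exprMn mulrC; apply: ler_wpM2l; first exact: sqr_ge0.
nra.
Qed.

Lemma coercive_arith (M N b W : R) : M <= N -> N + b + 1 <= W -> - W + b < - M.
Proof. by lra. Qed.

End Arithmetic.

Section Variational.
Context {R : realType} (L a : R) (fbar : R -> R).
Context (L_gt0 : 0 < L) (a_gt0 : 0 < a).
Notation mu := (@lebesgue_measure R).
Notation RM := (measurableTypeR R).
Notation Om := (Omega L : set RM).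
Notation Om1 := (Omega1 L : set RM).
Notation wd := (wderiv (Omega L)).
Notation S := (Stilde L a fbar).
Notation J u f := (\int[mu]_(x in Om1) integrand L a fbar u f x).
Notation P := (source L a fbar).
Notation q u := (sqn Om (wd u)).
Context (fbar_L2 : L2 Om1 fbar).
Implicit Types (f g h u v : RM -> R) (x y e s t : R).

Let mOm : measurable Om := measurable_Omega L.
Let mO1 : measurable Om1 := measurable_Omega1 L.
Let fO1 : (mu Om1 < +oo)%E := fin_Omega1 L.

Lemma wd_lin1 u v s t : H10 Om u -> H10 Om v ->
  {ae mu, forall x, Om1 x -> wd (fun x => s * u x + t * v x) x = s * wd u x + t * wd v x}.
Proof.
move=> uH vH; apply: wd_ae1; last exact: (wd_lin L_gt0 s t (H10_H1 uH) (H10_H1 vH)).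
by move=> x nx; rewrite !wd_out// ?mulr0 ?addr0//; exact: H10_lin.
Qed.

(** The term [a / 2 (f - fbar)^2] does not involve [u], hence the condition [s + t = 1]. *)
Lemma J_affine u v f s t : H10 Om u -> H10 Om v -> L2 Om1 f -> s + t = 1 ->
  J (fun x => s * u x + t * v x) f = s * J u f + t * J v f.
Proof.
move=> uH vH fL st.
have ui := integrand_int L_gt0 a_gt0 fbar_L2 uH fL.
have vi := integrand_int L_gt0 a_gt0 fbar_L2 vH fL.
have wi := integrand_int L_gt0 a_gt0 fbar_L2 (H10_lin L_gt0 s t uH vH) fL.
rewrite -RintegralZl// -RintegralZl// -RintegralD//; try exact: intbZ.
apply: Rint_ae => //.
- exact: intb_meas wi.
- by apply: (intb_meas (D := Om1)); apply: intbD => //; exact: intbZ.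
- apply: ae_imply (wd_lin1 s t uH vH) => x + Ox => /(_ Ox) E.
  by rewrite /integrand E (_ : t = 1 - s); [ring|rewrite -st; ring].
Qed.

Lemma Stilde_concave : H10_concave Om S.
Proof.
move=> u v t uH vH /andP[t0 t1].
have lH := H10_lin L_gt0 t (1 - t) uH vH.
apply: (Stilde_ge L_gt0 a_gt0 fbar_L2 lH) => f fL.
rewrite J_affine//; last by rewrite addrC subrK.
rewrite [X in (_ <= X)%E](_ : _ = t%:E * (J u f)%:E + (1 - t)%:E * (J v f)%:E)%E; last first.
  by rewrite -!EFinM -EFinD.
by apply: leeD; apply: lee_wpmul2l; rewrite ?lee_fin ?subr_ge0//; exact: Stilde_le.
Qed.

(** Controls the growth of [J v f] when [v] moves a distance [r] from [u]. The first summand comes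
    from Young's inequality with weights [1 / (2 r)] and [r / 2] on the product of [f] and the
    derivative of [v - u]; the second comes from the sup bound [sqrt (2 L) r] on [v - u] at [x - 1]
    and [x + 1]. *)
Definition modulus f : R := (1 + sqn Om1 f) / 2 + 2 * Num.sqrt (2 * L) * sqn Om1 f.

Lemma sup_boundE u : sup_bound L u = Num.sqrt (2 * L) * Num.sqrt (q u).
Proof. by rewrite /sup_bound sqrtrM// mulr_ge0// ltW. Qed.

Lemma J_perturb u v f (r : R) : H10 Om u -> H10 Om v -> L2 Om1 f -> 0 < r ->
  q (v \- u) < r ^+ 2 -> J v f <= J u f + r * modulus f.
Proof.
move=> uH vH fL r0 qr; have wH := H10_B L_gt0 vH uH.
have ui := integrand_int L_gt0 a_gt0 fbar_L2 uH fL.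
have vi := integrand_int L_gt0 a_gt0 fbar_L2 vH fL.
have wL := wd_L21 wH; have w2 := L2_sqr mO1 wL; have f2 := L2_sqr mO1 fL.
have sb x : `|(v \- u) x| <= Num.sqrt (2 * L) * r.
  apply: (le_trans (H10_sup_bound L_gt0 x wH)); rewrite sup_boundE ler_wpM2l//.
  by rewrite -(gtr0_norm r0) -sqrtr_sqr; apply: ler_wsqrtr; exact: ltW.
pose c := r / 2 + 2 * (Num.sqrt (2 * L) * r).
have H : J v f <= \int[mu]_(x in Om1) (integrand L a fbar u f x +
    ((2 * r)^-1 * wd (v \- u) x ^+ 2 + c * f x ^+ 2)).
  have i2 := intbZ (2 * r)^-1 mO1 w2; have i3 := intbZ c mO1 f2.
  have i4 := intbD mO1 i2 i3.
  apply: le_Rint_ae => //; first exact: intbD.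
  have wE := wd_lin1 1 (-1) vH uH.
  apply: ae_imply wE => x + Ox => /(_ Ox).
  rewrite (_ : (fun x => 1 * v x + -1 * u x) = v \- u); last first.
    by apply/funext => z /=; ring.
  move=> E; have Ev : wd v x = wd u x + wd (v \- u) x by rewrite E; ring.
  rewrite /integrand Ev.
  have := sb (x - 1); have := sb (x + 1); rewrite /= !ler_norml.
  set z := Num.sqrt _ * r => /andP[A1 A2] /andP[B1 B2].
  have -> : c = r / 2 + 2 * z by [].
  set w := wd (v \- u) x; set W := wd u x.
  have H1 : - w * f x <= (2 * r)^-1 * w ^+ 2 + r / 2 * f x ^+ 2.
    have : 0 <= (2 * r)^-1 * (w + r * f x) ^+ 2.
      by rewrite mulr_ge0 ?sqr_ge0// invr_ge0 mulr_ge0// ltW.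
    have -> : (2 * r)^-1 * (w + r * f x) ^+ 2 =
      (2 * r)^-1 * w ^+ 2 + r / 2 * f x ^+ 2 + w * f x by field; rewrite gt_eqF.
    lra.
  have H2 : f x ^+ 2 / 2 * ((v (x - 1) - u (x - 1)) - (v (x + 1) - u (x + 1))) <=
      f x ^+ 2 / 2 * (2 * z).
    by apply: ler_wpM2l; [rewrite divr_ge0 ?sqr_ge0|lra].
  have f20 : 0 <= f x ^+ 2 * z.
    by rewrite mulr_ge0 ?sqr_ge0//; lra.
  move: H1 H2 f20; set F := f x ^+ 2; set k := (2 * r)^-1 * w ^+ 2.
  move=> H1 H2 f20.
  have -> : - (W + w) * f x + F / 2 * (v (x - 1) - v (x + 1)) =
     - W * f x + F / 2 * (u (x - 1) - u (x + 1)) + (- w * f x) +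
     F / 2 * ((v (x - 1) - u (x - 1)) - (v (x + 1) - u (x + 1))) by field.
  lra.
apply: (le_trans H).
rewrite RintegralD//; last by apply: intbD => //; exact: intbZ.
rewrite lerD2l RintegralD//; [|exact: intbZ|exact: intbZ].
rewrite !RintegralZl// -/(sqn Om1 (wd (v \- u))) -/(sqn Om1 f).
rewrite sqn_Omega1//; last by move=> x; exact: wd_out.
have : (2 * r)^-1 * q (v \- u) <= r / 2.
  have -> : r / 2 = (2 * r)^-1 * r ^+ 2 by field; rewrite gt_eqF.
  by rewrite ler_wpM2l ?invr_ge0 ?mulr_ge0 ?ltW.
rewrite /c /modulus; lra.
Qed.

Lemma modulus_ge0 f : 0 <= modulus f.
Proof. by rewrite addr_ge0// ?divr_ge0 ?addr_ge0 ?sqn_ge0// !mulr_ge0 ?sqn_ge0. Qed.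

Lemma Stilde_usc : H10_upper_semicontinuous Om S.
Proof.
move=> u c uH Sc; have [f fL] := Stilde_lt L_gt0 a_gt0 fbar_L2 uH Sc.
rewrite lte_fin => Jc; have m0 := modulus_ge0 f.
have m1 : 0 < modulus f + 1 by lra.
exists ((c - J u f) / (modulus f + 1)); first by rewrite divr_gt0// subr_gt0.
set r := _ / _; have r0 : 0 < r by rewrite /r divr_gt0// subr_gt0.
move=> v [vH vu]; rewrite (H10norm_lt _ r0) in vu; last first.
  exact: (H1_B L_gt0 (H10_H1 vH) (H10_H1 uH)).
apply: (le_lt_trans (Stilde_le L_gt0 a_gt0 fbar_L2 vH fL)); rewrite lte_fin.
apply: (le_lt_trans (J_perturb uH vH fL r0 vu)).
have : r * (modulus f + 1) = c - J u f by rewrite /r divfK// gt_eqF.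
lra.
Qed.

(** Admissibility excludes negative values only almost everywhere; continuity would spread one
    negative value to a neighbourhood. *)
Lemma dom_Delta_ge0 u : H10 Om u -> (-oo < S u)%E -> forall x, Om1 x -> 0 <= Delta a u x.
Proof.
move=> uH Su x Ox; rewrite leNgt; apply/negP => D0.
have adm := Stilde_admissible L_gt0 a_gt0 fbar_L2 uH Su.
have [y [Oy Dy]] : exists2 y, (Om1 y /\ Delta a u y < 0) &
    (Om1 y -> 0 <= Delta a u y /\ (Delta a u y = 0 -> wd u y + a * fbar y = 0)).
  apply: ae_nbhs adm; apply: filterI; first exact: (near_in_itvoo Ox).
  have Dc : (Delta a u : R -> R) y @[y --> x] --> Delta a u x by exact: (Delta_cts uH).
  exact: (cvgr_lt _ Dc _ D0).
by move=> /(_ Oy)[]; rewrite leNgt Dy.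
Qed.

(** The minimum over the closed interval is attained. At an endpoint of [Omega1] both shifted points
    lie outside [Omega], so Delta equals [a] there. *)
Lemma Delta_lower u : H10 Om u -> (forall x, Om1 x -> 0 < Delta a u x) ->
  exists2 del, 0 < del & forall x, Om1 x -> del <= Delta a u x.
Proof.
move=> uH Dp; have LL : - L - 1 <= L + 1 by have := L_gt0; lra.
have uc : {within `[- L - 1, L + 1], continuous (Delta a u : R -> R)}.
  have Dc : continuous (Delta a u : R -> R) by exact: (Delta_cts uH).
  exact: continuous_subspaceT Dc.
have [m mI mmin] := EVT_min LL uc.
exists (Delta a u m); last first.
  move=> x; rewrite /Omega1 /= in_itv/= => /andP[x1 x2]; apply: mmin.
  by rewrite in_itv/= !ltW.
have [Om_|nOm] := pselect (Om1 m); first exact: Dp.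
have u0 x : ~ Om x -> u x = 0 by have [_ _ _] := uH; apply.
have E : m <= - L - 1 \/ L + 1 <= m.
  move: nOm; rewrite /Omega1 /= in_itv/= => /negP; rewrite negb_and -!leNgt => /orP[?|?].
    by left.
  by right.
move: mI; rewrite in_itv/= => /andP[m1 m2].
have n1 : ~ Om (m - 1).
  by rewrite /Omega /= in_itv/= => /andP[? ?]; case: E; have := L_gt0; lra.
have n2 : ~ Om (m + 1).
  by rewrite /Omega /= in_itv/= => /andP[? ?]; case: E; have := L_gt0; lra.
by rewrite /Delta u0// u0// addr0 subr0.
Qed.

(** Completing the square bounds the integrand below by [- P^2 / (2 del)], whatever the
    competitor. *)
Lemma Stilde_gtNy u del : H10 Om u -> 0 < del ->
  (forall x, Om1 x -> del <= Delta a u x) -> (-oo < S u)%E.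
Proof.
move=> uH d0 Dd; pose c := (2 * del)^-1.
apply: (@lt_le_trans _ _ (- (c * sqn Om1 (P u)))%:E); first exact: ltNyr.
apply: (Stilde_ge L_gt0 a_gt0 fbar_L2 uH) => f fL; rewrite lee_fin.
have P2 := L2_sqr mO1 (source_L2 a fbar_L2 uH).
have ui := integrand_int L_gt0 a_gt0 fbar_L2 uH fL.
have -> : - (c * sqn Om1 (P u)) = \int[mu]_(x in Om1) (- c * P u x ^+ 2).
  by rewrite RintegralZl// mulNr.
apply: le_Rintegral => //; first exact: intbZ.
move=> x Ox; rewrite integrandE.
have h1 : del / 2 * f x ^+ 2 <= Delta a u x / 2 * f x ^+ 2.
  by rewrite ler_wpM2r ?sqr_ge0// ler_wpM2r// Dd.
have h2 : 0 <= c * (del * f x - P u x) ^+ 2.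
  by rewrite mulr_ge0 ?sqr_ge0// invr_ge0 mulr_ge0// ltW.
have h3 : 0 <= a / 2 * fbar x ^+ 2 by rewrite mulr_ge0 ?sqr_ge0// divr_ge0// ltW.
have h4 : c * (del * f x - P u x) ^+ 2 = del / 2 * f x ^+ 2 - P u x * f x + c * P u x ^+ 2.
  by rewrite /c; field; rewrite gt_eqF.
move: h1 h2 h3; rewrite h4; lra.
Qed.

Lemma interior_dom : H10_interior Om (domS L a fbar) =
  [set u | H10 Om u /\ forall x, Om1 x -> 0 < Delta a u x].
Proof.
apply/seteqP; split => u [uH].
- move=> [eps e0 ball]; split=> // x Ox.
  (* Delta of [(1 + s) u] is [(1 + s) Delta - s a], negative where Delta <= 0 *)
  pose s := eps / (q u + 1).
  have q0 : 0 <= q u by exact: sqn_ge0.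
  have q1 : 0 < q u + 1 by lra.
  have s0 : 0 < s by exact: divr_gt0.
  pose v : RM -> R := fun x => (1 + s) * u x + 0 * u x.
  have vH : H10 Om v by exact: H10_lin.
  have vu : q (v \- u) < eps ^+ 2.
    rewrite (sqn_wdB L_gt0 (H10_H1 vH) (H10_H1 uH)).
    have -> : sqn Om (fun x => wd v x - wd u x) = sqn Om (fun x => s * wd u x).
      apply: sqn_ae => //.
      + by apply: L2_meas => //; apply: L2B => //; exact: wd_L2.
      + by apply: L2_meas => //; apply: L2Z => //; exact: wd_L2.
      + apply: ae_imply (wd_lin L_gt0 (1 + s) 0 (H10_H1 uH) (H10_H1 uH)) => y + Oy => /(_ Oy) ->.
        by ring.
    rewrite sqnZ//; last exact: wd_L2.
    (* [s] was defined by dividing by [q u + 1], where the norm is the root of [q u]: this avoids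
       roots and a zero denominator, and suffices since [q u < (q u + 1)^2]. *)
    have -> : eps = s * (q u + 1) by rewrite /s divfK// gt_eqF.
    exact: scale_lt.
  have [_ Sv] : domS L a fbar v.
    apply: ball; split => //; rewrite (H10norm_lt _ e0)//.
    exact: (H1_B L_gt0 (H10_H1 vH) (H10_H1 uH)).
  have := dom_Delta_ge0 vH Sv Ox; rewrite ltNge => H; apply/negP => D0.
  have : Delta a v x = (1 + s) * Delta a u x - s * a by rewrite /Delta /v; ring.
  move=> E; rewrite E in H.
  have s1 : 0 <= 1 + s by rewrite addr_ge0// ltW.
  have h1 := mulr_ge0_le0 s1 D0; have h2 := mulr_gt0 s0 a_gt0.
  by move: H; rewrite leNgt => /negP; apply; rewrite subr_lt0; exact: le_lt_trans h1 h2.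
- move=> Dp; split => //.
  have [del d0 Dd] := Delta_lower uH Dp.
  (* The sup norm of [v - u] is then at most [sqrt (2 L) eps <= del / 4], so Delta, which sees two
     shifts, loses at most [del / 2]. *)
  pose eps := del / 4 / (2 * L + 1).
  have L1 : 0 < 2 * L + 1 by have := L_gt0; lra.
  have e0 : 0 < eps by rewrite !divr_gt0.
  exists eps => // v [vH vu]; split => //.
  have wH := H10_B L_gt0 vH uH.
  rewrite (H10norm_lt _ e0) in vu; last exact: H10_H1.
  have wb x : `|(v \- u) x| <= del / 4.
    have h := H10_sup L_gt0 x wH.
    have d4 : 0 <= del / 4 by rewrite divr_ge0// ltW.
    rewrite -(ger0_norm d4) -ler_sqr ?nnegrE// real_normK ?num_real// real_normK ?num_real//.
    apply: (le_trans h).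
    have -> : del / 4 = eps * (2 * L + 1) by rewrite /eps divfK// gt_eqF.
    apply: (@le_trans _ _ (2 * L * eps ^+ 2)).
      by rewrite ler_wpM2l ?mulr_ge0 ?ltW.
    by apply: scale_le; exact: ltW.
  apply: (@Stilde_gtNy v (del / 2)) => //; first by rewrite divr_gt0.
  move=> x Ox; have := Dd x Ox; rewrite /Delta.
  have := wb (x - 1); have := wb (x + 1); rewrite /= !ler_norml.
  move=> /andP[A1 A2] /andP[B1 B2]; lra.
Qed.

(** The numerator grows like [n^2 / 2], the denominator linearly. The threshold lets one quarter of
    [n^2] absorb [4 K c n] and another absorb [2 K aa + G]. *)
Lemma growth_bound (K c G n Pn aa : R) : 0 <= K -> 0 <= c -> 0 <= G -> 0 < aa ->
  1 + 16 * K * c + 4 * (2 * K * aa + G) < n -> n ^+ 2 / 2 - G <= Pn ->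
  K <= Pn / (2 * (aa + 2 * (c * n))).
Proof.
move=> K0 c0 G0 a0 nbig Pbig.
have Kc : 0 <= K * c by exact: mulr_ge0.
have Ka : 0 <= K * aa by rewrite mulr_ge0// ltW.
have n1 : 1 <= n by rewrite -!mulrA in nbig; lra.
have n0 : 0 <= n by lra.
have cn : 0 <= c * n by exact: mulr_ge0.
have den : 0 < 2 * (aa + 2 * (c * n)) by lra.
rewrite ler_pdivlMr//.
have h1 : 16 * (K * c) * n <= n * n.
  by rewrite ler_wpM2r//; rewrite -!mulrA in nbig *; lra.
have h2 : 4 * (2 * (K * aa) + G) * 1 <= n * n.
  by apply: ler_pM => //; rewrite -?mulrA in nbig *; lra.
have -> : K * (2 * (aa + 2 * (c * n))) = 2 * (K * aa) + 4 * (K * c) * n by ring.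
rewrite expr2 in Pbig; move: h1 h2 Pbig; lra.
Qed.

Lemma Stilde_coercive : H10_coercive Om (fun u => - S u)%E.
Proof.
move=> M.
pose F := sqn Om1 fbar; have F0 : 0 <= F by exact: sqn_ge0.
pose b0 := a / 2 * F.
have b00 : 0 <= b0 by rewrite mulr_ge0// divr_ge0// ltW.
pose K := `|M| + b0 + 1; pose c := Num.sqrt (2 * L).
have K0 : 0 <= K by rewrite !addr_ge0.
have c0 : 0 <= c by exact: sqrtr_ge0.
pose G := a ^+ 2 * F; have G0 : 0 <= G by rewrite mulr_ge0 ?sqr_ge0.
exists (1 + 16 * K * c + 4 * (2 * K * a + G)) => u uH.
rewrite /H10norm (L2normE mOm (wd_L2 uH)) lte_fin => nbig.
set n := Num.sqrt _ in nbig.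
have n2 : n ^+ 2 = q u by rewrite sqr_sqrtr// sqn_ge0.
have PL := source_L2 a fbar_L2 uH.
have afL : L2 Om1 (fun x => a * fbar x) by exact: L2Z.
have Pn : n ^+ 2 / 2 - G <= sqn Om1 (P u).
  have := sqnB_le mO1 PL afL.
  rewrite (_ : (fun x => P u x - a * fbar x) = wd u); last first.
    by apply/funext => x; rewrite /source addrK.
  rewrite sqn_Omega1; last by move=> x; exact: wd_out.
  by rewrite sqnZ// n2 /G /F; lra.
have HK := growth_bound K0 c0 G0 a_gt0 nbig Pn.
(* [A] bounds Delta, so the competitor [P / A], which would be optimal for [Delta = A], gives at
   most [b0 - sqn P / (2 A)]. *)
pose A := a + 2 * (c * n).
have A0 : 0 < A by rewrite /A ltr_pwDl// mulr_ge0// mulr_ge0// sqrtr_ge0.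
have kL : L2 Om1 (fun x => A^-1 * P u x) by exact: L2Z.
have := Stilde_le L_gt0 a_gt0 fbar_L2 uH kL.
rewrite (J_scale L_gt0 a_gt0 fbar_L2 _ uH PL) => Sle.
rewrite lteNr; apply: (le_lt_trans Sle); rewrite -EFinN lte_fin.
have -> : \int[mu]_(x in Om1) (P u x * P u x) = sqn Om1 (P u).
  by apply: eq_Rintegral => x _; rewrite expr2.
have h1 : \int[mu]_(x in Om1) (Delta a u x / 2 * P u x ^+ 2) <= A / 2 * sqn Om1 (P u).
  rewrite /sqn -RintegralZl//; last exact: L2_sqr.
  apply: le_Rintegral => //.
  - exact: Delta_sqr_int.
  - by apply: intbZ => //; exact: L2_sqr.
  - move=> x _; rewrite ler_wpM2r ?sqr_ge0// ler_wpM2r//.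
    apply: (le_trans (ler_norm _)); apply: (le_trans (Delta_bound L_gt0 a_gt0 x uH)).
    by rewrite sup_boundE.
have h2 : (\int[mu]_(x in Om1) (Delta a u x / 2 * P u x ^+ 2)) * A^-1 ^+ 2 <=
    A / 2 * sqn Om1 (P u) * A^-1 ^+ 2 by rewrite ler_wpM2r ?sqr_ge0.
have h3 : A / 2 * sqn Om1 (P u) * A^-1 ^+ 2 - sqn Om1 (P u) * A^-1 =
   - (sqn Om1 (P u) / (2 * A)) by field; rewrite gt_eqF.
have M0 : M <= `|M| by exact: ler_norm.
rewrite -/F -/b0; rewrite -/A in HK.
apply: (@le_lt_trans _ _ (- (sqn Om1 (P u) / (2 * A)) + b0)).
  by rewrite lerD2r -h3 lerD2r.
by apply: coercive_arith M0 _; exact: HK.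
Qed.

(** * Existence of a maximizer *)

Lemma parallelogram u v : L2 Om u -> L2 Om v ->
  sqn Om (fun x => u x - v x) =
  2 * sqn Om u + 2 * sqn Om v - 4 * sqn Om (fun x => 2^-1 * u x + 2^-1 * v x).
Proof.
move=> uL vL.
have -> : sqn Om (fun x => u x - v x) = sqn Om (fun x => u x + (-1) * v x).
  by apply: eq_Rintegral => x _; rewrite mulN1r.
have -> : sqn Om (fun x => 2^-1 * u x + 2^-1 * v x) =
    (2^-1) ^+ 2 * sqn Om (fun x => u x + 1 * v x).
  rewrite -sqnZ//; last by apply: L2D => //; exact: L2Z.
  by apply: eq_Rintegral => x _; rewrite mul1r mulrDr.
by rewrite !sqn_lin//; field.
Qed.

(** The supremum is finite: the competitor 0 bounds it above, and the zero function, where Delta is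
    the constant [a], bounds it below. *)
Lemma Stilde_sup : exists2 M, (forall u, H10 Om u -> (S u <= M%:E)%E) &
  (forall e, 0 < e -> exists2 u, H10 Om u & ((M - e)%:E <= S u)%E).
Proof.
pose E : set (\bar R) := [set S u | u in H10 Om].
have Eub : (ereal_sup E <= (a / 2 * sqn Om1 fbar)%:E)%E.
  by apply: ge_ereal_sup => _ [u uH <-]; exact: Stilde_upper.
have H0 := H10_0 L_gt0.
have E0 : (-oo < ereal_sup E)%E.
  apply: (@lt_le_trans _ _ (S (fun=> 0))).
    by apply: (@Stilde_gtNy _ a) => // x _; rewrite /Delta addr0 subr0.
  by apply: ereal_sup_ubound; exists (fun=> 0).
have Efin : ereal_sup E \is a fin_num.
  rewrite fin_numE; apply/andP; split; first by rewrite gt_eqF.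
  by rewrite lt_eqF// (le_lt_trans Eub)// ltry.
exists (fine (ereal_sup E)); first by move=> u uH;
  rewrite fineK//; apply: ereal_sup_ubound; exists u.
move=> e e0; apply: contrapT => H.
have : (ereal_sup E <= (fine (ereal_sup E) - e)%:E)%E.
  apply: ge_ereal_sup => _ [u uH <-]; rewrite leNgt; apply/negP => lt.
  by apply: H; exists u => //; exact: ltW.
rewrite -{1}(fineK Efin) lee_fin; lra.
Qed.

(* The superlevel sets are convex, so near-minimal norm elements of them form
   a Cauchy sequence; this replaces weak compactness. *)
Lemma Stilde_maximizer : exists u, H10_maximizer Om S u.
Proof.
have [M Mub Madh] := Stilde_sup.
(* [iv n] serves both as the defect of the level [M - iv n] and as the tolerance for near-minimal
   norm. *)
have [iv [inv0 iv1 inv_le ivc]] : exists iv : nat -> R, [/\ forall n, 0 < iv n,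
    iv 0%N = 1, forall n m, (n <= m)%N -> iv m <= iv n & iv n @[n --> \oo] --> 0].
  exists (fun n => n.+1%:R^-1); split; [by move=> n; rewrite invr_gt0|exact: invr1| |].
    by move=> n m nm; rewrite lef_pV2 ?posrE// ler_nat.
  exact: cvg_harmonic.
pose K (n : nat) u := H10 Om u /\ ((M - iv n)%:E <= S u)%E.
pose Q (n : nat) : set R := [set q u | u in K n].
have Qinf n : has_inf (Q n).
  split; last by exists 0 => _ [u _ <-]; exact: sqn_ge0.
  by have [u uH Su] := Madh _ (inv0 n); exists (q u); exists u.
have Kmono n m u : (n <= m)%N -> K m u -> K n u.
  move=> nm [uH Su]; split => //; apply: le_trans Su; rewrite lee_fin.
  by rewrite lerD2l lerN2; exact: inv_le.
(* Since [iv 0 = 1], each [K n] lies in the superlevel set of [M - 1], which coercivity bounds. *)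
have [r Hr] := Stilde_coercive (- (M - 1)).
have Kbnd n u : K n u -> q u <= Num.max 0 r ^+ 2.
  move=> Ku; have [uH Su] := Kmono 0%N n u (leq0n n) Ku.
  have : ~~ (r%:E < H10norm Om u)%E.
    apply/negP => /(Hr u uH); rewrite lteNr -EFinN opprK => lt.
    by move: Su; rewrite iv1 leNgt lt.
  rewrite -leNgt /H10norm (L2normE mOm (wd_L2 uH)) lee_fin => qr.
  rewrite -[leLHS]sqr_sqrtr ?sqn_ge0// lerXn2r ?nnegrE ?le_max ?lexx ?sqrtr_ge0//.
  by rewrite qr orbT.
pose d n := inf (Q n).
have dle n u : K n u -> d n <= q u.
  by move=> Ku; apply: ge_inf; [case: (Qinf n)|exists u].
have dmono : {homo d : n m / (n <= m)%N >-> n <= m}.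
  move=> n m nm; apply: lb_le_inf; first by case: (Qinf m).
  by move=> _ [u Ku <-]; apply: dle; exact: Kmono Ku.
have dcvg : cvgn d.
  apply: nondecreasing_is_cvgn => //; exists (Num.max 0 r ^+ 2) => _ [n _ <-].
  by have [[_ [u Ku _]] _] := Qinf n; apply: (le_trans (dle n u Ku)); exact: Kbnd Ku.
pose l := limn d.
have dl n : d n <= l by exact: nondecreasing_cvgn_le.
have /choice[u_ Hu] n : exists u, K n u /\ q u < d n + iv n.
  have [_ [u Ku <-] lt] := inf_adherent (inv0 n) (Qinf n).
  by exists u; split.
have uH n : H10 Om (u_ n) by have [[]] := Hu n.
have key n m : (n <= m)%N ->
    sqn Om (fun x => wd (u_ n) x - wd (u_ m) x) <= 2 * (l - d n) + 4 * iv n.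
  move=> nm; have [Kn qn] := Hu n; have [Km qm] := Hu m.
  have [_ Sn] := Kn; have [_ Sm] := Kmono _ _ _ nm Km.
  (* By concavity the midpoint stays in [K n], so its squared norm is at least [d n]. *)
  pose w : RM -> R := fun x => 2^-1 * u_ n x + 2^-1 * u_ m x.
  have wH : H10 Om w by exact: H10_lin.
  have Kw : K n w.
    split; first exact: wH.
    have h01 : 0 <= (2^-1 : R) <= 1 by rewrite invr_ge0 ler0n invf_le1// ler1n.
    have := Stilde_concave (uH n) (uH m) h01.
    rewrite (_ : 1 - 2^-1 = 2^-1 :> R); last by field.
    apply: le_trans.
    rewrite (_ : (M - iv n)%:E = (2^-1)%:E * (M - iv n)%:E +
       (2^-1)%:E * (M - iv n)%:E)%E; last first.
      by rewrite -!EFinM -EFinD; congr EFin; field.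
    by apply: leeD; apply: lee_wpmul2l => //; rewrite lee_fin.
  have nL := wd_L2 (uH n); have mL := wd_L2 (uH m).
  rewrite (parallelogram nL mL).
  have -> : sqn Om (fun x => 2^-1 * wd (u_ n) x + 2^-1 * wd (u_ m) x) = q w.
    apply: sqn_ae => //.
    - by apply: L2_meas => //; apply: L2D => //; exact: L2Z.
    - by apply: L2_meas => //; exact: wd_L2.
    - apply: ae_imply (wd_lin L_gt0 2^-1 2^-1 (H10_H1 (uH n)) (H10_H1 (uH m))) => x + Ox.
      by move=> /(_ Ox) ->.
  exact: (near_minimal_arith qn qm (inv_le _ _ nm) (dl m) (dle n w Kw)).
have Cau (e : R) : 0 < e -> exists N, forall m n, (N <= m)%N -> (N <= n)%N ->
     sqn Om (fun x => wd (u_ m) x - wd (u_ n) x) <= e.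
  move=> e0.
  have e8 : 0 < e / 8 by rewrite divr_gt0.
  have [N1 _ HN1] : \forall n \near \oo, l - e / 8 < d n.
    by apply: (cvgr_gt _ dcvg); rewrite ltrBlDr ltrDl.
  have [N2 _ HN2] : \forall n \near \oo, iv n < e / 8.
    exact: (cvgr_lt _ ivc).
  exists (maxn N1 N2) => m n; rewrite !geq_max => /andP[m1 m2] /andP[n1 n2].
  have gen k k' : (k <= k')%N -> (N1 <= k)%N -> (N2 <= k)%N ->
      sqn Om (fun x => wd (u_ k) x - wd (u_ k') x) <= e.
    move=> kk k1 k2; apply: (le_trans (key _ _ kk)).
    exact: (cauchy_arith e0 (HN1 k k1) (HN2 k k2)).
  have [mn|/ltnW nm] := leqP m n; first exact: gen.
  by rewrite sqnB_sym; exact: gen.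
have [u uH' Hlim] := H10_complete L_gt0 uH Cau.
exists u; split => // v vH; apply: (le_trans (Mub v vH)).
rewrite leNgt; apply/negP => SuM.
(* Upper semicontinuity keeps [Stilde] below [c < M] near [u], whereas the late [u_ n] are near [u]
   with [Stilde] at least [M - iv n > c]. *)
have [c Sc cM] : exists2 c, (S u < c%:E)%E & c < M.
  case E : (S u) SuM => [s| |]//.
    by rewrite lte_fin => sM; exists ((s + M) / 2); rewrite ?lte_fin; case: (midf_lt sM).
  by move=> _; exists (M - 1); [exact: ltNyr|rewrite ltrBlDr ltrDl].
have [eps e0 ball] := Stilde_usc uH' Sc.
have [N HN] := Hlim (eps ^+ 2 / 2) (divr_gt0 (exprn_gt0 2 e0) (ltr0n _ 2)).
have Mc : 0 < M - c by rewrite subr_gt0.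
have [N2 _ HN2] : \forall n \near \oo, iv n < M - c.
  exact: (cvgr_lt _ ivc).
pose n := maxn N N2.
have B : H10_ball Om u eps (u_ n).
  split=> //; rewrite (H10norm_lt _ e0); last first.
    exact: (H1_B L_gt0 (H10_H1 (uH n)) (H10_H1 uH')).
  rewrite (sqn_wdB L_gt0 (H10_H1 (uH n)) (H10_H1 uH')).
  apply: (le_lt_trans (HN n (leq_maxl _ _))).
  by rewrite ltr_pdivrMr// ltr_pMr ?exprn_gt0// ltr1n.
have [[_ Sn] _] := Hu n.
have := le_lt_trans Sn (ball _ B); rewrite lte_fin.
have := HN2 n (leq_maxr _ _); rewrite /= ltrBrDr -ltrBrDl => /lt_trans/[apply].
by rewrite ltxx.
Qed.

End Variational.

(** * The Euler-Lagrange equation *)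

Section Translation.
Context {R : realType}.
Notation mu := (@lebesgue_measure R).
Notation RM := (measurableTypeR R).
Notation intb D f := (mu.-integrable D (EFin \o f)).
Implicit Types (f : RM -> R) (c : R).

Definition shift c : RM -> RM := fun x => x + c.

Lemma measurable_shift c : measurable_fun setT (shift c).
Proof. by apply: measurable_funD. Qed.

HB.instance Definition _ c := isMeasurableFun.Build _ _ _ _ (shift c) (measurable_shift c).

(** The two measures agree on half-open intervals, which determine Lebesgue measure. *)
Lemma lebesgue_measure_shift c (A : set RM) : measurable A ->
  pushforward mu (shift c) A = mu A.
Proof.
move=> mA; apply/esym/lebesgue_measure_unique => //= _ [[a b]] _ <-.
rewrite /pushforward.
have -> : shift c @^-1` `]a, b]%classic = `]a - c, b - c]%classic.
  by apply/seteqP; split => x; rewrite /shift /= !in_itv/= ltrBlDr lerBrDr.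
rewrite !lebesgue_measure_itv/= !lte_fin ltrD2r.
by case: ifP => // _; rewrite -!EFinB; congr EFin; ring.
Qed.

Lemma intb_shift c f : intb setT f -> intb setT (fun x => f (x + c)).
Proof.
move=> fi; have mf := intb_meas fi.
have ms : measurable_fun (setT : set RM) (fun x : RM => f (x + c)).
  exact: (measurableT_comp mf (measurable_shift c)).
apply/integrableP; split; first exact/measurable_EFinP.
move/integrableP : fi => [_]; apply: le_lt_trans.
have := @ge0_integral_pushforward _ _ _ _ R (shift c) (measurable_shift c) mu setT
  (fun x => (`|f x|)%:E).
rewrite preimage_setT => /(_ measurableT) <-//.
- rewrite le_eqVlt; apply/orP; left; apply/eqP.
  by apply: eq_measure_integral => A mA _; exact: lebesgue_measure_shift.
- by apply/measurable_EFinP; exact: measurableT_comp.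
Qed.

Lemma Rint_shift c f : intb setT f -> \int[mu]_x f (x + c) = \int[mu]_x f x.
Proof.
move=> fi; have si := intb_shift c fi; rewrite /Rintegral; congr fine.
have := @integral_pushforward _ _ _ _ R (shift c) (measurable_shift c) mu setT (EFin \o f).
rewrite preimage_setT => H.
rewrite -[LHS]H//.
- by apply: eq_measure_integral => A mA _; exact: lebesgue_measure_shift.
- by apply/measurable_EFinP; exact: intb_meas fi.
Qed.

Lemma ae_shift c (Q : RM -> Prop) : {ae mu, forall x, Q x} ->
  {ae mu, forall x, Q (x + c)}.
Proof.
move=> [N [mN N0 HN]]; exists (shift c @^-1` N); split.
- by rewrite -[X in measurable X]setTI; exact: measurable_shift.
- by rewrite -[LHS]/(pushforward mu (shift c) N) lebesgue_measure_shift.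
- by move=> x /= nQ; apply: HN.
Qed.

End Translation.

Section PerturbationArithmetic.
Context {R : realType}.

(** Take [t] with the sign of [l] and size [e <= |l| / (2 (C + 1))]: then [t l = e |l|] exceeds
    [e^2 C] unless [l = 0]. *)
Lemma small_quadratic (l C t0 : R) : 0 < t0 -> 0 <= C ->
  (forall t, `|t| <= t0 -> t * l <= t ^+ 2 * C) -> l = 0.
Proof.
move=> t00 C0 H; apply/eqP/negPn/negP => l0.
have nl : 0 < `|l| by rewrite normr_gt0.
have C1 : 0 < 2 * (C + 1) by lra.
pose e := Num.min t0 (`|l| / (2 * (C + 1))).
have e0 : 0 < e by rewrite lt_min t00 divr_gt0.
have et : e <= t0 by rewrite ge_min lexx.
have el : e * (2 * (C + 1)) <= `|l|.
  by rewrite -ler_pdivlMr// ge_min lexx orbT.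
have := H (e * Num.sg l).
have -> : `|e * Num.sg l| = e by rewrite normrM normr_sg l0 mulr1 gtr0_norm.
move=> /(_ et); rewrite -mulrA -normrEsg exprMn sqr_sg l0 mulr1 expr2 -mulrA ler_pM2l//.
have eC : 0 <= e * C by rewrite mulr_ge0// ltW.
move: el; rewrite !mulrDr mulr1; nra.
Qed.

(* Completing the square in [g] around [f]; [D + t * d] stands for the perturbed
   Delta, [qq] for the derivative of the perturbation, and [D * f] for P. *)
Lemma perturbed_square (D d t f g qq del : R) : 0 < del -> del / 2 <= D + t * d ->
  - (D / 2 * f ^+ 2) + t * (d * f ^+ 2 / 2 - qq * f) - t ^+ 2 * (del^-1 * (qq - d * f) ^+ 2)
  <= (D + t * d) / 2 * g ^+ 2 - (D * f + t * qq) * g.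
Proof.
move=> d0 H; rewrite -subr_ge0.
have -> : (D + t * d) / 2 * g ^+ 2 - (D * f + t * qq) * g -
  (- (D / 2 * f ^+ 2) + t * (d * f ^+ 2 / 2 - qq * f) -
   t ^+ 2 * (del^-1 * (qq - d * f) ^+ 2)) =
  (D + t * d - del / 2) / 2 * (g - f) ^+ 2 +
  del / 4 * ((g - f) - 2 * t * (qq - d * f) / del) ^+ 2.
  by field; rewrite gt_eqF.
apply: addr_ge0; rewrite mulr_ge0 ?sqr_ge0// divr_ge0 ?subr_ge0// ltW//.
Qed.

Lemma perturb_compare (D f b X Y W : R) :
  - (D / 2 * f ^+ 2) + X - Y <= W ->
  D / 2 * f ^+ 2 - D * f * f + b + X - Y <= W + b.
Proof. by lra. Qed.

Lemma perturb_conclude (j x y : R) : j + x - y <= j -> x <= y.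
Proof. by lra. Qed.

End PerturbationArithmetic.

(** * First variation and regularity at an interior maximizer *)

Section EulerLagrange.
Context {R : realType} (L a : R) (fbar : R -> R).
Context (L_gt0 : 0 < L) (a_gt0 : 0 < a).
Notation mu := (@lebesgue_measure R).
Notation RM := (measurableTypeR R).
Notation intb D f := (mu.-integrable D (EFin \o f)).
Notation Om := (Omega L : set RM).
Notation Om1 := (Omega1 L : set RM).
Notation wd := (wderiv (Omega L)).
Notation S := (Stilde L a fbar).
Notation J u f := (\int[mu]_(x in Om1) integrand L a fbar u f x).
Notation P := (source L a fbar).
Context (fbar_L2 : L2 Om1 fbar).
Implicit Types (f g h u v : RM -> R) (x y e s t : R).

Let mOm : measurable Om := measurable_Omega L.
Let mO1 : measurable Om1 := measurable_Omega1 L.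
Let fO1 : (mu Om1 < +oo)%E := fin_Omega1 L.
Let fOm : (mu Om < +oo)%E := fin_Omega L_gt0.

(** The derivative of [Delta] in the direction [v]. *)
Definition jump v x : R := v (x - 1) - v (x + 1).

Lemma fhat_mul_Delta u x : Delta a u x != 0 -> Delta a u x * fhat L a fbar u x = P u x.
Proof. by move=> D0; rewrite /fhat /source mulrC divfK// addrC. Qed.

Lemma fhat_L2 u del : H10 Om u -> 0 < del -> (forall x, Om1 x -> del <= Delta a u x) ->
  L2 Om1 (fhat L a fbar u).
Proof.
move=> uH d0 Dd.
have -> : fhat L a fbar u = (fun x => (Delta a u x)^-1 * P u x).
  by apply/funext => x; rewrite /fhat /source mulrC [a * _ + _]addrC.
apply: (@L2_bndM _ _ _ _ del^-1); [exact: mO1| | |exact: source_L2].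
  by apply: (measurableT_comp measurable_invr); exact: Delta_meas.
move=> x Ox; have Dx := Dd x Ox; have Dp : 0 < Delta a u x by exact: lt_le_trans Dx.
by rewrite gtr0_norm ?invr_gt0// lef_pV2 ?posrE.
Qed.

Lemma jump_bound v x : H10 Om v -> `|jump v x| <= 2 * sup_bound L v.
Proof.
move=> vH; have := H10_sup_bound L_gt0 (x - 1) vH; have := H10_sup_bound L_gt0 (x + 1) vH.
by rewrite /jump !ler_norml => /andP[? ?] /andP[? ?]; apply/andP; split; lra.
Qed.

Lemma jump_meas v : H10 Om v -> measurable_fun Om1 (jump v).
Proof.
move=> vH; have := Delta_meas 0 vH; congr measurable_fun.
by apply/funext => x; rewrite /Delta /jump add0r.
Qed.

(** For [w = u + t v], [perturbed_square] bounds [J w f] below by [J u fhat + t l - t^2 C] for every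
    [f], hence bounds [Stilde w] too. Maximality gives [Stilde w <= Stilde u <= J u fhat], and
    [small_quadratic] concludes. *)
Lemma first_variation u v : H10_maximizer Om S u ->
  (forall x, Om1 x -> 0 < Delta a u x) -> H10 Om v ->
  \int[mu]_(x in Om1) (jump v x * fhat L a fbar u x ^+ 2 / 2 - wd v x * fhat L a fbar u x) = 0.
Proof.
move=> [uH umax] Dp vH.
have [del d0 Dd] := Delta_lower L_gt0 a_gt0 uH Dp.
pose fh : RM -> R := fhat L a fbar u.
have fL : L2 Om1 fh by exact: fhat_L2 Dd.
have f2 := L2_sqr mO1 fL.
have wL := wd_L21 vH.
have jm := jump_meas vH.
have jb x : Om1 x -> `|jump v x| <= 2 * sup_bound L v by move=> _; exact: jump_bound.
have zL : L2 Om1 (fun x => wd v x - jump v x * fh x).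
  by apply: L2B => //; exact: L2_bndM jb fL.
pose l := \int[mu]_(x in Om1) (jump v x * fh x ^+ 2 / 2 - wd v x * fh x).
pose C := del^-1 * sqn Om1 (fun x => wd v x - jump v x * fh x).
have C0 : 0 <= C by rewrite mulr_ge0 ?sqn_ge0// invr_ge0 ltW.
have sb0 : 0 <= sup_bound L v by exact: sqrtr_ge0.
(* For [|t| <= t0] the perturbation [t * jump v] is at most [del / 2], so the perturbed Delta stays
   above [del / 2]. *)
pose t0 := del / (4 * (sup_bound L v + 1)).
have s4 : 0 < 4 * (sup_bound L v + 1) by rewrite mulr_gt0// ltr_wpDl.
have t00 : 0 < t0 by exact: divr_gt0.
have i1 : intb Om1 (fun x => jump v x * fh x ^+ 2 / 2 - wd v x * fh x).
  apply: intbB => //; last exact: L2M.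
  apply: (@intb_eq _ _ (fun x => 2^-1 * (jump v x * fh x ^+ 2))) => // [x _|].
    by rewrite mulrC.
  by apply: intbZ => //; exact: intb_bndM jb f2.
have i2 := intbZ del^-1 mO1 (L2_sqr mO1 zL).
have Ju := integrand_int L_gt0 a_gt0 fbar_L2 uH fL.
apply: (small_quadratic t00 C0) => t tt0.
pose w : RM -> R := fun x => 1 * u x + t * v x.
have wH : H10 Om w by exact: H10_lin.
have tb : `|t| * (2 * sup_bound L v) <= del / 2.
  apply: (@le_trans _ _ (t0 * (2 * (sup_bound L v + 1)))).
    apply: ler_pM => //; first by rewrite mulr_ge0.
    by rewrite ler_wpM2l// lerDl.
  rewrite le_eqVlt; apply/orP; left; apply/eqP; rewrite /t0; field.
  by rewrite gt_eqF// ltr_wpDl.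
have E : (J u fh + t * l - t ^+ 2 * C)%:E = (\int[mu]_(x in Om1) (integrand L a fbar u fh x +
    t * (jump v x * fh x ^+ 2 / 2 - wd v x * fh x) -
    t ^+ 2 * (del^-1 * (wd v x - jump v x * fh x) ^+ 2)))%:E.
  congr EFin; rewrite RintegralB//; [|by apply: intbD => //; exact: intbZ|exact: intbZ].
  rewrite RintegralD//; last exact: intbZ.
  by rewrite !RintegralZl//; exact: L2_sqr.
have lower : ((J u fh + t * l - t ^+ 2 * C)%:E <= S w)%E.
  rewrite E; apply: (Stilde_ge L_gt0 a_gt0 fbar_L2 wH) => f fL'; rewrite lee_fin.
  have Jw := integrand_int L_gt0 a_gt0 fbar_L2 wH fL'.
  apply: le_Rint_ae => //.
    by apply: intbB => //; [apply: intbD => //; exact: intbZ|exact: intbZ].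
  apply: ae_imply (wd_lin1 L_gt0 1 t uH vH) => x + Ox => /(_ Ox) Ew.
  have Dx := Dd x Ox.
  have Dn : Delta a u x != 0 by rewrite gt_eqF// (lt_le_trans d0).
  have DE : Delta a w x = Delta a u x + t * jump v x by rewrite /Delta /jump /w; ring.
  have PE : P w x = Delta a u x * fh x + t * wd v x.
    by rewrite fhat_mul_Delta// /source Ew; ring.
  rewrite !integrandE DE PE -(fhat_mul_Delta Dn) -/(fh x).
  have Dlow : del / 2 <= Delta a u x + t * jump v x.
    have : - (del / 2) <= t * jump v x.
      have : `|t * jump v x| <= del / 2.
        rewrite normrM; apply: le_trans tb; rewrite ler_wpM2l//; exact: jb.
      by rewrite ler_norml => /andP[].
    by move=> H; rewrite (_ : del / 2 = del + - (del / 2)); [exact: lerD|field].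
  have := perturbed_square (fh x) (f x) (wd v x) d0 Dlow.
  exact: perturb_compare.
have upper : (S w <= (J u fh)%:E)%E.
  by apply: (le_trans (umax w wH)); exact: Stilde_le.
have := le_trans lower upper; rewrite lee_fin; exact: perturb_conclude.
Qed.

Lemma maximizer_strong_solution u : H10_maximizer Om S u ->
  (forall x, Om1 x -> 0 < Delta a u x) -> strong_solution L (fhat L a fbar u).
Proof.
move=> um Dp; have [uH _] := um.
have [del d0 Dd] := Delta_lower L_gt0 a_gt0 uH Dp.
pose fh : RM -> R := fhat L a fbar u.
have fL : L2 Om1 fh by exact: fhat_L2 Dd.
(* Translations act on the whole line, so [fhat] is cut off to 0 outside [Omega1]; for [x] in
   [Omega] the points [x - 1] and [x + 1] stay in [Omega1], where nothing changes. *)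
pose fe : RM -> R := fh \_ Om1.
have feE x : Om1 x -> fe x = fh x by move=> Ox; rewrite /fe patchE mem_set.
have fe0 x : ~ Om1 x -> fe x = 0 by move=> nx; rewrite /fe patchE memNset.
have feL : L2 Om1 fe.
  apply: (L2_ae mO1 _ _ fL).
    by apply/(measurable_restrict _ mO1 mO1); rewrite setIid; exact: L2_meas mO1 fL.
  by apply: aeW => x Ox; rewrite feE.
have fe2 : intb setT (fun x => fe x ^+ 2).
  apply: (@intb_supp _ Om1); [exact: mO1| |exact: L2_sqr].
  by move=> x nx; rewrite fe0// expr0n.
have fei : intb Om fe.
  apply: (intbS mO1 mOm (@sub_Omega _ L)); exact: L2_int.
pose sp : RM -> R := fun x => fe (x + 1) ^+ 2.
pose sm : RM -> R := fun x => fe (x - 1) ^+ 2.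
have spi : intb setT sp by exact: (intb_shift 1 fe2).
have smi : intb setT sm by exact: (intb_shift (- 1) fe2).
pose h : RM -> R := fun x => (- 2^-1) * (sp x - sm x).
have hi : intb setT h by apply: intbZ => //; exact: intbB.
have LL : - L < L by rewrite gtrN.
have weak phi : Cc1 Om phi ->
    \int[mu]_(x in Om) (fe x * derive1 (phi : R -> R) x) = - \int[mu]_(x in Om) (h x * phi x).
  move=> phiC; have pH := Cc1_H10 L_gt0 phiC.
  have [pL dpL] := Cc1_L2 L_gt0 phiC.
  have [c [d [cd dphi cdphi phi0]]] := Cc1_support L_gt0 phiC.
  have cphi := derivable_cts dphi.
  have out x : ~ Om x -> phi x = 0 by move=> /(Cc1_out L_gt0 phiC)[].
  have dout x : ~ Om x -> derive1 (phi : R -> R) x = 0 by move=> /(Cc1_out L_gt0 phiC)[].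
  have [M phiM] : exists M, forall x, `|phi x| <= M.
    by apply: (cts_supp_bounded cd cphi) => x /phi0[].
  have bM g : intb setT g -> intb setT (fun x => phi x * g x).
    move=> gi; apply: (@intb_bndM _ _ _ _ M);
      [exact: measurableT|exact: measurable_cts| |exact: gi].
    by move=> x _; exact: phiM.
  have ip := bM _ spi; have im := bM _ smi.
  have A1 : \int[mu]_(x in Om1) (wd phi x * fh x) =
      \int[mu]_(x in Om) (fe x * derive1 (phi : R -> R) x).
    transitivity (\int[mu]_(x in Om1) (fe x * derive1 (phi : R -> R) x)).
      apply: Rint_ae; [exact: mO1| | |].
      - by apply: intb_meas (L2M mO1 (wd_L21 pH) fL).
      - by apply: intb_meas (L2M mO1 feL (L2_Omega1 dpL dout)).
      - have ae1 := wd_ae1 (fun x nx => etrans (wd_out pH nx) (esym (dout x nx)))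
          (wd_Cc1 L_gt0 phiC).
        by apply: ae_imply ae1 => x + Ox => /(_ Ox) ->; rewrite feE// mulrC.
    rewrite [LHS](@Rint_supp _ Om1); last by move=> x nx; rewrite fe0// mul0r.
    by rewrite [RHS](@Rint_supp _ Om)// => x nx; rewrite dout// mulr0.
  (* Translating by 1 in each half moves the shifts from [phi] to the square of [fe]: [phi (x - 1)]
     pairs with [sp] and [phi (x + 1)] with [sm]. *)
  have A2 : \int[mu]_(x in Om1) (jump phi x * fh x ^+ 2 / 2) =
      2^-1 * (\int[mu]_x (phi x * sp x) - \int[mu]_x (phi x * sm x)).
    have ip' := intb_shift (- 1) ip; have im' := intb_shift 1 im.
    rewrite -(Rint_shift (- 1) ip) -(Rint_shift 1 im) -RintegralB//.
    rewrite -RintegralZl//; last exact: intbB.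
    rewrite -[RHS](@Rint_supp _ Om1); last first.
      by move=> x nx; rewrite /sp /sm subrK addrK fe0// expr0n/= !mulr0 subrr mulr0.
    apply: eq_Rintegral => x /set_mem Ox.
    by rewrite /sp /sm subrK addrK feE// /jump; ring.
  have := first_variation um Dp pH; rewrite RintegralB; [|exact: mO1| |]; last first.
  - exact: L2M mO1 (wd_L21 pH) fL.
  - apply: (@intb_eq _ _ (fun x => 2^-1 * (jump phi x * fh x ^+ 2)));
      [by move=> x _; rewrite mulrC|exact: mO1|].
    apply: intbZ; first exact: mO1.
    apply: (@intb_bndM _ _ _ _ (2 * sup_bound L phi));
      [exact: mO1|exact: jump_meas| |exact: L2_sqr].
    by move=> x _; exact: jump_bound.
  rewrite -/fh A1 A2 => /eqP; rewrite subr_eq0 => /eqP <-.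
  rewrite (@Rint_supp _ Om); last by move=> x nx; rewrite out// mulr0.
  rewrite -RintegralB// -RintegralZl//; last exact: intbB.
  rewrite -mulN1r -RintegralZl//; last first.
    apply: (@intb_eq _ _ (fun x => phi x * h x));
      [by move=> x _; rewrite mulrC|exact: measurableT|].
    exact: bM.
  by apply: eq_Rintegral => x _; rewrite /h; ring.
have [k Hk] := weak_derivative_primitive LL fei hi weak.
(* The absolutely continuous representative is known only on [Omega]; elsewhere [fhat] itself is
   kept, since the nonlocal term evaluates [g] on all of [Omega1]. *)
pose g : RM -> R := fun x => if x \in Om then k + primitive h x else fh x.
have gO x : Om x -> g x = k + primitive h x by move=> Ox; rewrite /g mem_set.
have gE : {ae mu, forall x, Om1 x -> g x = fh x}.
  apply: ae_imply Hk => x Hx O1x; have [Ox|nOx] := pselect (Om x).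
    by rewrite gO// -Hx// feE.
  by rewrite /g memNset.
exists g, h; split.
- exact: gE.
- move=> e e0; have [dl dl0 H] := primitive_ac hi e0; exists dl => // n A B AB tAB sAB.
  have OA i : Om (A i) by have [ab sub] := AB i; apply: sub; rewrite /= in_itv/= lexx.
  have OB i : Om (B i) by have [ab sub] := AB i; apply: sub; rewrite /= in_itv/= lexx andbT.
  rewrite (eq_bigr (fun i => `|primitive h (B i) - primitive h (A i)|)).
    by apply: H => // i; have [] := AB i.
  by move=> i _; rewrite !gO// opprD addrACA subrr add0r.
- exact: (intbS measurableT mOm (@subsetT _ _) hi).
- apply: ae_imply (primitive_derive hi) => x dx Ox.
  have H2 : is_derive x 1 (fun y => k + primitive h y : R) (h x).
    have := is_deriveD (is_derive_cst k x 1) dx; rewrite add0r; exact.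
  apply: (near_eq_is_derive _ H2).
  have := near_in_itvoo Ox; apply: filterS => y Oy.
  by rewrite gO.
(* The null set where [g] differs from [fhat] is translated both ways, to control [g (x + 1)] and
   [g (x - 1)]. *)
- have gp := ae_shift 1 gE; have gm := ae_shift (- 1) gE.
  apply: ae_imply (ae_and gp gm) => x [Hp Hm] Ox; have [xm1 xp1] := Omega_shift Ox.
  by rewrite Hp// Hm// /h /sp /sm !feE//; ring.
Qed.

End EulerLagrange.

Unset Implicit Arguments.
Set Strict Implicit.

Theorem proposition3p1 (R : realType) (L a : R) (fbar : R -> R)
    (L_gt0 : 0 < L) (a_gt0 : 0 < a) (fbar_L2 : L2 (Omega1 L) fbar) :
  (forall lambda : R -> R, H10 (Omega L) lambda ->
     Stilde L a fbar lambda =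
       (if `[< admissible L a fbar lambda >] then SL L a fbar lambda else -oo)%E
     /\ (Stilde L a fbar lambda
           <= (a / 2)%:E * (L2norm (Omega1 L) fbar) ^+ 2)%E)
  /\
  (H10_concave (Omega L) (Stilde L a fbar) /\
   H10_upper_semicontinuous (Omega L) (Stilde L a fbar))
  /\
  H10_interior (Omega L) (domS L a fbar) =
    [set lambda | H10 (Omega L) lambda /\
                  forall x, Omega1 L x -> 0 < Delta a lambda x]
  /\
  (H10_coercive (Omega L) (fun lambda => - Stilde L a fbar lambda)%E /\
   exists lambda, H10_maximizer (Omega L) (Stilde L a fbar) lambda)
  /\
  (forall lambda, H10_maximizer (Omega L) (Stilde L a fbar) lambda ->
     H10_interior (Omega L) (domS L a fbar) lambda ->
     strong_solution L (fhat L a fbar lambda)).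
Proof.
have interiorE := interior_dom L_gt0 a_gt0 fbar_L2.
split.
  move=> u uH; split; first exact: Stilde_formula.
  rewrite (L2normE (measurable_Omega1 L) fbar_L2) -EFin_expe sqr_sqrtr ?sqn_ge0//.
  by rewrite -EFinM; exact: Stilde_upper.
split; first by split; [exact: Stilde_concave|exact: Stilde_usc].
split; first exact: interiorE.
split; first by split; [exact: Stilde_coercive|exact: Stilde_maximizer].
move=> u um; rewrite interiorE => -[_ Dp].
exact: maximizer_strong_solution.
Qed.
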